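(* Let $E$ be a self-adjoint operator on $\mathcal H$ such that $\{0,1\}\subset\sigma_{ess}(E)\subset[0,1]$. Let $\boldsymbol\lambda=(\lambda_j)_{j\in J}$ be the list of all eigenvalues of $E$ with multiplicity (possibly an empty list). Let $\boldsymbol d=(d_i)_{i\in I}$, $d_i=\langle Ee_i,e_i\rangle$, be the diagonal of $E$ with respect to some orthonormal basis $(e_i)_{i\in I}$ of $\mathcal H$. Define \[\delta^L=\liminf_{\beta\nearrow 0}(f_{\boldsymbol\lambda}(\beta)-f_{\boldsymbol d}(\beta)),\qquad \delta^U=\liminf_{\beta\searrow 1}(f_{\boldsymbol\lambda}(\beta)-f_{\boldsymbol d}(\beta)).\] Suppose that $f_{\boldsymbol d}(\alpha)<\infty$ for some $\alpha\in(0,1)$ and $\delta^L+\delta^U<\infty$. Then $E$ is diagonalizable and $\boldsymbol d$ has accumulation points at $0$ and $1$. Moreover, there exist $\delta_0\in[0,\delta^L]$ and $\delta_1\in[0,\delta^U]$ such that the following hold: (i) $f_{\boldsymbol\lambda}(\alpha)<\infty$ for all $\alpha\in(0,1)$; (ii) $f_{\boldsymbol\lambda}(\alpha)\le f_{\boldsymbol d}(\alpha)+(1-\alpha)\delta_0+\alpha\delta_1$ for all $\alpha\in(0,1)$; (iii) $f_{\boldsymbol\lambda}'(\alpha)-f_{\boldsymbol d}'(\alpha)\equiv\delta_1-\delta_0\mod 1$ for some $\alpha\in(0,1)$; (iv) if $\sum_{\lambda_j<0}|\lambda_j|<\infty$, then $\delta^L-\delta_0\le\delta^U-\delta_1$;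 (v) if $\sum_{\lambda_j>1}(\lambda_j-1)<\infty$, then $\delta^U-\delta_1\le\delta^L-\delta_0$. In addition, if for some $\alpha\in[0,1]$ the condition $(\mathfrak d_\alpha)$ holds, where $(\mathfrak d_0)$: $\delta^L=0$, or ($\delta_0=0$ and $\delta_1=\delta^U$); $(\mathfrak d_\alpha)$ for $\alpha\in(0,1)$: $f_{\boldsymbol\lambda}(\alpha)=f_{\boldsymbol d}(\alpha)+(1-\alpha)\delta_0+\alpha\delta_1$; $(\mathfrak d_1)$: $\delta^U=0$, or ($\delta_1=0$ and $\delta_0=\delta^L$), then $E$ decouples at the point $\alpha$: the spaces $\mathcal H_0=\overline{\operatorname{span}}\{e_i:d_i<\alpha\}$ and $\mathcal H_1=\overline{\operatorname{span}}\{e_i:d_i\ge\alpha\}$ are invariant subspaces of $E$, and $\sigma(E|_{\mathcal H_0})\subset(-\infty,\alpha]$, $\sigma(E|_{\mathcal H_1})\subset[\alpha,\infty)$.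
   Context: Hilbert spaces are separable and infinite-dimensional, operators are bounded. An operator is diagonalizable if the space has an orthonormal basis of its eigenvectors. Majorization function: for a countable real sequence $\boldsymbol d=(d_i)$ let $C_{\boldsymbol d}(\alpha)=\sum_{0\le d_i<\alpha}d_i$, $D_{\boldsymbol d}(\alpha)=\sum_{\alpha\le d_i\le1}(1-d_i)$, and $f_{\boldsymbol d}:\mathbb R\to[0,\infty]$, $f_{\boldsymbol d}(\alpha)=\sum_{d_i\le\alpha}(\alpha-d_i)$ for $\alpha\le0$; $f_{\boldsymbol d}(\alpha)=(1-\alpha)C_{\boldsymbol d}(\alpha)+\alpha D_{\boldsymbol d}(\alpha)$ for $\alpha\in(0,1)$; $f_{\boldsymbol d}(\alpha)=\sum_{d_i\ge\alpha}(d_i-\alpha)$ for $\alpha\ge1$. When finite on $(0,1)$ it is piecewise linear there; statements on derivatives at $\alpha$ mean that the functions involved are differentiable at $\alpha$. $x$ is an accumulation point of $(d_i)_{i\in I}$ if for every $\varepsilon>0$ there are infinitely many $i\in I$ with $|x-d_i|<\varepsilon$. *)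

(* Defs.v *)
From HB Require Import structures.
From mathcomp Require Import all_boot all_order all_algebra.
From mathcomp Require Import sesquilinear complex.
From mathcomp Require Import all_classical all_reals all_analysis.

Set Implicit Arguments.
Unset Strict Implicit.
Unset Printing Implicit Defensive.

Import Order.TTheory GRing.Theory Num.Theory.
Import numFieldNormedType.Exports.

Local Open Scope classical_set_scope.
Local Open Scope complex_scope.
Local Open Scope ring_scope.

(* Inner products are linear in the first argument. A Hilbert space is a
   complete normed space [H] over [R[i]] together with [ip : {dot H for conjC}]
   such that [hilbert_norm ip]. Norms take values in [R[i]]. *)

Section Hilbert.
Context {R : realType} {H : completeNormedModType R[i]}.
Implicit Types (ip : {dot H for (@Num.conj R[i])}) (V A : set H)
  (T S : H -> H) (mu : R[i]).

Definition hilbert_norm ip := forall x : H, `|x| ^+ 2 = ip x x.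

Definition linspan A : set H :=
  [set x | exists n (c : 'I_n -> R[i]) (v : 'I_n -> H),
     (forall k, A (v k)) /\ x = \sum_(k < n) c k *: v k].

Definition clspan A : set H := closure (linspan A).

Definition finite_dimensional V :=
  exists n (v : 'I_n -> H), V `<=` linspan (range v).

Definition separable_space := exists2 A : set H, countable A & dense A.

Definition orthonormal_basis_of ip (I : eqType) (B : set I) (e : I -> H) V :=
  (forall i j, B i -> B j -> ip (e i) (e j) = (i == j)%:R) /\
  clspan (e @` B) = V.

Definition orthonormal_basis ip (I : eqType) (e : I -> H) :=
  orthonormal_basis_of ip setT e setT.

Definition bounded_on V T :=
  exists M : R, forall x, V x -> `|T x| <= M%:C * `|x|.

Definition linear_on V T :=
  forall (a : R[i]) x y, V x -> V y -> T (a *: x + y) = a *: T x + T y.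

Definition invariant_under T V := forall x, V x -> V (T x).

Definition self_adjoint ip T := forall x y, ip (T x) y = ip x (T y).

Definition shift T mu : H -> H := fun x => T x - mu *: x.

Definition eigenspace_of T mu : set H := [set x | T x = mu *: x].

Definition diagonalizable_op ip T :=
  exists (K : countType) (v : K -> H),
    orthonormal_basis ip v /\ forall k, exists mu, eigenspace_of T mu (v k).

(* [spectrum_on T V] is the spectrum of the restriction of [T] to the subspace
   [V], viewed as an operator on [V]; it is meant for [V] invariant under
   [T], and values of the inverse [S] outside [V] are irrelevant. *)
Definition invertible_on V T :=
  exists S, [/\ invariant_under S V, linear_on V S, bounded_on V S,
                (forall x, V x -> S (T x) = x) & (forall x, V x -> T (S x) = x)].

Definition spectrum_on T V : set R[i] :=
  [set mu | ~ invertible_on V (shift T mu)].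

Definition fredholm T :=
  [/\ finite_dimensional [set x | T x = 0],
      closed (range T) &
      exists n (v : 'I_n -> H), forall y, exists x, linspan (range v) (y - T x)].

Definition essential_spectrum T : set R[i] :=
  [set mu | ~ fredholm (shift T mu)].

(* Every complex number [mu] occurs in [l] exactly as many times as the Hilbert
   dimension of its eigenspace; for other numbers than eigenvalues this
   dimension is 0. *)
Definition eigenvalue_list ip T (J : countType) (l : J -> R) :=
  forall mu, exists v : J -> H,
    orthonormal_basis_of ip [set j | (l j)%:C = mu] v (eigenspace_of T mu).

Definition decouples_at T (I : countType) (e : I -> H) (d : I -> R) (a : R) :=
  let H0 := clspan (e @` [set i | d i < a]) in
  let H1 := clspan (e @` [set i | a <= d i]) in
  [/\ invariant_under T H0, invariant_under T H1,
      spectrum_on T H0 `<=` [set t%:C | t in [set t : R | t <= a]] &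
      spectrum_on T H1 `<=` [set t%:C | t in [set t : R | a <= t]]].

End Hilbert.

Section Majorization.
Context {R : realType}.
Local Open Scope ereal_scope.

Definition majC (I : countType) (d : I -> R) (a : R) : \bar R :=
  \esum_(i in [set i | (0 <= d i < a)%R]) (d i)%:E.

Definition majD (I : countType) (d : I -> R) (a : R) : \bar R :=
  \esum_(i in [set i | (a <= d i <= 1)%R]) (1 - d i)%:E.

Definition majf (I : countType) (d : I -> R) (a : R) : \bar R :=
  if (a <= 0)%R then \esum_(i in [set i | (d i <= a)%R]) (a - d i)%:E
  else if (a < 1)%R then (1 - a)%:E * majC d a + a%:E * majD d a
  else \esum_(i in [set i | (a <= d i)%R]) (d i - a)%:E.

Definition deltaL (I J : countType) (l : J -> R) (d : I -> R) : \bar R :=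
  limf_einf (fun b => majf l b - majf d b) (0%R : R)^'-.

Definition deltaU (I J : countType) (l : J -> R) (d : I -> R) : \bar R :=
  limf_einf (fun b => majf l b - majf d b) (1%R : R)^'+.

(* [fine] sends infinite values to 0, hence the first condition. *)
Definition ediff_at (f : R -> \bar R) (a : R) :=
  (\forall x \near a, f x \is a fin_num) /\ derivable (fine \o f) a 1.

Definition accumulation_point (I : countType) (d : I -> R) (x : R) :=
  forall eps : R, (0 < eps)%R -> infinite_set [set i | (`|x - d i| < eps)%R].

Definition decoupling_condition (I J : countType) (l : J -> R) (d : I -> R)
    (d0 d1 a : R) :=
  [\/ a = 0%R /\ (deltaL l d = 0 \/ (d0 = 0%R /\ d1%:E = deltaU l d)),
      (0 < a < 1)%R /\ majf l a = majf d a + ((1 - a) * d0 + a * d1)%:E |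
      a = 1%R /\ (deltaU l d = 0 \/ (d1 = 0%R /\ d0%:E = deltaL l d))].

End Majorization.

(* Main.v *)
Require Import Defs.
From HB Require Import structures.
From mathcomp Require Import all_boot all_order all_algebra.
From mathcomp Require Import sesquilinear complex ring lra finmap.
From mathcomp Require Import all_classical all_reals all_analysis.

Set Implicit Arguments.
Unset Strict Implicit.
Unset Printing Implicit Defensive.

Import Order.TTheory GRing.Theory Num.Theory.
Import numFieldNormedType.Exports.

Local Open Scope classical_set_scope.
Local Open Scope complex_scope.
Local Open Scope ring_scope.

(* Let v be orthonormal eigenvectors for the list l, let w_ij = |<e_i, v_j>|^2,
   and let t_i and s_i be the values at e_i of the quadratic forms of E and 1 - E
   on the orthogonal complement of the v_j, where 0 <= E <= 1. Each row (w_i, t_i,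
   s_i) is a probability distribution on {l_j} together with the points 1 and 0,
   with mean d_i. Its excess at a is the average of (x - a)_+ if d_i < a and of
   (a - x)_+ otherwise. Summing over i, with total excess T(a),
     f_l(a) = f_d(a) + T(a)                       for a <= 0 and a >= 1,
     T(a) <= f_d(a) + (1 - a) T(0) + a T(1)       for 0 < a < 1,
   and once the v_j are known to be complete the gap in the second line is
   exactly f_l(a). Fatou's lemma bounds T(0) and T(1) by the two liminfs, so T(a)
   is finite and the restriction of E - E^2 to the complement of the v_j has
   finite trace; if it were nonzero it would have an eigenvector, and so would E.
   Hence E is diagonalizable. With delta_0 = T(0) and delta_1 = T(1) everything
   else is read off T: T(a) = 0 forces w_ij = 0 whenever d_i and l_j lie on
   opposite sides of a, and the slope of T away from the values of d and l is the
   index of a pair of projections with Hilbert-Schmidt difference, an integer. *)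

(** No spectral measure of E is used. On the complement of the eigenvectors, the spectral
    distribution seen by e_i is replaced by two masses, t_i at 1 and s_i at 0, with the same total
    and the same mean. Functions that are affine on [0, 1] do not notice the replacement, so levels
    outside (0, 1) keep exact identities.

    At the levels 0 and 1 themselves f_l and f_d may both be infinite. Their difference is therefore
    formed only at levels below 0 or above 1, where f_l is finite because only finitely many
    eigenvalues lie beyond such a level. Fatou's lemma loses mass in the limit, which is why delta_0
    and delta_1 can be smaller than the two liminfs.

    The operator theory rests on one device: the powers of a positive contraction converge strongly
    to the projection onto its fixed vectors. It yields kernel projections for closed range
    operators, eigenvectors of positive operators with finite trace, and the integer attached to a
    pair of projections. *)

(** * Sums of nonnegative families *)

Section NonnegativeSums.
Context {R : realType}.
Implicit Types (T U : choiceType).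

(** Real terms with an extended real total: termwise identities stay within reach of [ring] and
    [lra], and only the total can be infinite. *)
Definition nsum {T} (f : T -> R) : \bar R := (\esum_(i in setT) (f i)%:E)%E.

Lemma nsum_seq_le T (f : T -> R) (s : seq T) : (forall i, 0 <= f i) -> uniq s ->
  ((\sum_(i <- s) f i)%:E <= nsum f)%E.
Proof.
move=> f0 us; apply: esum_ge; exists [set` s]; first by split => //; exact: finite_seq.
by rewrite -fsbig_seq// -sumEFin.
Qed.

Lemma nsum_le_seq T (f : T -> R) (M : \bar R) :
  (forall s : seq T, uniq s -> ((\sum_(i <- s) f i)%:E <= M)%E) -> (nsum f <= M)%E.
Proof.
move=> h; rewrite /nsum /esum; apply: ge_ereal_sup => _ [X [finX _]] <-.
by rewrite fsbig_finite//= sumEFin; apply: h; exact: fset_uniq.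
Qed.

Lemma nsum_gt_seq T (f : T -> R) (M : R) : (M%:E < nsum f)%E ->
  exists2 s : seq T, uniq s & M < \sum_(i <- s) f i.
Proof.
move=> h; apply: contrapT => hn; move: h; apply/negP; rewrite -leNgt.
apply: nsum_le_seq => s us; rewrite lee_fin leNgt; apply/negP => h.
by apply: hn; exists s.
Qed.

Lemma nsum_ge0 T (f : T -> R) : (forall i, 0 <= f i) -> (0 <= nsum f)%E.
Proof. by move=> f0; apply: esum_ge0 => i _; rewrite lee_fin. Qed.

Lemma le_nsum T (f g : T -> R) : (forall i, f i <= g i) -> (nsum f <= nsum g)%E.
Proof. by move=> fg; apply: le_esum => i _; rewrite lee_fin. Qed.

Lemma eq_nsum T (f g : T -> R) : f =1 g -> nsum f = nsum g.
Proof. by move=> fg; apply: eq_esum => i _; rewrite fg. Qed.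

Lemma nsumD T (f g : T -> R) : (forall i, 0 <= f i) -> (forall i, 0 <= g i) ->
  nsum (fun i => f i + g i) = (nsum f + nsum g)%E.
Proof. by move=> f0 g0; rewrite /nsum -esumD// => i _; rewrite lee_fin. Qed.

Lemma le_nsum1 T (f : T -> R) i : (forall i, 0 <= f i) -> ((f i)%:E <= nsum f)%E.
Proof. by move=> f0; have := @nsum_seq_le T f [:: i] f0 isT; rewrite big_seq1. Qed.

Lemma esumZ T (f : T -> \bar R) (c : R) : (forall i, (0 <= f i)%E) -> 0 <= c ->
  (\esum_(i in setT) (c%:E * f i) = c%:E * \esum_(i in setT) f i)%E.
Proof.
move=> f0 c0; rewrite /esum -ereal_supZl//; last first.
  by apply/set0P; exists 0%E, set0; [exact: fsets_set0|rewrite fsbig_set0].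
congr ereal_sup; apply/seteqP; split => [_ [X [fX XT]] <-|_ [_ [X [fX XT]] <-] <-].
  exists (\sum_(x \in X) f x)%E; first by exists X.
  by rewrite ge0_mule_fsumr.
by exists X => //; rewrite ge0_mule_fsumr.
Qed.

Lemma nsumZ T (f : T -> R) (c : R) : (forall i, 0 <= f i) -> 0 <= c ->
  nsum (fun i => c * f i) = (c%:E * nsum f)%E.
Proof.
move=> f0 c0; rewrite /nsum -esumZ//.
Qed.

Lemma esum_swap T U (f : T -> U -> \bar R) : (forall i j, (0 <= f i j)%E) ->
  (\esum_(i in setT) \esum_(j in setT) f i j =
   \esum_(j in setT) \esum_(i in setT) f i j)%E.
Proof.
move=> f0; rewrite !esum_esum//.
rewrite (reindex_esum ([set: U] `*`` (fun=> [set: T])) _ (fun k => (k.2, k.1)))//.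
split; first by move=> [].
- by move=> [a b] [c d] _ _ /= [-> ->].
- by move=> [a b] _; exists (b, a).
Qed.

Lemma nsum0 T (f : T -> R) : (forall i, 0 <= f i) -> (nsum f <= 0)%E ->
  forall i, f i = 0.
Proof.
move=> f0 h i; apply/eqP; rewrite eq_le f0 andbT -lee_fin.
exact: le_trans (le_nsum1 i f0) h.
Qed.

(* Fatou's lemma for the counting measure. *)
Lemma nsum_fatou T (V : Type) (F : set_system V) {FF : Filter F}
    (f : V -> T -> R) (g : T -> R) (M : R) :
  (forall v i, 0 <= f v i) -> (forall i, f ^~ i @ F --> g i) ->
  (M%:E < nsum g)%E -> \forall v \near F, (M%:E < nsum (f v))%E.
Proof.
move=> f0 fg /nsum_gt_seq[s us Ms].
have cs : (fun v => \sum_(i <- s) f v i) @ F --> \sum_(i <- s) g i.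
  by apply: cvg_big => //; exact: add_continuous.
have : \forall v \near F, M < \sum_(i <- s) f v i by apply: (cvgr_gt _ cs).
apply: filterS => v h; apply: lt_le_trans (nsum_seq_le (f0 v) us).
by rewrite lte_fin.
Qed.

(** As the first sum is finite, one can subtract: Fatou for the differences [f 0 - f n] bounds the
    sums from above, and [g <= f n] bounds them from below. *)
Lemma nsum_decr T (f : nat -> T -> R) (g : T -> R) :
  (forall n i, 0 <= f n i) -> (forall n i, f n.+1 i <= f n i) ->
  (forall i, f ^~ i @ \oo --> g i) -> (nsum (f 0%N) < +oo)%E ->
  fine (nsum (f n)) @[n --> \oo] --> fine (nsum g).
Proof.
move=> f0 fd fg fin0.
have fle m n i : (m <= n)%N -> f n i <= f m i.
  by move=> /subnK <-; elim: (_ - m)%N => // k; apply: le_trans; exact: fd.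
have g0 i : 0 <= g i.
  by apply: (cvgr_to_ge (fg i)); apply: nearW.
have gle n i : g i <= f n i.
  apply: (cvgr_to_le (fg i)); near=> m; apply: fle; near: m; exact: nbhs_infty_ge.
have fin n : nsum (f n) \is a fin_num.
  rewrite ge0_fin_numE ?nsum_ge0//; apply: le_lt_trans fin0.
  by apply: le_nsum => i; exact: fle.
have fing : nsum g \is a fin_num.
  rewrite ge0_fin_numE ?nsum_ge0//; apply: le_lt_trans fin0.
  by apply: le_nsum => i; exact: gle.
apply/cvgrPdist_lt => e e0.
have cd i : (fun n => f 0%N i - f n i) @ \oo --> f 0%N i - g i.
  by apply: cvgB => //; exact: cvg_cst.
have h0 i : 0 <= f 0%N i - g i by rewrite subr_ge0.
have hn n i : 0 <= f 0%N i - f n i by rewrite subr_ge0 fle.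
have E0 : nsum (f 0%N) = (nsum g + nsum (fun i => (f 0%N i - g i)%R))%E.
  by rewrite -nsumD//; apply: eq_nsum => i; rewrite addrC subrK.
have En n : nsum (f 0%N) = (nsum (f n) + nsum (fun i => (f 0%N i - f n i)%R))%E.
  by rewrite -nsumD//; apply: eq_nsum => i; rewrite addrC subrK.
have fd0 : nsum (fun i => f 0%N i - g i) \is a fin_num.
  rewrite ge0_fin_numE ?nsum_ge0//; apply: le_lt_trans fin0.
  by apply: le_nsum => i; rewrite gerBl.
have fdn n : nsum (fun i => f 0%N i - f n i) \is a fin_num.
  rewrite ge0_fin_numE ?nsum_ge0//; apply: le_lt_trans fin0.
  by apply: le_nsum => i; rewrite gerBl.
have := nsum_fatou (M := fine (nsum (fun i => f 0%N i - g i)) - e) hn cd.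
rewrite -[X in (_ < X)%E](fineK fd0) lte_fin ltrBlDr ltrDl => /(_ _ e0).
apply: filterS => n; rewrite -(fineK (fdn n)) lte_fin.
have := E0; have := En n.
rewrite -(fineK (fin n)) -(fineK (fdn n)) -(fineK fd0) -(fineK fing) => -> /=.
rewrite -!EFinD => -[] h1 h2.
have : fine (nsum g) <= fine (nsum (f n)).
  by apply: fine_le => //; apply: le_nsum => i; exact: gle.
move=> h3; rewrite ler0_norm; lra.
Unshelve. all: by end_near. Qed.

End NonnegativeSums.

(** * Absolutely convergent real sums *)

Section AbsoluteSums.
Context {R : realType} {T : choiceType}.
Implicit Types (f g p q : T -> R).

Definition absum f := (nsum (fun i => `|f i|%R) < +oo)%E.

(** [fine] turns an infinite part into 0, so the value is a sum only under [absum]. *)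
Definition rsum f : R :=
  fine (nsum (fun i => Num.max (f i) 0)) - fine (nsum (fun i => Num.max (- f i) 0)).

Lemma nsum_fin f : (forall i, 0 <= f i) -> (nsum f < +oo)%E -> nsum f \is a fin_num.
Proof. by move=> f0 h; rewrite ge0_fin_numE ?nsum_ge0. Qed.

Lemma nsum_dom f g : (forall i, f i <= g i) -> (nsum g < +oo)%E -> (nsum f < +oo)%E.
Proof. by move=> fg; apply: le_lt_trans; exact: le_nsum. Qed.

Lemma nsumD_lty f g : (forall i, 0 <= f i) -> (forall i, 0 <= g i) ->
  (nsum f < +oo)%E -> (nsum g < +oo)%E -> (nsum (fun i => (f i + g i)%R) < +oo)%E.
Proof. by move=> f0 g0 hf hg; rewrite nsumD// lte_add_pinfty. Qed.

Lemma nsumZ_lty f c : (forall i, 0 <= f i) -> 0 <= c -> (nsum f < +oo)%E ->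
  (nsum (fun i => (c * f i)%R) < +oo)%E.
Proof. by move=> f0 c0 hf; rewrite nsumZ// lte_mul_pinfty// lee_fin. Qed.

Lemma nsumD_fin f g : (forall i, 0 <= f i) -> (forall i, 0 <= g i) ->
  (nsum f < +oo)%E -> (nsum g < +oo)%E ->
  fine (nsum (fun i => f i + g i)) = fine (nsum f) + fine (nsum g).
Proof. by move=> f0 g0 ff gg; rewrite nsumD// fineD// nsum_fin. Qed.

Lemma absumE f : (forall i, 0 <= f i) -> absum f = (nsum f < +oo)%E.
Proof. by move=> f0; rewrite /absum; congr (_ < _)%E; apply: eq_nsum => i; rewrite ger0_norm. Qed.

Lemma absum_dom f g : (forall i, `|f i| <= g i) -> absum g -> absum f.
Proof.
move=> fg; apply: nsum_dom => i; apply: le_trans (fg i) _; exact: ler_norm.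
Qed.

Lemma absumD f g : absum f -> absum g -> absum (fun i => f i + g i).
Proof.
rewrite /absum => hf hg; apply: (@nsum_dom _ (fun i => `|f i| + `|g i|)).
  by move=> i; exact: ler_normD.
by rewrite nsumD// lte_add_pinfty.
Qed.

Lemma absumZ c f : absum f -> absum (fun i => c * f i).
Proof.
rewrite /absum => hf; rewrite (@eq_nsum _ _ _ (fun i => `|c| * `|f i|)).
  by rewrite nsumZ// lte_mul_pinfty// lee_fin.
by move=> i; rewrite normrM.
Qed.

(** The value does not depend on the splitting into summable nonnegative parts. Polarization
    identities use it with two families of squares as [p] and [q]. *)
Lemma rsum_split f p q : (forall i, 0 <= p i) -> (forall i, 0 <= q i) ->
  (nsum p < +oo)%E -> (nsum q < +oo)%E -> (forall i, f i = p i - q i) ->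
  rsum f = fine (nsum p) - fine (nsum q).
Proof.
move=> p0 q0 hp hq fE.
have a0 i : 0 <= Num.max (f i) 0 by rewrite le_max lexx orbT.
have b0 i : 0 <= Num.max (- f i) 0 by rewrite le_max lexx orbT.
have ap i : Num.max (f i) 0 <= p i.
  by rewrite ge_max p0 andbT fE gerBl.
have bq i : Num.max (- f i) 0 <= q i.
  by rewrite ge_max q0 andbT fE opprB gerBl.
have ha := nsum_dom ap hp. have hb := nsum_dom bq hq.
rewrite /rsum; apply/eqP; rewrite subr_eq addrAC eq_sym subr_eq.
rewrite -!nsumD_fin//; apply/eqP; congr fine; apply: eq_nsum => i.
rewrite fE; case: (leP (p i - q i) 0) => h1; case: (leP (- (p i - q i)) 0) => h2; lra.
Qed.

Lemma rsum_ge0E f : (forall i, 0 <= f i) -> (nsum f < +oo)%E -> rsum f = fine (nsum f).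
Proof.
move=> f0 hf; have z : nsum (fun _ : T => 0 : R) = 0%E by rewrite /nsum esum1.
by rewrite (@rsum_split f f (fun=> 0))// ?z ?ltry//= ?subr0// => i; rewrite subr0.
Qed.

Lemma eq_rsum f g : f =1 g -> rsum f = rsum g.
Proof. by move=> /funext ->. Qed.

Lemma absum_posneg f : absum f ->
  [/\ (forall i, 0 <= Num.max (f i) 0), (forall i, 0 <= Num.max (- f i) 0),
      (nsum (fun i => Num.max (f i) 0%R) < +oo)%E,
      (nsum (fun i => Num.max (- f i)%R 0%R) < +oo)%E &
      (forall i, f i = Num.max (f i) 0 - Num.max (- f i) 0)].
Proof.
move=> hf; split.
- by move=> i; rewrite le_max lexx orbT.
- by move=> i; rewrite le_max lexx orbT.
- by apply: nsum_dom hf => i; rewrite ge_max normr_ge0 ler_norm.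
- by apply: nsum_dom hf => i; rewrite ge_max normr_ge0 -normrN ler_norm.
by move=> i; case: (leP (f i) 0) => h1; case: (leP (- f i) 0) => h2; lra.
Qed.

Lemma rsumD f g : absum f -> absum g -> rsum (fun i => f i + g i) = rsum f + rsum g.
Proof.
move=> /absum_posneg[a0 b0 ha hb fE] /absum_posneg[c0 d0 hc hd gE].
rewrite (@rsum_split _ (fun i => Num.max (f i) 0 + Num.max (g i) 0)
  (fun i => Num.max (- f i) 0 + Num.max (- g i) 0)).
- by rewrite !nsumD_fin// /rsum; ring.
- by move=> i; rewrite addr_ge0.
- by move=> i; rewrite addr_ge0.
- by rewrite nsumD// lte_add_pinfty.
- by rewrite nsumD// lte_add_pinfty.
by move=> i; rewrite {1}fE {1}gE; ring.
Qed.

Lemma nsumZ_fin f c : (forall i, 0 <= f i) -> 0 <= c -> (nsum f < +oo)%E ->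
  fine (nsum (fun i => c * f i)) = c * fine (nsum f).
Proof. by move=> f0 c0 hf; rewrite nsumZ// fineM// nsum_fin. Qed.

Lemma rsumZ c f : absum f -> rsum (fun i => c * f i) = c * rsum f.
Proof.
move=> /absum_posneg[a0 b0 ha hb fE].
have [c0|c0] := leP 0 c.
  rewrite (@rsum_split _ (fun i => c * Num.max (f i) 0) (fun i => c * Num.max (- f i) 0)).
  - by rewrite !nsumZ_fin// /rsum mulrBr.
  - by move=> i; rewrite mulr_ge0.
  - by move=> i; rewrite mulr_ge0.
  - by rewrite nsumZ// lte_mul_pinfty// lee_fin.
  - by rewrite nsumZ// lte_mul_pinfty// lee_fin.
  by move=> i; rewrite {1}fE mulrBr.
have c1 : 0 <= - c by lra.
rewrite (@rsum_split _ (fun i => - c * Num.max (- f i) 0) (fun i => - c * Num.max (f i) 0)).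
- by rewrite !nsumZ_fin// /rsum; ring.
- by move=> i; rewrite mulr_ge0.
- by move=> i; rewrite mulr_ge0.
- by rewrite nsumZ// lte_mul_pinfty// lee_fin.
- by rewrite nsumZ// lte_mul_pinfty// lee_fin.
by move=> i; rewrite {1}fE; ring.
Qed.

Lemma rsum_ge0 f : (forall i, 0 <= f i) -> 0 <= rsum f.
Proof.
move=> f0; have z : nsum (fun i => Num.max (- f i) 0) = 0%E.
  rewrite /nsum esum1// => i _; congr EFin; apply/eqP.
  by rewrite eq_le ge_max le_max lexx orbT andbT oppr_le0 f0.
rewrite /rsum z subr0 fine_ge0// nsum_ge0// => i.
by rewrite le_max lexx orbT.
Qed.

End AbsoluteSums.

(** * Real-valued calculus of the complex inner product *)

Section InnerProduct.
Context {R : realType} {H : completeNormedModType R[i]}.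
Variable ip : {dot H for (@Num.conj R[i])}.

(** Norms and inner products are complex numbers here; estimates are made in [R], with the real part
    [rip], the squared norm [sq] and the squared modulus [cw]. *)
Definition rip (x y : H) : R := complex.Re (ip x y).
Definition sq x := rip x x.
Definition cw (x y : H) : R := complex.Re (ip x y) ^+ 2 + complex.Im (ip x y) ^+ 2.

Lemma CM (a b : R) : (a * b)%:C = a%:C * b%:C. Proof. exact: rmorphM. Qed.
Lemma CB (a b : R) : (a - b)%:C = a%:C - b%:C. Proof. exact: rmorphB. Qed.
Lemma conjR (a : R) : (a%:C : R[i])^* = a%:C. Proof. exact: conjc_real. Qed.
Lemma ipDl x y z : ip (x + y) z = ip x z + ip y z. Proof. exact: linearDl. Qed.
Lemma ipDr x y z : ip x (y + z) = ip x y + ip x z. Proof. exact: linearDr. Qed.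
Lemma ipNl x z : ip (- x) z = - ip x z. Proof. exact: linearNl. Qed.
Lemma ipNr x z : ip x (- z) = - ip x z. Proof. exact: linearNr. Qed.
Lemma ipBl x y z : ip (x - y) z = ip x z - ip y z. Proof. by rewrite ipDl ipNl. Qed.
Lemma ipBr x y z : ip x (y - z) = ip x y - ip x z. Proof. by rewrite ipDr ipNr. Qed.
Lemma ipZl a x z : ip (a *: x) z = a * ip x z. Proof. exact: linearZl_LR. Qed.
Lemma ipZr a x z : ip x (a *: z) = a^* * ip x z. Proof. exact: linearZr_LR. Qed.
Lemma ipC x y : ip x y = (ip y x)^*. Proof. by rewrite hermC expr0 mul1r. Qed.
Lemma ip0l x : ip 0 x = 0. Proof. exact: linear0l. Qed.
Lemma ip0r x : ip x 0 = 0. Proof. exact: linear0r. Qed.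

Lemma ip_ge0 x : 0 <= ip x x. Proof. exact: dnorm_ge0. Qed.
Lemma ipxx x : ip x x = (sq x)%:C.
Proof. by have := ip_ge0 x; rewrite lecE => /andP[/eqP h _];
  rewrite [LHS]complexE h mulr0 addr0. Qed.

Lemma ripC x y : rip x y = rip y x. Proof. by rewrite /rip ipC; case: (ip y x). Qed.
Lemma ReD (a b : R[i]) : complex.Re (a + b) = complex.Re a + complex.Re b.
Proof. by case: a; case: b. Qed.
Lemma ReN (a : R[i]) : complex.Re (- a) = - complex.Re a. Proof. by case: a. Qed.
Lemma ReZ a (b : R[i]) : complex.Re (a%:C * b) = a * complex.Re b.
Proof. by case: b => b c /=; rewrite mul0r subr0. Qed.
Lemma ripDl x y z : rip (x + y) z = rip x z + rip y z. Proof. by rewrite /rip ipDl ReD. Qed.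
Lemma ripDr x y z : rip x (y + z) = rip x y + rip x z. Proof. by rewrite /rip ipDr ReD. Qed.
Lemma ripNl x z : rip (- x) z = - rip x z. Proof. by rewrite /rip ipNl ReN. Qed.
Lemma ripNr x z : rip x (- z) = - rip x z. Proof. by rewrite /rip ipNr ReN. Qed.
Lemma ripBl x y z : rip (x - y) z = rip x z - rip y z. Proof. by rewrite ripDl ripNl. Qed.
Lemma ripBr x y z : rip x (y - z) = rip x y - rip x z. Proof. by rewrite ripDr ripNr. Qed.
Lemma ripZl a x z : rip (a%:C *: x) z = a * rip x z. Proof. by rewrite /rip ipZl ReZ. Qed.
Lemma ripZr a x z : rip x (a%:C *: z) = a * rip x z. Proof. by rewrite ripC ripZl ripC. Qed.
Lemma rip0l x : rip 0 x = 0. Proof. by rewrite /rip ip0l. Qed.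
Lemma rip0r x : rip x 0 = 0. Proof. by rewrite /rip ip0r. Qed.

Lemma ripE x y : rip x y = complex.Re (ip x y). Proof. by []. Qed.
Lemma rip_ip0 x y : ip x y = 0 -> rip x y = 0. Proof. by rewrite /rip => ->. Qed.

Lemma sq_ge0 x : 0 <= sq x.
Proof. by have := ip_ge0 x; rewrite ipxx ler0c. Qed.
Lemma sq0 : sq 0 = 0. Proof. by rewrite /sq rip0l. Qed.
Lemma sq_eq0 x : sq x = 0 -> x = 0.
Proof. by move=> h; apply/eqP; rewrite -(dnorm_eq0 ip) ipxx h. Qed.
Lemma sqD x y : sq (x + y) = sq x + 2 * rip x y + sq y.
Proof. by rewrite /sq ripDl !ripDr (ripC y x); ring. Qed.
Lemma sqB x y : sq (x - y) = sq x - 2 * rip x y + sq y.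
Proof. by rewrite /sq ripBl !ripBr (ripC y x); ring. Qed.
Lemma sqN x : sq (- x) = sq x.
Proof. by rewrite /sq ripNl ripNr opprK. Qed.
Lemma sqBC x y : sq (x - y) = sq (y - x).
Proof. by rewrite -sqN opprB. Qed.
Lemma sqZ a x : sq (a *: x) = (complex.Re a ^+ 2 + complex.Im a ^+ 2) * sq x.
Proof.
apply: complexI; rewrite -ipxx ipZl ipZr mulrA -sqr_normc -add_Re2_Im2 ipxx.
by rewrite -rmorphM.
Qed.
Lemma sqZr a x : sq (a%:C *: x) = a ^+ 2 * sq x.
Proof. by rewrite sqZ /= expr0n addr0. Qed.

Lemma cwC x y : cw x y = cw y x.
Proof. by rewrite /cw ipC; case: (ip y x) => a b /=; rewrite sqrrN. Qed.
Lemma cw_ge0 x y : 0 <= cw x y. Proof. by rewrite addr_ge0// sqr_ge0. Qed.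
Lemma cwE x y : (cw x y)%:C = ip x y * (ip x y)^*.
Proof. by rewrite -sqr_normc -add_Re2_Im2. Qed.
Lemma cw_eq0 x y : cw x y = 0 -> ip x y = 0.
Proof.
by move=> h; apply/eqP; move: (cwE x y); rewrite h => /esym/eqP;
  rewrite mulf_eq0 conjc_eq0 orbb.
Qed.
Lemma cw0 x y : ip x y = 0 -> cw x y = 0.
Proof. by rewrite /cw => -> /=; rewrite expr0n addr0. Qed.
Lemma rip2_le_cw x y : rip x y ^+ 2 <= cw x y.
Proof. by rewrite lerDl sqr_ge0. Qed.
Lemma cwBr_orth x y z : ip x z = 0 -> cw x (y - z) = cw x y.
Proof. by rewrite /cw ipBr => ->; rewrite subr0. Qed.
Lemma cw_le x y : cw x y <= sq x * sq y.
Proof.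
have [y0|y0] := eqVneq (sq y) 0.
  by rewrite (sq_eq0 y0) cw0 ?ip0r// sq0 mulr0.
have yp : 0 < sq y by rewrite lt_def y0 sq_ge0.
have := sq_ge0 ((sq y)%:C *: x - ip x y *: y).
suff -> : sq ((sq y)%:C *: x - ip x y *: y) = sq y * (sq x * sq y - cw x y).
  by rewrite pmulr_rge0// subr_ge0.
apply: complexI; rewrite -[LHS]ipxx ipBl !ipBr !ipZl !ipZr !CM CB CM cwE.
rewrite (ipC y x) conjR !ipxx; ring.
Qed.

Lemma rip_le x y : rip x y ^+ 2 <= sq x * sq y.
Proof. exact: le_trans (rip2_le_cw x y) (cw_le x y). Qed.

Definition nrm x := Num.sqrt (sq x).
Lemma nrm_ge0 x : 0 <= nrm x. Proof. exact: sqrtr_ge0. Qed.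
Lemma nrm2 x : nrm x ^+ 2 = sq x. Proof. by rewrite sqr_sqrtr// sq_ge0. Qed.
Lemma rip_nrm x y : `|rip x y| <= nrm x * nrm y.
Proof.
rewrite -(@ler_pXn2r _ 2)// ?nnegrE ?normr_ge0// ?mulr_ge0 ?nrm_ge0//.
by rewrite exprMn !nrm2 real_normK ?num_real// rip_le.
Qed.

Hypothesis hH : hilbert_norm ip.

Lemma normE x : `|x| = (nrm x)%:C.
Proof.
have h : `|x| ^+ 2 = ((nrm x)%:C) ^+ 2 by rewrite hH ipxx -nrm2 rmorphXn.
apply/eqP; rewrite -(@eqrXn2 _ 2)// ?h// ler0c; exact: nrm_ge0.
Qed.

Lemma nrmD x y : nrm (x + y) <= nrm x + nrm y.
Proof. by rewrite -lecR rmorphD/= -!normE ler_normD. Qed.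

Lemma norm_lt x (e : R) : 0 < e -> (`|x| < e%:C) = (sq x < e ^+ 2).
Proof.
by move=> e0; rewrite normE ltcR -nrm2 ltr_pXn2r// ?nnegrE ?nrm_ge0// ltW.
Qed.

Lemma pos_complex (e : R[i]) : 0 < e -> exists2 r : R, 0 < r & e = r%:C.
Proof.
rewrite ltcE /= => /andP[/eqP h r0]; exists (complex.Re e) => //.
by rewrite [LHS]complexE h mulr0 addr0.
Qed.

Definition hcvg (u : nat -> H) y := (fun n => sq (u n - y)) @ \oo --> (0 : R).

Lemma hcvgP u y : hcvg u y <->
  forall e, 0 < e -> exists N, forall n, (N <= n)%N -> sq (u n - y) < e.
Proof.
split=> [h e e0|h].
  have [N _ hN] := cvgr_lt _ h _ e0.
  by exists N => n Nn; apply: hN.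
apply/cvgrPdist_lt => e e0; have [N hN] := h e e0; exists N => // n Nn.
by rewrite sub0r normrN ger0_norm ?sq_ge0//; apply: hN.
Qed.

Lemma hcomplete u :
  (forall e : R, 0 < e ->
     exists N, forall m n, (N <= m)%N -> (N <= n)%N -> sq (u n - u m) < e) ->
  exists y, hcvg u y.
Proof.
move=> h; have : cvg (u @ \oo).
  apply: cauchy_cvg; apply: cauchy_exP => e /pos_complex[r r0 ->].
  have [N hN] := h (r ^+ 2) ltac:(by rewrite exprn_gt0).
  exists (u N), N => // n Nn /=; rewrite -ball_normE /ball_ /=.
  by rewrite norm_lt//; apply: hN.
move=> /cvg_ex[y /cvgrPdist_lt hy]; exists y; apply/hcvgP => e e0.
have s0 : 0 < Num.sqrt e by rewrite sqrtr_gt0.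
have := hy (Num.sqrt e)%:C; rewrite ltcR => /(_ s0)[N _ hN].
exists N => n /hN /=; rewrite norm_lt// sqr_sqrtr ?ltW// sqBC//.
Qed.

Lemma hclosureP (A : set H) y :
  closure A y <-> forall e, 0 < e -> exists2 a, A a & sq (y - a) < e.
Proof.
split=> [h e e0|h B /nbhs_ballP[e /= /pos_complex[r r0 ->] hB]].
  have s0 : 0 < Num.sqrt e by rewrite sqrtr_gt0.
  have [] := h (ball y (Num.sqrt e)%:C).
    by apply: nbhsx_ballx; rewrite ltcR.
  move=> a [Aa]; rewrite -ball_normE /ball_ /= norm_lt// sqr_sqrtr ?ltW// => ha.
  by exists a.
have [|a Aa ha] := h (r ^+ 2); first by rewrite exprn_gt0.
by exists a; split => //; apply: hB; rewrite -ball_normE /ball_ /= norm_lt.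
Qed.

End InnerProduct.

(** * Orthonormal families: Bessel, Parseval, Riesz-Fischer *)

Section Orthonormal.
Context {R : realType} {H : completeNormedModType R[i]}.
Variable ip : {dot H for (@Num.conj R[i])}.
Hypothesis hH : hilbert_norm ip.
Local Notation rip := (rip ip).
Local Notation sq := (sq ip).
Local Notation cw := (cw ip).
Local Notation hcvg := (hcvg ip).

Definition orthonormal_family (J : choiceType) (v : J -> H) :=
  forall i j, ip (v i) (v j) = (i == j)%:R.

Lemma ip_suml (J : Type) (s : seq J) (F : J -> H) z :
  ip (\sum_(j <- s) F j) z = \sum_(j <- s) ip (F j) z.
Proof. by elim/big_ind2: _ => [|? ? ? ? <- <-|//]; rewrite ?ip0l// ipDl. Qed.

Lemma ip_sumr (J : Type) (s : seq J) (F : J -> H) z :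
  ip z (\sum_(j <- s) F j) = \sum_(j <- s) ip z (F j).
Proof. by elim/big_ind2: _ => [|? ? ? ? <- <-|//]; rewrite ?ip0r// ipDr. Qed.

Definition nc (c : R[i]) : R := complex.Re c ^+ 2 + complex.Im c ^+ 2.
Lemma nc_ge0 c : 0 <= nc c. Proof. by rewrite addr_ge0// sqr_ge0. Qed.
Lemma ncE c : (nc c)%:C = c * c^*.
Proof. by rewrite -sqr_normc -add_Re2_Im2. Qed.
Lemma nc_eq0 c : nc c = 0 -> c = 0.
Proof.
by move=> h; apply/eqP; move: (ncE c); rewrite h => /esym/eqP; rewrite mulf_eq0 conjc_eq0 orbb.
Qed.
Lemma ncM a b : nc (a * b) = nc a * nc b.
Proof. case: a => a1 a2; case: b => b1 b2; rewrite /nc /=; ring. Qed.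
Lemma nc0 : nc 0 = 0. Proof. by rewrite /nc /= expr0n addr0. Qed.
Lemma nc_sum (J : Type) (s : seq J) (F : J -> R) :
  (\sum_(j <- s) F j)%:C = \sum_(j <- s) (F j)%:C :> R[i].
Proof. exact: rmorph_sum. Qed.

Lemma cw_nc x y : cw x y = nc (ip x y). Proof. by []. Qed.

Section Family.
Context (J : choiceType) (v : J -> H).
Hypothesis ov : orthonormal_family v.
Implicit Types (s : seq J) (c : J -> R[i]) (x y z : H).

Lemma onf_sq j : sq (v j) = 1.
Proof. by apply: complexI; rewrite -ipxx ov eqxx. Qed.

Definition comb s c := \sum_(j <- s) c j *: v j.

Lemma ip_comb s c j : uniq s -> ip (comb s c) (v j) = if j \in s then c j else 0.
Proof.
move=> us; rewrite ip_suml; under eq_bigr do rewrite ipZl ov.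
case: ifPn => js.
  rewrite (bigD1_seq j)//= eqxx mulr1 big1_seq ?addr0// => i /andP[ij _].
  by rewrite (negbTE ij) mulr0.
rewrite big1_seq// => i /andP[_ si]; case: eqP => [ij|]; last by rewrite mulr0.
by rewrite ij in si; rewrite si in js.
Qed.

Lemma sq_comb s c : uniq s -> sq (comb s c) = \sum_(j <- s) nc (c j).
Proof.
move=> us; apply: complexI; rewrite -ipxx {2}/comb ip_sumr nc_sum.
by apply: eq_big_seq => j js; rewrite ipZr ip_comb// js ncE mulrC.
Qed.

Lemma comb_span (B : set J) s c : (forall j, j \in s -> B j) ->
  linspan (v @` B) (comb s c).
Proof.
move=> sB; exists (size s), (fun k => c (tnth (in_tuple s) k)),
  (fun k => v (tnth (in_tuple s) k)); split; last by rewrite /comb big_tnth.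
by move=> k; exists (tnth (in_tuple s) k) => //; apply: sB; exact: mem_tnth.
Qed.

Definition pr s x := comb s (fun j => ip x (v j)).

Lemma ip_pr s x j : uniq s -> j \in s -> ip (x - pr s x) (v j) = 0.
Proof. by move=> us js; rewrite ipBl ip_comb// js subrr. Qed.

Lemma ip_comb0 s c z : (forall j, j \in s -> ip z (v j) = 0) -> ip z (comb s c) = 0.
Proof.
move=> h; rewrite ip_sumr big1_seq// => j /andP[_ js].
by rewrite ipZr h// mulr0.
Qed.

Lemma sq_pr s x : uniq s -> sq (x - pr s x) = sq x - \sum_(j <- s) cw x (v j).
Proof.
move=> us; have h : ip (x - pr s x) (pr s x) = 0.
  by apply: ip_comb0 => j js; rewrite ip_pr.
have : sq x = sq (x - pr s x) + \sum_(j <- s) cw x (v j).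
  have := sqD ip (x - pr s x) (pr s x).
  by rewrite subrK (rip_ip0 h) mulr0 addr0 => ->; rewrite [sq (pr s x)]sq_comb.
by move=> ->; rewrite addrK.
Qed.

Lemma bessel_seq s x : uniq s -> \sum_(j <- s) cw x (v j) <= sq x.
Proof. by move=> us; rewrite -subr_ge0 -sq_pr// sq_ge0. Qed.

Lemma bessel x : (nsum (fun j => cw x (v j)) <= (sq x)%:E)%E.
Proof. by apply: nsum_le_seq => s us; rewrite lee_fin bessel_seq. Qed.

(** Membership of [y] in the span enters through orthogonality: the residual r is orthogonal to
    [pr s x] and to [y], so |r|^2 = <r, x - y>, and Cauchy-Schwarz concludes. *)
Lemma pr_best s x y : uniq s -> (forall z, (forall j, j \in s -> ip z (v j) = 0) -> ip z y = 0) ->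
  sq (x - pr s x) <= sq (x - y).
Proof.
move=> us hy; set r := x - pr s x.
have h1 : ip r (pr s x) = 0 by apply: ip_comb0 => j js; rewrite ip_pr.
have h2 : ip r y = 0 by apply: hy => j js; rewrite ip_pr.
have E : sq r = rip r (x - y).
  by rewrite [rip r (x - y)]ripBr (rip_ip0 h2) subr0 -[sq r]/(rip r r) {2}/r ripBr (rip_ip0 h1)
    subr0.
have := rip_le ip r (x - y); rewrite -E expr2.
have [->|r0] := eqVneq (sq r) 0; first by rewrite sq_ge0.
by rewrite ler_pM2l// lt_def r0 sq_ge0.
Qed.

Lemma linspan_seq (B : set J) y : linspan (v @` B) y ->
  exists2 s, uniq s & forall z, (forall j, j \in s -> ip z (v j) = 0) -> ip z y = 0.
Proof.
case=> n [c [w [hw ->]]].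
have /choice[f hf] : forall k, exists j, v j = w k.
  by move=> k; have [j _ <-] := hw k; exists j.
exists (undup (codom f)); first exact: undup_uniq.
move=> z hz; rewrite ip_sumr big1// => k _; rewrite ipZr -hf hz ?mulr0//.
by rewrite mem_undup codom_f.
Qed.

Lemma parseval x : clspan (range v) x -> nsum (fun j => cw x (v j)) = (sq x)%:E.
Proof.
move=> /(hclosureP hH) hx; apply/eqP; rewrite eq_le bessel/=.
apply/lee_addgt0Pr => e e0; have [y /linspan_seq[s us hs] hy] := hx e e0.
have := pr_best x us hs; rewrite sq_pr// => h.
apply: le_trans (leeD2r _ (nsum_seq_le (fun j => cw_ge0 ip x (v j)) us)).
by rewrite -EFinD lee_fin; lra.
Qed.

Lemma clspan_orth (A : set H) x z : clspan A x -> (forall a, A a -> ip z a = 0) ->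
  ip z x = 0.
Proof.
move=> /(hclosureP hH) hx hz; apply: cw_eq0; apply/eqP; rewrite eq_le cw_ge0 andbT.
apply/ler_addgt0Pr => e e0; rewrite add0r.
have q0 : 0 < e / (sq z + 1) by rewrite divr_gt0// ltr_wpDl// sq_ge0.
have [y [n [c [w [hw ->]]]] hy] := hx _ q0.
have h0 : ip z (\sum_(k < n) c k *: w k) = 0.
  by rewrite ip_sumr big1// => k _; rewrite ipZr hz// mulr0.
rewrite -(cwBr_orth _ h0).
apply: le_trans (cw_le _ _ _) _.
apply: (@le_trans _ _ ((sq z + 1) * (e / (sq z + 1)))).
  by rewrite ler_pM ?sq_ge0 ?lerDl ?ltW.
by rewrite mulrCA divff ?mulr1// gt_eqF// ltr_wpDl// sq_ge0.
Qed.

End Family.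

Section Countable.
Context (J : countType) (v : J -> H).
Hypothesis ov : orthonormal_family v.

(** The indices with code below [n]: an increasing exhaustion of [J] by finite lists, which turns
    series over [J] into sequences. *)
Definition en n : seq J := pmap choice.pickle_inv (iota 0 n).

Lemma en_uniq n : uniq (en n).
Proof. by rewrite (pmap_uniq (@choice.pickle_invK J))// iota_uniq. Qed.

Lemma mem_en n j : (j \in en n) = (choice.pickle j < n)%N.
Proof.
rewrite mem_pmap; apply/mapP/idP => [[k]|h].
  rewrite mem_iota add0n /= => kn /esym hk; have := @choice.pickle_invK J k.
  by rewrite hk /= => ->.
by exists (choice.pickle j); rewrite ?mem_iota// choice.pickleK_inv.
Qed.

Lemma comb_cat n m c : (n <= m)%N -> ip (comb v (en m) c) (comb v (en n) c) = (\sum_(j <- en n)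
  nc (c j))%:C.
Proof.
move=> nm; rewrite [comb v (en n) c]/comb ip_sumr nc_sum.
apply: eq_big_seq => j; rewrite mem_en => jn.
by rewrite ipZr ip_comb ?en_uniq// mem_en (leq_trans jn nm) ncE mulrC.
Qed.

Lemma riesz_fischer c : (nsum (fun j => nc (c j)) < +oo)%E ->
  exists x, (forall j, ip x (v j) = c j) /\ hcvg (fun n => comb v (en n) c) x.
Proof.
move=> hc; pose t n := \sum_(j <- en n) nc (c j).
have tm : nondecreasing_seq t.
  move=> n m nm; rewrite -lecR.
  have e1 : (t m)%:C = ip (comb v (en m) c) (comb v (en m) c) by rewrite comb_cat.
  have : 0 <= sq (comb v (en m) c - comb v (en n) c) by exact: sq_ge0.
  rewrite sqB !sq_comb ?en_uniq// /rip comb_cat// -/(t n) -/(t m) /= lecR => h.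
  lra.
have tb : has_ubound (range t).
  exists (fine (nsum (fun j => nc (c j)))) => _ [n _ <-].
  rewrite -lee_fin fineK; first by apply: nsum_seq_le; rewrite ?en_uniq// => j; exact: nc_ge0.
  by apply: nsum_fin => // j; exact: nc_ge0.
have ct := nondecreasing_is_cvgn tm tb.
have [x hx] : exists x, hcvg (fun n => comb v (en n) c) x.
  apply: (hcomplete hH) => e e0.
  have e2 : 0 < e / 2 by rewrite divr_gt0.
  have [N _ hN] := (cvgr_gt _ ct (lim (t @ \oo) - e) ltac:(by rewrite ltrBlDr ltrDl)).
  exists N.
  have key m n : (N <= m)%N -> (m <= n)%N -> sq (comb v (en n) c - comb v (en m) c) < e.
    move=> Nm mn; rewrite sqB !sq_comb ?en_uniq// /rip comb_cat// -/(t n) -/(t m) /=.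
    have := hN m Nm; have := nondecreasing_cvgn_le tm ct n; rewrite /=; lra.
  move=> m n Nm Nn; have [mn|/ltnW nm] := leqP m n; first exact: key.
  by rewrite sqBC; exact: key.
exists x; split => // j; apply/eqP; rewrite -subr_eq0.
have -> : ip x (v j) - c j = 0; last by [].
apply: contrapT => /eqP h0.
have n0 : 0 < nc (ip x (v j) - c j).
  by rewrite -ltcR ncE -sqr_normc exprn_gt0// normr_gt0.
have [N hN] := (hcvgP _ _ _).1 hx _ n0.
have hm : j \in en (maxn N (choice.pickle j).+1) by rewrite mem_en leq_max ltnSn orbT.
have := hN _ (leq_maxl N (choice.pickle j).+1); apply/negP; rewrite -leNgt sqBC.
rewrite (_ : nc _ = cw (x - comb v (en (maxn N (choice.pickle j).+1)) c) (v j)); last first.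
  by rewrite cw_nc ipBl ip_comb ?en_uniq// hm.
by apply: le_trans (cw_le ip _ _) _; rewrite (onf_sq ov) mulr1.
Qed.

End Countable.
End Orthonormal.

(** * Closed spans described by orthogonality *)

Section SpanCharacterization.
Context {R : realType} {H : completeNormedModType R[i]}.
Variable ip : {dot H for (@Num.conj R[i])}.
Hypothesis hH : hilbert_norm ip.
Local Notation rip := (rip ip).
Local Notation sq := (sq ip).
Local Notation cw := (cw ip).
Local Notation hcvg := (hcvg ip).

Section Family.
Context (J : countType) (v : J -> H).
Hypothesis ov : orthonormal_family ip v.

Lemma riesz_fischer_span (B : set J) (c : J -> R[i]) :
  (nsum (fun j => nc (c j)) < +oo)%E -> (forall j, ~ B j -> c j = 0) ->
  exists2 x, clspan (v @` B) x & forall j, ip x (v j) = c j.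
Proof.
move=> hc cB; have [x [xc xl]] := riesz_fischer hH ov hc.
exists x => //; apply/(hclosureP hH) => e e0; have [N hN] := (hcvgP _ _ _).1 xl _ e0.
exists (comb v (en J N) c); last by rewrite sqBC; exact: hN.
rewrite /comb (bigID (fun j => `[< B j >]))/= [X in _ + X]big1 ?addr0; last first.
  by move=> j /asboolPn/cB ->; rewrite scale0r.
rewrite -big_filter; apply: (@comb_span _ _ _ v B [seq j <- en J N | `[< B j >]]).
by move=> j; rewrite mem_filter => /andP[/asboolP].
Qed.

(** Double orthogonal complement. Riesz-Fischer builds the candidate projection y from the
    coefficients of x over B; then x - y is orthogonal to x and to y, hence to itself. *)
Lemma clspanP (B : set J) x : clspan (v @` B) x <->
  forall z, (forall j, B j -> ip z (v j) = 0) -> ip z x = 0.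
Proof.
split=> [h z hz|h]; first by apply: (clspan_orth hH h) => _ [j Bj <-]; exact: hz.
pose c j := if `[< B j >] then ip x (v j) else 0.
have hc : (nsum (fun j => nc (c j)) < +oo)%E.
  apply: le_lt_trans (ltry (sq x)); apply: le_trans (bessel ov x).
  apply: le_nsum => j; rewrite /c; case: ifP => // _; rewrite nc0; exact: cw_ge0.
have [|y yB yc] := @riesz_fischer_span B c hc.
  by move=> j /asboolPn/negbTE nB; rewrite /c nB.
have hz j : B j -> ip (x - y) (v j) = 0.
  by move=> /asboolP Bj; rewrite ipBl yc /c Bj subrr.
have h1 := h _ hz.
have h2 : ip (x - y) y = 0 by apply: (clspan_orth hH yB) => _ [j Bj <-]; exact: hz.
have /sq_eq0/eqP : sq (x - y) = 0.
  by apply: rip_ip0; rewrite [LHS]ipBr h1 h2 subrr.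
by rewrite subr_eq0 => /eqP ->.
Qed.

(** The family may be incomplete; with all coefficients equal to 1 this gives the orthogonal
    projection onto its closed span. *)
Lemma diag_exists (m : J -> R[i]) (K : R) : (forall j, nc (m j) <= K) ->
  exists D : H -> H, forall x, clspan (range v) (D x) /\
    forall j, ip (D x) (v j) = m j * ip x (v j).
Proof.
move=> hm.
have h x : exists y, clspan (range v) y /\ forall j, ip y (v j) = m j * ip x (v j).
  have [||y h1 h2] := @riesz_fischer_span setT (fun j => m j * ip x (v j)).
  - apply: (@nsum_dom _ _ _ (fun j => K * cw x (v j))).
      by move=> j; rewrite ncM ler_wpM2r ?nc_ge0//; exact: hm.
    have [[j _]|nJ] := pselect (exists j : J, True).
      have K0 : 0 <= K by apply: le_trans (hm j); exact: nc_ge0.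
      rewrite nsumZ//; last by move=> i; exact: cw_ge0.
      rewrite lte_mul_pinfty ?lee_fin//; apply: le_lt_trans (bessel ov x) _.
      exact: ltry.
    apply: le_lt_trans (ltry 0); apply: nsum_le_seq => -[|j s] _; first by rewrite big_nil.
    by case: nJ; exists j.
  - by move=> j [].
  - by exists y.
by have [D hD] := choice h; exists D.
Qed.

End Family.

Section Basis.
Context (J : countType) (v : J -> H).
Hypothesis bv : orthonormal_basis ip v.

Lemma onb_family : orthonormal_family ip v.
Proof. by move=> i j; case: bv => h _; exact: h. Qed.

Lemma onb_parseval x : nsum (fun j => cw x (v j)) = (sq x)%:E.
Proof. by apply: (parseval hH onb_family); case: bv => _ ->. Qed.

Lemma onb_ip0 x : (forall j, ip x (v j) = 0) -> x = 0.
Proof.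
move=> h; apply: (@sq_eq0 _ _ ip); apply: EFin_inj; rewrite -onb_parseval.
by rewrite /nsum esum1// => j _; rewrite cw0.
Qed.

Lemma onb_eq x y : (forall j, ip x (v j) = ip y (v j)) -> x = y.
Proof.
by move=> h; apply/eqP; rewrite -subr_eq0; apply/eqP/onb_ip0 => j; rewrite ipBl h subrr.
Qed.

Lemma onb_clspan (B : set J) x : clspan (v @` B) x <-> forall j, ~ B j -> ip x (v j) = 0.
Proof.
split=> [/(clspanP onb_family) h j nB|h].
  rewrite ipC h ?conjC0// => i Bi; rewrite onb_family; case: eqP => // ij.
  by rewrite ij in nB.
have hc : (nsum (fun j => nc (ip x (v j))) < +oo)%E by rewrite onb_parseval ltry.
have [y yB yc] := riesz_fischer_span onb_family hc h.
by rewrite (@onb_eq x y)// => j; rewrite yc.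
Qed.

End Basis.

End SpanCharacterization.

(** * Powers of a positive contraction on an invariant subspace *)

Section Power.
Context {R : realType} {H : completeNormedModType R[i]}.
Variable ip : {dot H for (@Num.conj R[i])}.
Hypothesis hH : hilbert_norm ip.
Local Notation rip := (rip ip).
Local Notation sq := (sq ip).
Local Notation hcvg := (hcvg ip).
Variables (V : set H) (S : H -> H).
Hypothesis VB : forall x y, V x -> V y -> V (x - y).
Hypothesis VS : forall x, V x -> V (S x).
Hypothesis SB : forall x y, S (x - y) = S x - S y.
Hypothesis Ssa : forall x y, rip (S x) y = rip x (S y).
Hypothesis S0 : forall x, V x -> 0 <= rip (S x) x.
Hypothesis S1 : forall x, V x -> rip (S x) x <= sq x.

Lemma V_iter n x : V x -> V (iter n S x).
Proof. by move=> Vx; elim: n => //= n; exact: VS. Qed.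

Lemma rip_iter n x y : rip (iter n S x) y = rip x (iter n S y).
Proof. by elim: n x y => //= n ih x y; rewrite Ssa ih -iterSr. Qed.

Lemma rip_iterD n m x : rip (iter n S x) (iter m S x) = rip (iter (n + m) S x) x.
Proof. by rewrite -rip_iter -iterD addnC. Qed.

(** S^2 <= S without a square root of S: positivity at x - S x gives 2 |S x|^2 <= <S x, x> + <S (S
    x), S x>, and the last term is at most |S x|^2. *)
Lemma sq_contract x : V x -> sq (S x) <= rip (S x) x.
Proof.
move=> Vx; have h1 := S1 (VS Vx); have := S0 (VB Vx (VS Vx)).
rewrite SB !ripBl !ripBr (Ssa (S x) x) -[rip (S x) (S x)]/(sq (S x)); lra.
Qed.

Lemma power_even k x : rip (iter k.*2 S x) x = sq (iter k S x).
Proof. by rewrite -addnn -rip_iterD. Qed.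

Lemma power_odd k x : rip (iter k.*2.+1 S x) x = rip (S (iter k S x)) (iter k S x).
Proof. by rewrite -addnn -addSn -rip_iterD. Qed.

Lemma power_ge0 n x : V x -> 0 <= rip (iter n S x) x.
Proof.
move=> Vx; rewrite -(odd_double_half n); case: (odd n); rewrite ?add1n ?add0n.
  by rewrite power_odd; apply/S0/V_iter.
by rewrite power_even sq_ge0.
Qed.

Lemma power_decr n x : V x -> rip (iter n.+1 S x) x <= rip (iter n S x) x.
Proof.
move=> Vx; rewrite -(odd_double_half n); case: (odd n); rewrite ?add1n ?add0n.
  by rewrite -doubleS power_even power_odd; apply/sq_contract/V_iter.
by rewrite power_even power_odd; apply/S1/V_iter.
Qed.

Lemma power_nonincr x : V x -> nonincreasing_seq (fun n => rip (iter n S x) x).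
Proof.
move=> Vx; apply/nonincreasing_seqP => n; exact: power_decr.
Qed.

(* The sequence [<S^n x, x>] is convex. *)
Lemma power_bernoulli n x : V x -> sq x - rip (iter n S x) x <= n%:R * (sq x - rip (S x) x).
Proof.
move=> Vx.
have conv k : rip (iter k S x) x - rip (iter k.+1 S x) x <= sq x - rip (S x) x.
  elim: k => //= k; apply: le_trans.
  have := power_ge0 k (VB Vx (VS Vx)).
  rewrite !ripBr.
  have iB y z m : iter m S (y - z) = iter m S y - iter m S z.
    by elim: m => //= m ->.
  rewrite iB !ripBl -iterSr -Ssa /= -Ssa; lra.
elim: n => [|n ih]; first by rewrite mul0r subrr.
by rewrite -natr1 mulrDl mul1r; have := conv n; lra.
Qed.

(** With a_n = <S^n x, x>, |S^n x - S^m x|^2 = a_(2n) - 2 a_(n+m) + a_(2m), and a_n converges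
    because it decreases and is nonnegative. *)
Lemma power_cvg x : V x -> exists y, hcvg (fun n => iter n S x) y.
Proof.
move=> Vx; apply: (hcomplete hH) => e e0.
have hb : has_lbound (range (fun n => rip (iter n S x) x)).
  by exists 0 => _ [n _ <-]; exact: power_ge0.
have ct := nonincreasing_is_cvgn (power_nonincr Vx) hb.
set a := (fun n => _) in ct.
have [N _ hN] := cvgr_lt _ ct (lim (a @ \oo) + e) ltac:(by rewrite ltrDl).
have lima n : lim (a @ \oo) <= a n by apply: nonincreasing_cvgn_ge => //; exact: power_nonincr.
have key m n : (N <= m)%N -> (m <= n)%N -> sq (iter n S x - iter m S x) < e.
  move=> Nm mn; rewrite sqB rip_iterD -!power_even -/(a n.*2) -/(a (n + m)%N) -/(a m.*2).
  have h1 : a n.*2 <= a (n + m)%N by apply: power_nonincr => //; rewrite -addnn leq_add2l.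
  have h2 := lima (n + m)%N.
  have /= := hN m.*2; rewrite -addnn => /(_ (leq_trans Nm (leq_addr _ _))); lra.
exists N => m n Nm Nn; have [mn|/ltnW nm] := leqP m n; first exact: key.
by rewrite sqBC; exact: key.
Qed.

End Power.

(** * Strong limits and self-adjoint maps *)

Section StrongLimits.
Context {R : realType} {H : completeNormedModType R[i]}.
Variable ip : {dot H for (@Num.conj R[i])}.
Hypothesis hH : hilbert_norm ip.
Local Notation rip := (rip ip).
Local Notation sq := (sq ip).
Local Notation cw := (cw ip).
Local Notation hcvg := (hcvg ip).

Lemma sqD_le x y : sq (x + y) <= 2 * sq x + 2 * sq y.
Proof. by have := sq_ge0 ip (x - y); rewrite sqB sqD; lra. Qed.

Lemma small_eq0 (a : R) : 0 <= a -> (forall e, 0 < e -> a < e) -> a = 0.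
Proof.
move=> a0 h; apply/eqP; rewrite eq_le a0 andbT leNgt; apply/negP => /h.
by rewrite ltxx.
Qed.

Lemma hcvg_uniq u x y : hcvg u x -> hcvg u y -> x = y.
Proof.
move=> /hcvgP hx /hcvgP hy; apply/eqP; rewrite -subr_eq0; apply/eqP/(@sq_eq0 _ _ ip).
apply: small_eq0 => [|e e0]; first exact: sq_ge0.
have e4 : 0 < e / 4 by rewrite divr_gt0.
have [N hN] := hx _ e4; have [M hM] := hy _ e4.
have := hN _ (leq_maxl N M); have := hM _ (leq_maxr N M).
set w := u _; rewrite sqBC => h1; rewrite sqBC => h2.
have -> : x - y = (x - w) - (y - w) by rewrite opprB addrA subrK.
have := sqD_le (x - w) (- (y - w)); rewrite sqN; lra.
Qed.

Lemma hcvg_map (T : H -> H) K u x : (forall y z, T (y - z) = T y - T z) ->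
  (forall z, sq (T z) <= K * sq z) -> hcvg u x -> hcvg (fun n => T (u n)) (T x).
Proof.
move=> TB TK /hcvgP hx; apply/hcvgP => e e0.
have K0 : 0 < `|K| + 1 by rewrite ltr_wpDl.
have [N hN] := hx (e / (`|K| + 1)) ltac:(by rewrite divr_gt0).
exists N => n /hN; rewrite ltr_pdivlMr// -TB; apply: le_lt_trans.
apply: le_trans (TK _) _; rewrite mulrC ler_wpM2l ?sq_ge0//.
by apply: le_trans (ler_norm K) _; rewrite lerDl.
Qed.

Lemma hcvg_shift u x : hcvg u x -> hcvg (fun n => u n.+1) x.
Proof.
by move=> /hcvgP h; apply/hcvgP => e /h[N hN]; exists N => n Nn; apply/hN/leqW.
Qed.

Lemma hcvg_rip u x z : hcvg u x -> (fun n => rip (u n) z) @ \oo --> rip x z.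
Proof.
move=> /hcvgP h; apply/cvgrPdist_lt => e e0.
have q0 : 0 < sq z + 1 by rewrite ltr_wpDl// sq_ge0.
have [N hN] := h (e ^+ 2 / (sq z + 1)) ltac:(by rewrite divr_gt0// exprn_gt0).
exists N => // n /hN; rewrite ltr_pdivlMr// => hn.
rewrite -ripBl -(@ltr_pXn2r _ 2)// ?nnegrE ?(ltW e0)//.
rewrite real_normK ?num_real//; apply: le_lt_trans (rip_le _ _ _) _.
rewrite sqBC; apply: le_lt_trans hn; apply: ler_wpM2l; first exact: sq_ge0.
by rewrite lerDl.
Qed.

Lemma ip_nondeg x y : (forall z, ip x z = ip y z) -> x = y.
Proof.
move=> h; apply/eqP; rewrite -subr_eq0; apply/eqP/(@sq_eq0 _ _ ip)/rip_ip0.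
by rewrite ipBl h subrr.
Qed.

Lemma sa_sub T : self_adjoint ip T -> forall x y, T (x - y) = T x - T y.
Proof. by move=> sa x y; apply: ip_nondeg => z; rewrite sa !ipBl !sa. Qed.

Lemma sa_linear_add T : self_adjoint ip T -> forall x y, T (x + y) = T x + T y.
Proof. by move=> sa x y; apply: ip_nondeg => z; rewrite sa !ipDl !sa. Qed.

Lemma sa_scale T : self_adjoint ip T -> forall a x, T (a *: x) = a *: T x.
Proof. by move=> sa a x; apply: ip_nondeg => z; rewrite sa !ipZl !sa. Qed.

Lemma sa_rip T : self_adjoint ip T -> forall x y, rip (T x) y = rip x (T y).
Proof. by move=> sa x y; rewrite !ripE sa. Qed.

Lemma sa_comp T U : self_adjoint ip T -> self_adjoint ip U -> (forall x, T (U x) = U (T x)) ->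
  self_adjoint ip (fun x => T (U x)).
Proof. by move=> sT sU c x y; rewrite sT sU c. Qed.

Lemma sa_iter T n : self_adjoint ip T -> self_adjoint ip (iter n T).
Proof. by move=> sT; elim: n => //= n ih x y; rewrite sT ih -iterSr. Qed.

Lemma sa_subop T U : self_adjoint ip T -> self_adjoint ip U -> self_adjoint ip (fun x => T x - U x).
Proof. by move=> sT sU x y; rewrite ipBl ipBr sT sU. Qed.

Lemma sa_id : self_adjoint ip id. Proof. by []. Qed.

(** [L] is the orthogonal projection onto the fixed vectors of [S]. *)
Lemma power_limit (S : H -> H) K (L : H -> H) : self_adjoint ip S ->
  (forall z, sq (S z) <= K * sq z) ->
  (forall x, hcvg (fun n => iter n S x) (L x)) ->
  [/\ forall x, S (L x) = L x, forall x, L (L x) = L x & self_adjoint ip L].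
Proof.
move=> sS SK hL.
have fix1 x : S (L x) = L x.
  apply: (hcvg_uniq (hcvg_map (sa_sub sS) SK (hL x))).
  exact: (hcvg_shift (hL x)).
have fixn n x : iter n S (L x) = L x by elim: n => //= n ->.
split=> //.
  move=> x; apply: (hcvg_uniq (hL (L x))).
  by apply/hcvgP => e e0; exists 0%N => n _; rewrite fixn subrr sq0.
move=> x y; apply/eqP; rewrite -subr_eq0; set c := _ - _.
have c0 : nc c = 0.
  apply: small_eq0 => [|e e0]; first exact: nc_ge0.
  have q0 : 0 < 4 * (sq x + sq y + 1).
    by have := sq_ge0 ip x; have := sq_ge0 ip y; lra.
  have d0 : 0 < e / (4 * (sq x + sq y + 1)) by rewrite divr_gt0.
  have [N hN] := (hcvgP _ _ _).1 (hL x) _ d0.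
  have [M hM] := (hcvgP _ _ _).1 (hL y) _ d0.
  have := hN _ (leq_maxl N M); have := hM _ (leq_maxr N M).
  set n := maxn _ _; rewrite !ltr_pdivlMr// => h1 h2.
  have -> : c = ip x (iter n S y - L y) - ip (iter n S x - L x) y.
    by rewrite ipBr ipBl (sa_iter n sS) /c; ring.
  have ncB (a b : R[i]) : nc (a - b) <= 2 * nc a + 2 * nc b.
    case: a => a1 a2; case: b => b1 b2; rewrite /nc /=.
    by have := sqr_ge0 (a1 + b1); have := sqr_ge0 (a2 + b2); lra.
  apply: le_lt_trans (ncB _ _) _.
  have := cw_le ip x (iter n S y - L y); have := cw_le ip (iter n S x - L x) y.
  rewrite !cw_nc; have := sq_ge0 ip x; have := sq_ge0 ip y.
  have := sq_ge0 ip (iter n S x - L x); have := sq_ge0 ip (iter n S y - L y).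
  move: h1 h2; nra.
by apply/eqP/nc_eq0.
Qed.

End StrongLimits.

(** * Hilbert-Schmidt sums and eigenvectors of operators with finite trace *)

Section Traces.
Context {R : realType} {H : completeNormedModType R[i]}.
Variable ip : {dot H for (@Num.conj R[i])}.
Hypothesis hH : hilbert_norm ip.
Local Notation rip := (rip ip).
Local Notation sq := (sq ip).
Local Notation cw := (cw ip).
Local Notation hcvg := (hcvg ip).
Context (I : countType) (e : I -> H).
Hypothesis be : orthonormal_basis ip e.

(** Both sides are the double sum of |<A e_i, e_j>|^2. *)
Lemma hs_adjoint (A B : H -> H) : (forall x y, ip (A x) y = ip x (B y)) ->
  nsum (fun i => sq (A (e i))) = nsum (fun i => sq (B (e i))).
Proof.
move=> AB; transitivity (\esum_(i in setT) \esum_(j in setT) (cw (A (e i)) (e j))%:E)%E.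
  by apply: eq_esum => i _; rewrite -(onb_parseval hH be).
rewrite esum_swap; last by move=> i j; rewrite lee_fin cw_ge0.
apply: eq_esum => j _; rewrite -(onb_parseval hH be); apply: eq_esum => i _.
by rewrite cw_nc AB -cw_nc cwC.
Qed.

Lemma sq_le_hs (A B : H -> H) u : (forall x y, ip (A x) y = ip x (B y)) ->
  ((sq (A u))%:E <= (sq u)%:E * nsum (fun i => sq (B (e i))))%E.
Proof.
move=> AB; rewrite -(onb_parseval hH be) -nsumZ ?sq_ge0//; last by move=> i; exact: sq_ge0.
by apply: le_nsum => i; rewrite cw_nc AB -cw_nc cw_le.
Qed.

(* Let [m] be the supremum of [<T x, x>] on the unit ball. If [m] were not an
   eigenvalue, the powers of [T / m] would tend to 0 in the Hilbert-Schmidt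
   norm, against Bernoulli's inequality for [<(T / m)^n u, u>] at a vector [u]
   with [<T u, u>] close to [m]. *)
Lemma trace_eigenvector (T : H -> H) (C : R) : self_adjoint ip T ->
  (forall x, 0 <= rip (T x) x) -> (forall x, rip (T x) x <= C * sq x) ->
  (nsum (fun i => rip (T (e i)) (e i)) < +oo)%E -> (exists x, T x <> 0) ->
  exists m x, [/\ 0 < m, x <> 0 & T x = m%:C *: x].
Proof.
move=> sT T0 TC trT [x0 Tx0].
have C0 : 0 < `|C| + 1 by rewrite ltr_wpDl.
have TC' x : rip (T x) x <= (`|C| + 1) * sq x.
  by apply: le_trans (TC x) _; rewrite ler_wpM2r ?sq_ge0// ler_wpDr// ler_norm.
have [x1 x1p] : exists x, 0 < rip (T x) x.
  apply: contrapT => hn; apply: Tx0; apply: (@sq_eq0 _ _ ip).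
  have z x : rip (T x) x = 0.
    by apply/eqP; rewrite eq_le T0 andbT leNgt; apply/negP => h; apply: hn; exists x.
  (* If the quadratic form vanishes identically, its value at x0 - T x0 is -2 |T x0|^2. *)
  have := z (x0 - T x0); rewrite (sa_sub sT) !ripBl !ripBr (sa_rip sT (T x0)) !z.
  by rewrite -[rip (T x0) (T x0)]/(sq (T x0)) ?sub0r ?subr0; lra.
pose A := [set a | exists2 x, sq x <= 1 & a = rip (T x) x].
have A0 : A 0 by exists 0; rewrite ?sq0// rip0r.
have Ab : has_ubound A.
  exists (`|C| + 1) => _ [x xx1 ->]; apply: le_trans (TC' x) _.
  by rewrite ler_piMr// ltW.
pose m := sup A.
have mT x : rip (T x) x <= m * sq x.
  have [/sq_eq0 ->|x0'] := eqVneq (sq x) 0; first by rewrite rip0r sq0 mulr0.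
  have xp : 0 < sq x by rewrite lt_def x0' sq_ge0.
  rewrite -ler_pdivrMr//; apply: ub_le_sup => //.
  exists ((nrm ip x)^-1%:C *: x); rewrite ?sqZr ?(sa_scale sT) ?ripZl ?ripZr.
    by rewrite exprVn nrm2 mulVf.
  by rewrite mulrA -expr2 exprVn nrm2 mulrC.
have mp : 0 < m.
  rewrite ltNge; apply/negP => m0; have := mT x1.
  by have := sq_ge0 ip x1; nra.
exists m; apply: contrapT => hno.
have {}hno x : T x = m%:C *: x -> x = 0.
  by move=> h; apply: contrapT => xn; apply: hno; exists x.
pose S x := m^-1%:C *: T x.
have sS : self_adjoint ip S by move=> x y; rewrite ipZl ipZr sT conjR.
have S0 x : 0 <= rip (S x) x by rewrite ripZl mulr_ge0// invr_ge0 ltW.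
have S1 x : rip (S x) x <= sq x.
  by rewrite ripZl mulrC ler_pdivrMr// mulrC.
have SB := sa_sub sS. have Sr := sa_rip sS.
have Tt : forall x y : H, setT x -> setT y -> setT (x - y) by [].
have T1 : forall x : H, setT x -> setT (S x) by [].
have S0' x : setT x -> 0 <= rip (S x) x by [].
have S1' x : setT x -> rip (S x) x <= sq x by [].
have SK x : sq (S x) <= 1 * sq x.
  rewrite mul1r; apply: le_trans (S1 x).
  by apply: (@sq_contract _ _ ip setT).
have /choice[L hL] : forall x, exists y, hcvg (fun n => iter n S x) y.
  by move=> x; apply: (power_cvg hH Tt T1 SB Sr S0' S1').
have [SL _ _] := power_limit sS SK hL.
have L0 x : L x = 0.
  apply: hno; rewrite -[in RHS]SL /S scalerA -CM divff ?scale1r//.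
  by rewrite gt_eqF.
pose f k i := sq (iter k.+1 S (e i)).
have f0 k i : 0 <= f k i by exact: sq_ge0.
have fd k i : f k.+1 i <= f k i by have := SK (iter k.+1 S (e i)); rewrite mul1r.
have fl i : f ^~ i @ \oo --> (0 : R).
  have /hcvg_shift := hL (e i); rewrite L0 /hcvg.
  by under eq_fun do rewrite subr0.
have ff : (nsum (f 0%N) < +oo)%E.
  apply: (@nsum_dom _ _ _ (fun i => m^-1 * rip (T (e i)) (e i))).
    by move=> i; rewrite -ripZl; apply: (@sq_contract _ _ ip setT).
  by rewrite nsumZ ?invr_ge0 ?(ltW mp)// lte_mul_pinfty// lee_fin invr_ge0 ltW.
have := nsum_decr f0 fd fl ff; rewrite [X in fine X](_ : _ = 0%E); last first.
  by rewrite /nsum esum1.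
move=> hc; have q4 : fine 0%E < 4^-1 :> R by rewrite /= invr_gt0.
have [k _ /(_ k (leqnn k)) /= hk] := cvgr_lt _ hc _ q4.
(* For a unit ball vector u with <S u, u> > 1 - 1/(2n), Bernoulli loses at most 1/2, and n >= 2
   gives |u|^2 > 3/4. Hence |S^(k+1) u|^2 > 1/4, against the Hilbert-Schmidt bound. *)
pose n := (k.+1).*2.
have n1 : 2 <= n%:R :> R by rewrite ler_nat /n doubleS.
have q : m * (1 - (2 * n%:R)^-1) < m.
  by rewrite gtr_pMr// gtrBl invr_gt0; lra.
have [_ [u u1 ->] hu] := sup_gt (ex_intro _ 0 A0 : A !=set0) q.
have := @power_bernoulli _ _ ip setT S Tt T1 SB Sr S0' n u Logic.I.
rewrite power_even//.
have := @sq_le_hs (iter k.+1 S) _ u (sa_iter k.+1 sS).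
rewrite -[nsum _]fineK; last first.
  apply: nsum_fin => [i|]; first exact: sq_ge0.
  apply: le_lt_trans ff; apply: le_nsum => i; rewrite -/(f k i).
  by elim: (k) => // k' ih; apply: le_trans ih.
rewrite -EFinM lee_fin => h1.
have h2 : sq (iter k.+1 S u) < 4^-1.
  apply: le_lt_trans h1 _; apply: le_lt_trans hk.
  by rewrite ler_piMl// fine_ge0// nsum_ge0// => i; exact: sq_ge0.
have h3 : 1 - (2 * n%:R)^-1 < rip (S u) u.
  by rewrite ripZl ltr_pdivlMl.
have h4 : n%:R * (sq u - rip (S u) u) <= n%:R * (2 * n%:R)^-1.
  by rewrite ler_wpM2l//; lra.
have h5 : n%:R * (2 * n%:R)^-1 = 2^-1 :> R by field; rewrite gt_eqF//; lra.
have h6 : (2 * n%:R)^-1 <= 4^-1 :> R by rewrite lef_pV2 ?posrE//; lra.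
have := S1 u; lra.
Qed.

End Traces.

(** * Traces of projections and cyclicity of the trace *)

Section Projections.
Context {R : realType} {H : completeNormedModType R[i]}.
Variable ip : {dot H for (@Num.conj R[i])}.
Hypothesis hH : hilbert_norm ip.
Local Notation rip := (rip ip).
Local Notation sq := (sq ip).
Local Notation cw := (cw ip).
Local Notation hcvg := (hcvg ip).
Context (I : countType) (e : I -> H).
Hypothesis be : orthonormal_basis ip e.

(** The trace is the dimension of the range. It bounds the size of orthonormal families in the
    range, and a maximal one accounts for each [G (e i)] completely: a nonzero residual, normalized,
    would enlarge the family. *)
Lemma trace_projection_nat (G : H -> H) : self_adjoint ip G -> (forall x, G (G x) = G x) ->
  (nsum (fun i => sq (G (e i))) < +oo)%E ->
  exists n, nsum (fun i => sq (G (e i))) = (n%:R)%:E.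
Proof.
move=> sG GG fin.
pose P n := exists v : 'I_n -> H, orthonormal_family ip v /\ forall k, G (v k) = v k.
have sumv n (v : 'I_n -> H) : orthonormal_family ip v ->
    (\sum_(k <- enum 'I_n) \esum_(i in setT) (cw (e i) (v k))%:E = (n%:R)%:E)%E.
  move=> ov; rewrite (eq_bigr (fun=> 1%E)).
    by rewrite big_const_seq count_predT size_enum_ord; elim: (n) => //= k ->; rewrite -natr1 addrC.
  move=> k _; rewrite -(_ : sq (v k) = 1); last exact: (onf_sq ov).
  by rewrite -(onb_parseval hH be); apply: eq_esum => i _; rewrite cwC.
have swp n (v : 'I_n -> H) :
    (\sum_(k <- enum 'I_n) \esum_(i in setT) (cw (e i) (v k))%:E =
     \esum_(i in setT) (\sum_(k <- enum 'I_n) cw (e i) (v k))%:E)%E.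
  rewrite -esum_sum; last by move=> i k _ _; rewrite lee_fin cw_ge0.
  by apply: eq_esum => i _; rewrite sumEFin.
have Gv n (v : 'I_n -> H) i k : G (v k) = v k -> cw (e i) (v k) = cw (G (e i)) (v k).
  by move=> Gk; rewrite !cw_nc sG Gk.
have Pb n : `[< P n >] -> (n <= Num.truncn (fine (nsum (fun i => sq (G (e i))))))%N.
  move=> /asboolP[v [ov Gk]]; rewrite truncn_ge_nat; last first.
    by rewrite fine_ge0// nsum_ge0// => i; exact: sq_ge0.
  rewrite -lee_fin fineK; last by apply: nsum_fin => // i; exact: sq_ge0.
  rewrite -(sumv _ _ ov) swp; apply: le_nsum => i.
  by under eq_bigr do rewrite Gv//; exact: (bessel_seq ov _ (enum_uniq _)).
have P0 : exists n, `[< P n >].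
  by exists 0%N; apply/asboolP; exists (fun=> 0); split; case.
case: (ex_maxnP P0 Pb) => n /asboolP[v [ov Gk]] nmax.
exists n; rewrite -(sumv _ _ ov) swp; apply: eq_esum => i _; congr EFin.
under eq_bigr do rewrite (Gv _ _ _ _ (Gk _)).
set x := G (e i); set z := x - pr ip v (enum 'I_n) x.
have := sq_pr ov x (enum_uniq 'I_n); rewrite -/z => hz.
suff z0 : sq z = 0 by move: hz; rewrite z0 => /esym/eqP; rewrite subr_eq0 => /eqP.
apply/eqP; apply: contraT => zn; have zp : 0 < sq z by rewrite lt_def zn sq_ge0.
have zv k : ip z (v k) = 0 by apply: ip_pr => //; rewrite ?enum_uniq ?mem_enum.
have Gz : G z = z.
  rewrite /z (sa_sub sG) {1}/x GG; congr (_ - _).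
  apply: (@ip_nondeg _ _ ip) => y; rewrite sG !ip_suml; apply: eq_bigr => k _.
  by rewrite !ipZl -sG Gk.
pose w := (nrm ip z)^-1%:C *: z.
have ww : ip w w = 1.
  by rewrite ipxx /w sqZr exprVn nrm2 mulVf.
have : `[< P n.+1 >].
  apply/asboolP; exists (fun k => if unlift ord_max k is Some j then v j else w).
  split=> [a b|a]; last by case: unliftP => // _; rewrite (sa_scale sG) Gz.
  case: unliftP => [j ->|->]; case: unliftP => [k ->|->].
  - by rewrite ov (inj_eq (@lift_inj _ _)).
  - by rewrite ipC /w ipZl zv mulr0 conjC0 eq_sym (negbTE (neq_lift _ _)).
  - by rewrite /w ipZl zv mulr0 (negbTE (neq_lift _ _)).
  - by rewrite ww eqxx.
by move=> /nmax; rewrite ltnn.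
Qed.

Lemma trace_cyclic (A A' B B' : H -> H) :
  (forall x y, ip (A x) y = ip x (A' y)) -> (forall x y, ip (B x) y = ip x (B' y)) ->
  (nsum (fun i => sq (A (e i))) < +oo)%E -> (nsum (fun i => sq (B (e i))) < +oo)%E ->
  rsum (fun i => rip (A (e i)) (B (e i))) = rsum (fun i => rip (A' (e i)) (B' (e i))).
Proof.
have key (C D : H -> H) : (nsum (fun i => sq (C (e i))) < +oo)%E ->
    (nsum (fun i => sq (D (e i))) < +oo)%E ->
    rsum (fun i => rip (C (e i)) (D (e i))) =
    4^-1 * (fine (nsum (fun i => sq (C (e i) + D (e i)))) -
            fine (nsum (fun i => sq (C (e i) - D (e i))))).
  move=> hC hD.
  have hh : (nsum (fun i => (2 * sq (C (e i)) + 2 * sq (D (e i)))%R) < +oo)%E.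
    by apply: nsumD_lty; rewrite ?nsumZ_lty// => i; rewrite ?mulr_ge0 ?sq_ge0.
  have h1 : (nsum (fun i => sq (C (e i) + D (e i))%R) < +oo)%E.
    by apply: nsum_dom hh => i; exact: sqD_le.
  have h2 : (nsum (fun i => sq (C (e i) - D (e i))%R) < +oo)%E.
    by apply: nsum_dom hh => i; rewrite -[sq (D _)](sqN ip); exact: sqD_le.
  rewrite -(@rsum_split _ _ (fun i => 4 * rip (C (e i)) (D (e i)))
    (fun i => sq (C (e i) + D (e i))) (fun i => sq (C (e i) - D (e i))))//; first last.
  - by move=> i; rewrite sqD sqB; ring.
  - by move=> i; exact: sq_ge0.
  - by move=> i; exact: sq_ge0.
  rewrite rsumZ ?mulKf//; apply: (absum_dom (g := fun i => 2 * sq (C (e i)) + 2 * sq (D (e i)))).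
    move=> i; have := sqD_le ip (C (e i)) (D (e i)); have := sqD_le ip (C (e i)) (- D (e i)).
    have := sq_ge0 ip (C (e i) + D (e i)); have := sq_ge0 ip (C (e i) - D (e i)).
    have := sq_ge0 ip (C (e i)); have := sq_ge0 ip (D (e i)).
    by rewrite sqN sqB sqD ler_norml; lra.
  by rewrite absumE// => i; rewrite addr_ge0// mulr_ge0// sq_ge0.
move=> AA BB hA hB; rewrite !key//; last first.
- by rewrite -(hs_adjoint hH be BB).
- by rewrite -(hs_adjoint hH be AA).
congr (_ * (fine _ - fine _)).
  apply: (hs_adjoint hH be (A := fun x => A x + B x) (B := fun x => A' x + B' x)) => x y.
  by rewrite ipDl ipDr AA BB.
apply: (hs_adjoint hH be (A := fun x => A x - B x) (B := fun x => A' x - B' x)) => x y.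
by rewrite ipBl ipBr AA BB.
Qed.

End Projections.

(** * The index of a pair of projections *)

Section ProjectionPair.
Context {R : realType} {H : completeNormedModType R[i]}.
Variable ip : {dot H for (@Num.conj R[i])}.
Hypothesis hH : hilbert_norm ip.
Local Notation rip := (rip ip).
Local Notation sq := (sq ip).
Local Notation cw := (cw ip).
Local Notation hcvg := (hcvg ip).
Context (I : countType) (e : I -> H).
Hypothesis be : orthonormal_basis ip e.
Variables P Q : H -> H.
Hypotheses (sP : self_adjoint ip P) (sQ : self_adjoint ip Q).
Hypotheses (PP : forall x, P (P x) = P x) (QQ : forall x, Q (Q x) = Q x).

(** Pairing with an arbitrary vector turns an identity between sums of vectors into one in [R[i]],
    where [ring] applies. *)
Local Ltac vector_identity :=
  apply: (@ip_nondeg _ _ ip) => ?; rewrite !(ipDl, ipNl); ring.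

Let S x := P x - P (Q x) - Q (P x) + Q x.
Let PB := sa_sub sP.
Let QB := sa_sub sQ.
Let PN x : P (- x) = - P x. Proof. by have := PB 0 x; rewrite sub0r => ->;
  rewrite -(subrr (0 : H)) PB subrr sub0r. Qed.
Let QN x : Q (- x) = - Q x. Proof. by have := QB 0 x; rewrite sub0r => ->;
  rewrite -(subrr (0 : H)) QB subrr sub0r. Qed.
Let PD x y : P (x + y) = P x + P y. Proof. by rewrite -[y in LHS]opprK PB PN opprK. Qed.
Let QD x y : Q (x + y) = Q x + Q y. Proof. by rewrite -[y in LHS]opprK QB QN opprK. Qed.

Let sS : self_adjoint ip S.
Proof. by move=> x y; rewrite /S !(ipDl, ipDr, ipNl, ipNr) !sP !sQ !sP; ring. Qed.

Let ripS x : rip (S x) x = sq (P x - Q x).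
Proof.
rewrite /S !(ripDl, ripNl) sqB (ripC _ (Q (P x))) -(sa_rip sQ) (ripC _ _ (P x)).
rewrite -{1}(PP x) (sa_rip sP (P x)) (sa_rip sP (Q x)) -{3}(QQ x) (sa_rip sQ (Q x)).
rewrite -[rip (P x) (P x)]/(sq (P x)) -[rip (Q x) (Q x)]/(sq (Q x)).
by rewrite (ripC _ (Q x) (P x)); ring.
Qed.

Let S0 x : 0 <= rip (S x) x. Proof. by rewrite ripS sq_ge0. Qed.

Let ripP x : rip (P x) x = sq (P x).
Proof. by rewrite -{1}PP (sa_rip sP). Qed.
Let ripQ x : rip (Q x) x = sq (Q x).
Proof. by rewrite -{1}QQ (sa_rip sQ). Qed.

Let S1 x : rip (S x) x <= sq x.
Proof.
rewrite ripS; have := sq_ge0 ip (P x + Q x - x).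
by rewrite !sqB sqD ripDl ripP ripQ; lra.
Qed.

Let SK x : sq (S x) <= 1 * sq x.
Proof.
rewrite mul1r; apply: le_trans (S1 x); apply: (@sq_contract _ _ ip setT S) => //.
- exact: sa_sub.
- exact: sa_rip.
Qed.

Let SPE x : S (P x) = P x - P (Q (P x)).
Proof. by rewrite /S !PP subrK. Qed.

Let SP x : S (P x) = P (S x).
Proof. by rewrite SPE /S !(PD, PB, PN) !PP [in RHS]addrAC subrK. Qed.

Let Pc x := x - P x.

Let sPc : self_adjoint ip Pc. Proof. by apply: sa_subop => //; exact: sa_id. Qed.

Let SPc x : S (Pc x) = Pc (S x).
Proof. by rewrite /Pc (sa_sub sS) SP. Qed.

(** The exponent starts at 1 because P and 1 - P may have infinite trace, unlike S P and S (1 -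
    P). *)
Let u k i := rip (iter k.+1 S (P (e i))) (P (e i)).
Let v k i := rip (iter k.+1 S (Pc (e i))) (Pc (e i)).

Let SQ x : S (Q x) = Q (S x).
Proof.
by rewrite /S !(QD, QB, QN) !QQ; vector_identity.
Qed.

Let iter_comm (T : H -> H) n x :
  (forall y, S (T y) = T (S y)) -> iter n S (T x) = T (iter n S x).
Proof. by move=> ST; elim: n => //= n ->. Qed.

(** The off-diagonal corners of Q with respect to P. They measure what the next power of S loses: S
    P - S^2 P = W' W and S (1 - P) - S^2 (1 - P) = W W'. The two losses have equal traces by
    cyclicity. *)
Let W x := Pc (Q (P x)).
Let W' x := P (Q (Pc x)).

Let adjW x y : ip (W x) y = ip x (W' y).
Proof. by rewrite /W sPc sQ sP. Qed.

Let SW x : S (W x) = W (S x). Proof. by rewrite /W SPc SQ SP. Qed.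
Let SW' x : S (W' x) = W' (S x). Proof. by rewrite /W' SP SQ SPc. Qed.

Let PcPc x : Pc (Pc x) = Pc x.
Proof. by rewrite {1}/Pc /Pc PB PP subrr subr0. Qed.

Let SPcE x : S (Pc x) = Pc (Q (Pc x)).
Proof.
by rewrite (sa_sub sS) SPE /S /Pc !(QB, PB, PN); vector_identity.
Qed.

Let SSP x : S (P x) - S (S (P x)) = W' (W x).
Proof.
rewrite [in S (S _)]SPE (sa_sub sS) !SPE /W' /W PcPc /Pc.
by rewrite !(QB, PB, QQ, PP); vector_identity.
Qed.

Let SSPc x : S (Pc x) - S (S (Pc x)) = W (W' x).
Proof.
rewrite !SPcE /W PP /W' /Pc.
by rewrite !(QB, PB, QQ, PP); vector_identity.
Qed.

Let WP x : W (P x) = W x. Proof. by rewrite /W PP. Qed.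
Let W'Pc x : W' (Pc x) = W' x. Proof. by rewrite /W' PcPc. Qed.

Let iterS_sub n x y : iter n S (x - y) = iter n S x - iter n S y.
Proof. exact: (sa_sub (sa_iter n sS)). Qed.

Let u_diff k i : u k i - u k.+1 i = rip (W (iter k S (e i))) (W (e i)).
Proof.
rewrite /u -ripBl !(iterSr k.+1) !(iterSr k) -iterS_sub SSP (iter_comm _ _ SW') (iter_comm _ _ SW).
by rewrite ripC ripE -adjW WP -ripE ripC.
Qed.

Let v_diff k i : v k i - v k.+1 i = rip (iter k S (W' (e i))) (W' (e i)).
Proof.
rewrite /v -ripBl !(iterSr k.+1) !(iterSr k) -iterS_sub SSPc (iter_comm _ _ SW) !(iter_comm _ _
  SW').
by rewrite ripE adjW W'Pc.
Qed.

Let Tt (x y : H) : setT x -> setT y -> setT (x - y). Proof. by []. Qed.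
Let Ts (x : H) : setT x -> setT (S x). Proof. by []. Qed.
Let S0' (x : H) : setT x -> 0 <= rip (S x) x. Proof. by []. Qed.
Let S1' (x : H) : setT x -> rip (S x) x <= sq x. Proof. by []. Qed.

Let pow_ge0 n x : 0 <= rip (iter n S x) x.
Proof. exact: (power_ge0 Ts (sa_rip sS) S0'). Qed.
Let pow_decr n x : rip (iter n.+1 S x) x <= rip (iter n S x) x.
Proof. exact: (power_decr Tt Ts (sa_sub sS) (sa_rip sS) S0' S1'). Qed.

Let sq_iter n x : sq (iter n S x) <= sq x.
Proof.
elim: n => //= n; apply: le_trans; have := SK (iter n S x); by rewrite mul1r.
Qed.

(* [S = (P - Q)^2] commutes with [P] and [Q], and the difference of the traces of
   [S^k P] and [S^k (1 - P)] is the same for all [k > 0]. As [k] grows both tend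
   to traces of projections. *)
Lemma projection_pair_index :
  (nsum (fun i => sq (Q (P (e i)) - P (e i))%R) < +oo)%E ->
  (nsum (fun i => sq (Q (e i - P (e i))%R)) < +oo)%E ->
  exists z : int, fine (nsum (fun i => sq (Q (P (e i)) - P (e i)))) -
    fine (nsum (fun i => sq (Q (e i - P (e i))))) = z%:~R.
Proof.
have u0E i : sq (Q (P (e i)) - P (e i)) = u 0 i by rewrite /u /= ripS PP sqBC.
have v0E i : sq (Q (e i - P (e i))) = v 0 i.
  by rewrite /v /= ripS /Pc PB PP subrr sub0r sqN.
rewrite (eq_nsum u0E) (eq_nsum v0E) => u0 v0.
have fu k i : 0 <= u k i by exact: pow_ge0.
have fv k i : 0 <= v k i by exact: pow_ge0.
have du k i : u k.+1 i <= u k i by exact: pow_decr.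
have dv k i : v k.+1 i <= v k i by exact: pow_decr.
have uk k : (nsum (u k) < +oo)%E.
  by elim: k => // k; apply: nsum_dom => i; exact: du.
have vk k : (nsum (v k) < +oo)%E.
  by elim: k => // k; apply: nsum_dom => i; exact: dv.
have hW : (nsum (fun i => sq (W (e i))) < +oo)%E.
  by apply: nsum_dom u0 => i; have := u_diff 0 i; have := fu 1%N i; rewrite /= -/(sq _); lra.
have step k : fine (nsum (u k)) - fine (nsum (u k.+1)) = fine (nsum (v k)) - fine (nsum (v k.+1)).
  rewrite -(rsum_split (fu k) (fu k.+1) (uk k) (uk k.+1) (fun=> erefl)).
  rewrite -(rsum_split (fv k) (fv k.+1) (vk k) (vk k.+1) (fun=> erefl)).
  rewrite (eq_rsum (u_diff k)) (eq_rsum (v_diff k)).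
  apply: (trace_cyclic hH be (A := fun x => W (iter k S x)) (A' := fun x => iter k S (W' x))) => //.
    by move=> x y; rewrite adjW (sa_iter k sS).
  apply: nsum_dom hW => i; rewrite -(iter_comm _ _ SW); exact: sq_iter.
have const k : fine (nsum (u 0)) - fine (nsum (v 0)) = fine (nsum (u k)) - fine (nsum (v k)).
  by elim: k => // k ->; have := step k; lra.
have /choice[L hL] : forall x, exists y, hcvg (fun n => iter n S x) y.
  by move=> x; apply: (power_cvg hH Tt Ts (sa_sub sS) (sa_rip sS) S0' S1').
have [SL LL sL] := power_limit sS SK hL.
have lim T : self_adjoint ip T -> (forall x, T (T x) = T x) -> (forall x, S (T x) = T (S x)) ->
    (forall x, sq (T x) <= 1 * sq x) ->
    forall w, w = (fun k i => rip (iter k.+1 S (T (e i))) (T (e i))) ->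
    (nsum (w 0%N) < +oo)%E ->
    exists n : nat, fine (nsum (w k)) @[k --> \oo] --> (n%:R : R).
  move=> sT TT ST TK w -> w0; pose G x := T (L x).
  have TL x : T (L x) = L (T x).
    apply: (hcvg_uniq (hcvg_map (sa_sub sT) TK (hL x))).
    apply/hcvgP => d d0; have [N hN] := (hcvgP _ _ _).1 (hL (T x)) d d0.
    by exists N => n Nn; rewrite -(iter_comm _ _ ST); exact: hN.
  have wl i : rip (iter k.+1 S (T (e i))) (T (e i)) @[k --> \oo] --> sq (G (e i)).
    rewrite (_ : sq (G (e i)) = rip (L (T (e i))) (T (e i))).
      exact: (hcvg_rip (z := T (e i)) (u := fun n => iter n.+1 S (T (e i))) (hcvg_shift (hL _))).
    by rewrite /G TL -[in RHS]LL (sa_rip sL).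
  have hG : (nsum (fun i => sq (G (e i))) < +oo)%E.
    apply: nsum_dom w0 => i; apply: (cvgr_to_le (wl i)); apply: nearW => k.
    by elim: k => // k; apply: le_trans; exact: pow_decr.
  have [n hn] := trace_projection_nat hH be (sa_comp sT sL TL) (fun x => etrans (congr1 T (esym
    (TL _))) (etrans (TT _) (congr1 T (LL x)))) hG.
  exists n; rewrite -[n%:R]/(fine (n%:R)%:E) -hn.
  by apply: (@nsum_decr _ _ (fun k i => rip (iter k.+1 S (T (e i))) (T (e i)))).
have contr T : self_adjoint ip T -> (forall x, T (T x) = T x) -> forall x, sq (T x) <= 1 * sq x.
  move=> sT TT x; have := sq_ge0 ip (x - T x).
  rewrite sqB mul1r -(sa_rip sT) -{1}TT (sa_rip sT) -/(sq _).
  lra.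
have [n hn] := lim P sP PP SP (contr _ sP PP) u erefl u0.
have [m hm] := lim Pc sPc PcPc SPc (contr _ sPc PcPc) v erefl v0.
exists (n%:Z - m%:Z); rewrite rmorphB /=.
have hc : (fun k => fine (nsum (u k)) - fine (nsum (v k))) @ \oo --> (n%:R - m%:R : R).
  exact: cvgB.
have hd : (fun k => fine (nsum (u k)) - fine (nsum (v k))) @ \oo --> fine (nsum (u 0)) - fine
  (nsum (v 0)).
  by under eq_fun do rewrite -const; exact: cvg_cst.
by rewrite -(cvg_lim (@Rhausdorff R) hd) (cvg_lim (@Rhausdorff R) hc).
Qed.

End ProjectionPair.

(** * Uniform boundedness and closed range *)

Section ClosedRange.
Context {R : realType} {H : completeNormedModType R[i]}.
Variable ip : {dot H for (@Num.conj R[i])}.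
Hypothesis hH : hilbert_norm ip.
Local Notation rip := (rip ip).
Local Notation sq := (sq ip).
Local Notation nrm := (nrm ip).
Local Notation hcvg := (hcvg ip).

(* Gliding hump: [z n.+1] differs from [z n] by a vector of length [3^-n.+1] along [f n]. *)
Lemma uniform_bounded_rip (F : set H) :
  (forall z, exists M, forall f, F f -> `|rip z f| <= M) ->
  exists M, forall f, F f -> nrm f <= M.
Proof.
move=> hF; apply: contrapT => hn.
have /choice[f hf] : forall n : nat, exists f, F f /\ n%:R * 2 * 3 ^+ n.+1 < nrm f.
  move=> n; apply: contrapT => h; apply: hn; exists (n%:R * 2 * 3 ^+ n.+1) => f Ff.
  by rewrite leNgt; apply/negP => h'; apply: h; exists f.
have fp n : 0 < nrm (f n).
  by apply: le_lt_trans (hf n).2; rewrite !mulr_ge0// exprn_ge0.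
have t0 n : 0 < 3 ^- n :> R by rewrite invr_gt0 exprn_gt0.
pose a n := (3 ^- n.+1 / nrm (f n))%:C *: f n.
have na n : nrm (a n) = 3 ^- n.+1.
  rewrite /nrm sqZr -nrm2 -exprMn divfK ?gt_eqF// sqrtr_sqr ger0_norm ?ltW//.
have ra n : rip (a n) (f n) = 3 ^- n.+1 * nrm (f n).
  by rewrite ripZl -[rip _ _]/(sq _) -nrm2 expr2 mulrA divfK// gt_eqF.
(* The sign prevents cancellation, so |<z n.+1, f n>| is at least 3^-(n+1) |f n|. With ratio 1/3 all
   later humps together have at most half the length of this one, and half of the pairing survives
   in the limit. *)
pose step n z := if 0 <= rip z (f n) then z + a n else z - a n.
pose z := fix z n := if n is k.+1 then step k (z k) else 0.
have nN x : nrm (- x) = nrm x by rewrite /nrm sqN.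
have zs n : nrm (z n.+1 - z n) = 3 ^- n.+1.
  rewrite /= /step; case: ifP => _; rewrite addrAC subrr add0r ?nN; exact: na.
have zr n : 3 ^- n.+1 * nrm (f n) <= `|rip (z n.+1) (f n)|.
  rewrite /= /step; case: ifP => [h|/negbT].
    by rewrite ripDl ra ger0_norm ?lerDr// addr_ge0// mulr_ge0 ?nrm_ge0// ltW.
  rewrite -ltNge => h; rewrite ripBl ra ler0_norm;
    last by rewrite subr_le0 (le_trans (ltW h))// mulr_ge0 ?nrm_ge0// ltW.
  by rewrite opprB lerBrDr gerDl ltW.
have zd n k : nrm (z (n + k)%N - z n) <= (3 ^- n - 3 ^- (n + k)) / 2.
  elim: k => [|k ih]; first by rewrite addn0 !subrr mul0r /nrm sq0 sqrtr0.
  have -> : z (n + k.+1)%N - z n = (z (n + k).+1 - z (n + k)%N) + (z (n + k)%N - z n).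
    by rewrite addnS addrA subrK.
  apply: le_trans (nrmD hH _ _) _; rewrite zs addnS.
  have -> : 3 ^- (n + k).+1 = 3^-1 * 3 ^- (n + k) :> R by rewrite exprS invfM.
  move: ih; lra.
have zd' n k : nrm (z (n + k)%N - z n) <= 3 ^- n / 2.
  by apply: le_trans (zd n k) _; rewrite ler_pM2r// gerBl ltW.
have zlow n k : 2^-1 * (3 ^- n.+1 * nrm (f n)) <= `|rip (z (n.+1 + k)%N) (f n)|.
  have h1 := zr n.
  have h2 : `|rip (z (n.+1 + k)%N - z n.+1) (f n)| <= 3 ^- n.+1 / 2 * nrm (f n).
    by apply: le_trans (rip_nrm _ _ _) _; rewrite ler_wpM2r ?nrm_ge0.
  have h3 := lerB_normD (rip (z n.+1) (f n)) (rip (z (n.+1 + k)%N - z n.+1) (f n)).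
  have E : rip (z n.+1) (f n) + rip (z (n.+1 + k)%N - z n.+1) (f n) = rip (z (n.+1 + k)%N) (f n).
    by rewrite ripBl addrC subrK.
  move: h3; rewrite E; lra.
have [y hy] : exists y, hcvg z y.
  apply: (hcomplete hH) => e e0.
  have ct : 3 ^- n @[n --> \oo] --> (0 : R).
    under eq_fun do rewrite -exprVn; apply: cvg_expr.
    by rewrite ger0_norm ?invr_ge0// invf_lt1// ltr1n.
  have s0 : 0 < Num.sqrt e by rewrite sqrtr_gt0.
  have [N _ hN] := cvgr_lt _ ct _ s0.
  exists N => m n Nm Nn.
  have -> : z n - z m = (z n - z N) - (z m - z N) by rewrite opprB addrA subrK.
  have h : nrm (z n - z N - (z m - z N)) < Num.sqrt e.
    apply: le_lt_trans (nrmD hH _ _) _; rewrite nN.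
    have := zd' N (n - N)%N; have := zd' N (m - N)%N; rewrite !subnKC//.
    have := hN N (leqnn N); rewrite /=; lra.
  rewrite -nrm2 -[e](sqr_sqrtr (ltW e0)) ltr_pXn2r// nnegrE ?nrm_ge0//.
have [M hM] := hF y.
pose n := (Num.truncn (`|M|)).+1.
have hn1 : M < n%:R by apply: le_lt_trans (ler_norm M) _; rewrite truncnS_gt.
have := hM _ (hf n).1; apply/negP; rewrite -ltNge.
have hl : 2^-1 * (3 ^- n.+1 * nrm (f n)) <= `|rip y (f n)|.
  have hc : (fun m => `|rip (z m) (f n)|) @ \oo --> `|rip y (f n)|.
    by apply: cvg_norm; exact: hcvg_rip.
  apply: (cvgr_to_ge hc); exists n.+1 => // m nm /=.
  by have := zlow n (m - n.+1)%N; rewrite subnKC.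
apply: lt_le_trans hl; apply: lt_trans hn1 _.
have tp : 0 < 3 ^+ n.+1 :> R by rewrite exprn_gt0.
have -> : 2^-1 * (3 ^- n.+1 * nrm (f n)) = nrm (f n) / (2 * 3 ^+ n.+1).
  by field; rewrite gt_eqF.
have tp2 : 0 < 2 * 3 ^+ n.+1 :> R by rewrite mulr_gt0.
by rewrite (ltr_pdivlMr _ _ tp2) mulrA; exact: (hf n).2.
Qed.

(** The powers of S = 1 - T^2 / K' converge to the projection L onto ker T, and x - L x lies in the
    closure of the range, so x = L x + T u. Therefore the f orthogonal to ker T with |T f| <= 1 are
    weakly bounded, as <x, f> = <u, T f>; uniform boundedness gives the constant. *)
Lemma closed_range_coercive (T : H -> H) (K : R) : self_adjoint ip T ->
  (forall x, sq (T x) <= K * sq x) -> closed (range T) ->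
  exists2 c, 0 < c & forall x, (forall y, T y = 0 -> ip x y = 0) -> c * sq x <= sq (T x).
Proof.
move=> sT TK clT.
have K0 : 0 < `|K| + 1 by rewrite ltr_wpDl.
set K' := `|K| + 1 in K0.
have TK' x : sq (T x) <= K' * sq x.
  by apply: le_trans (TK x) _; rewrite ler_wpM2r ?sq_ge0// ler_wpDr// ler_norm.
pose S x := x - K'^-1%:C *: T (T x).
have sS : self_adjoint ip S.
  by move=> x y; rewrite ipBl ipBr ipZl ipZr conjR !sT.
have TB := sa_sub sT.
have ripS x : rip (S x) x = sq x - K'^-1 * sq (T x).
  by rewrite ripBl ripZl (sa_rip sT).
have S0 x : setT x -> 0 <= rip (S x) x.
  by move=> _; rewrite ripS subr_ge0 mulrC ler_pdivrMr// mulrC.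
have S1 x : setT x -> rip (S x) x <= sq x.
  by move=> _; rewrite ripS gerBl mulr_ge0 ?sq_ge0// invr_ge0 ltW.
have Tt (x y : H) : setT x -> setT y -> setT (x - y) by [].
have Ts (x : H) : setT x -> setT (S x) by [].
have SK x : sq (S x) <= 1 * sq x.
  rewrite mul1r; apply: le_trans (S1 x Logic.I).
  exact: (sq_contract Tt Ts (sa_sub sS) (sa_rip sS) S0 S1).
have /choice[L hL] : forall x, exists y, hcvg (fun n => iter n S x) y.
  by move=> x; apply: (power_cvg hH Tt Ts (sa_sub sS) (sa_rip sS) S0 S1).
have [SL _ _] := power_limit sS SK hL.
have TL x : T (L x) = 0.
  have : K'^-1 * sq (T (L x)) = 0.
    by have := ripS (L x); rewrite SL -[rip _ _]/(sq _); lra.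
  by move=> /eqP; rewrite mulf_eq0 invr_eq0 gt_eqF//= => /eqP/sq_eq0.
have dec x : exists u, x = L x + T u.
  have : range T (x - L x).
    apply: clT; apply/(hclosureP hH) => e e0.
    have [N hN] := (hcvgP _ _ _).1 (hL x) e e0.
    exists (x - iter N S x); last first.
      have -> : x - L x - (x - iter N S x) = iter N S x - L x.
        by rewrite opprB addrC addrA subrK.
      exact: hN.
    elim: (N) => [|k [u _ hu]].
      by exists 0 => //=; rewrite subrr -[X in T X](subrr 0) TB subrr.
    exists (u + K'^-1%:C *: T (iter k S x)) => //.
    apply: (@ip_nondeg _ _ ip) => y; rewrite sT ipDl ipZl -!sT hu /= {3}/S.
    by rewrite !(ipDl, ipNl) ipZl !sT; ring.
  by move=> [u _ hu]; exists u; rewrite hu addrC subrK.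
pose F := [set f | (forall y, T y = 0 -> ip f y = 0) /\ sq (T f) <= 1].
have [|M hM] := @uniform_bounded_rip F.
  move=> z; have [u hu] := dec z; exists (nrm u) => f [fV f1].
  rewrite hu ripDl ripC (rip_ip0 (fV _ (TL z))) add0r (sa_rip sT).
  apply: le_trans (rip_nrm _ _ _) _; rewrite ler_piMr ?nrm_ge0//.
  by rewrite /nrm -[leRHS](sqrtr1) ler_wsqrtr.
exists (M ^+ 2 + 1)^-1; first by rewrite invr_gt0 ltr_wpDl// sqr_ge0.
move=> x xV; rewrite mulrC ler_pdivrMr ?ltr_wpDl ?sqr_ge0//.
have [T0|Tn] := eqVneq (sq (T x)) 0.
  by rewrite (_ : sq x = 0) ?T0 ?mul0r//; apply/rip_ip0/xV/sq_eq0/T0.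
have Tp : 0 < sq (T x) by rewrite lt_def Tn sq_ge0.
have Np : 0 < nrm (T x) by rewrite sqrtr_gt0.
have : nrm ((nrm (T x))^-1%:C *: x) <= M.
  apply: hM; split=> [y Ty|]; first by rewrite ipZl xV// mulr0.
  by rewrite (sa_scale sT) sqZr exprVn nrm2 mulVf.
have M0 : 0 <= M.
  by apply: le_trans (nrm_ge0 ip 0) _; apply: hM; split=> [y _|];
    rewrite ?ip0l// -[X in T X](subrr 0) TB subrr sq0.
rewrite -(@ler_pXn2r _ 2)// ?nnegrE ?nrm_ge0// nrm2 sqZr exprVn nrm2.
rewrite mulrC ler_pdivrMr// => h; apply: le_trans h _.
by rewrite mulrC ler_wpM2l ?sq_ge0// lerDl.
Qed.

End ClosedRange.

(** * The majorization function as a sum of hinge and tent functions *)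

Section MajorizationFormulas.
Context {R : realType}.

Definition posp (b x : R) := Num.max (x - b) 0.
Definition negp (b x : R) := Num.max (b - x) 0.
(** For 0 < a < 1, the Green function at a of minus the second derivative on [0, 1] with zero
    boundary values, extended by 0. *)
Definition tent (a x : R) := (if 0 <= x < a then (1 - a) * x else 0) +
  (if a <= x <= 1 then a * (1 - x) else 0).

Lemma posp_ge0 b x : 0 <= posp b x. Proof. by rewrite le_max lexx orbT. Qed.
Lemma negp_ge0 b x : 0 <= negp b x. Proof. by rewrite le_max lexx orbT. Qed.
Lemma tent_ge0 a x : 0 < a < 1 -> 0 <= tent a x.
Proof.
by rewrite /tent => /andP[? ?]; case: ifPn => [/andP[? ?]|_]; case: ifPn => [/andP[? ?]|_]; nra.
Qed.

Section Sequence.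
Context (I : countType) (d : I -> R).

Lemma majf_le0 b : b <= 0 -> majf d b = nsum (fun i => negp b (d i)).
Proof.
move=> b0; rewrite /majf b0 esum_mkcond; apply: eq_esum => i _; rewrite /negp.
case: ifPn => [/set_mem /= h|/negP h].
  by rewrite max_l// subr_ge0.
rewrite max_r// subr_le0 leNgt; apply/negP => h'; apply: h; apply/mem_set.
exact: ltW.
Qed.

Lemma majf_ge1 b : 1 <= b -> majf d b = nsum (fun i => posp b (d i)).
Proof.
move=> b1; rewrite /majf leNgt (lt_le_trans ltr01 b1)/= ltNge b1/=.
rewrite esum_mkcond; apply: eq_esum => i _; rewrite /posp.
case: ifPn => [/set_mem /= h|/negP h].
  by rewrite max_l// subr_ge0.
rewrite max_r// subr_le0 leNgt; apply/negP => h'; apply: h; apply/mem_set.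
exact: ltW.
Qed.

Lemma majf_mid a : 0 < a < 1 -> majf d a = nsum (fun i => tent a (d i)).
Proof.
move=> /andP[a0 a1]; rewrite /majf leNgt a0/= a1.
rewrite [majC _ _]esum_mkcond [majD _ _]esum_mkcond.
rewrite -!esumZ ?subr_ge0 ?(ltW a1) ?(ltW a0)//; first last.
- by move=> i; case: ifPn => // /set_mem /= /andP[? ?]; rewrite lee_fin.
- by move=> i; case: ifPn => // /set_mem /= /andP[? ?]; rewrite lee_fin subr_ge0.
rewrite -esumD; first last.
- move=> i _; case: ifPn => [/set_mem /= /andP[? ?]|_]; rewrite ?mule0// -EFinM lee_fin; nra.
- move=> i _; case: ifPn => [/set_mem /= /andP[? ?]|_]; rewrite ?mule0// -EFinM lee_fin; nra.
have ifE (A : set I) (p : I -> bool) (c y : R) i : (A i <-> p i) ->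
    (c%:E * (if i \in A then y%:E else 0) = (if p i then c * y else 0)%:E)%E.
  move=> Ap; have -> : (i \in A) = p i by apply/idP/idP => [/set_mem/Ap|/Ap/mem_set].
  by case: ifP => _; rewrite ?mule0 ?EFinM.
apply: eq_esum => i _; rewrite /tent [RHS]EFinD.
by rewrite (ifE _ (fun i => 0 <= d i < a))// (ifE _ (fun i => a <= d i <= 1)).
Qed.

Lemma majf_ge0 a : (0 <= majf d a)%E.
Proof.
have [a0|a0] := leP a 0; first by rewrite majf_le0// nsum_ge0// => i; exact: negp_ge0.
have [a1|a1] := ltP a 1; last by rewrite majf_ge1// nsum_ge0// => i; exact: posp_ge0.
by rewrite majf_mid ?a0 ?a1// nsum_ge0// => i; apply: tent_ge0; rewrite a0.
Qed.

End Sequence.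

Lemma finite_ge_nsum (T : choiceType) (f : T -> R) (c : R) : (forall i, 0 <= f i) ->
  (nsum f < +oo)%E -> 0 < c -> finite_set [set i | c <= f i].
Proof.
move=> f0 hf c0; apply: contrapT => hinf.
pose n := (Num.truncn (fine (nsum f) / c)).+1.
have [X XA Xn] := infinite_set_fset n hinf.
have h := nsum_seq_le f0 (fset_uniq X).
have h2 : n%:R * c <= \sum_(i <- X) f i.
  apply: (@le_trans _ _ (\sum_(i <- X) c)).
    rewrite big_const_seq count_predT iter_addr addr0 -[X in _ <= X]mulr_natl.
    by apply: ler_wpM2r; [exact: ltW|rewrite ler_nat].
  by rewrite big_seq [leRHS]big_seq; apply: ler_sum => i iX; apply: XA.
move: h; rewrite -(fineK (nsum_fin f0 hf)) lee_fin => h.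
have := le_trans h2 h; rewrite -ler_pdivlMr// leNgt => /negP; apply.
by rewrite truncnS_gt.
Qed.

End MajorizationFormulas.

(** * Averages along one row and the excess *)

Section Averages.
Context {R : realType}.

(** A class of functions that contains hinges, tents and affine functions, is stable under linear
    combinations, and has absolutely convergent averages. *)
Definition affine_growth (f : R -> R) := exists C, forall x, `|f x| <= C * (1 + `|x|).

Lemma affine_growthD f g : affine_growth f -> affine_growth g ->
  affine_growth (fun x => f x + g x).
Proof.
move=> [C hC] [D hD]; exists (C + D) => x; apply: le_trans (ler_normD _ _) _.
by rewrite mulrDl lerD.
Qed.

Lemma affine_growthZ c f : affine_growth f -> affine_growth (fun x => c * f x).
Proof.
move=> [C hC]; exists (`|c| * C) => x; rewrite normrM -mulrA.
by rewrite ler_wpM2l.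
Qed.

Lemma affine_growth_cst c : affine_growth (fun=> c).
Proof. by exists `|c| => x; rewrite ler_peMr// lerDl. Qed.

Lemma affine_growth_id : affine_growth id.
Proof. by exists 1 => x; rewrite mul1r lerDr. Qed.

Lemma affine_growth_dom f g : (forall x, `|f x| <= `|g x|) -> affine_growth g -> affine_growth f.
Proof. by move=> fg [C hC]; exists C => x; exact: le_trans (fg x) (hC x). Qed.

Lemma affine_growth_posp b : affine_growth (posp b).
Proof.
apply: (@affine_growth_dom _ (fun x => x + - b)).
  by move=> x; rewrite ger0_norm ?posp_ge0// /posp ge_max normr_ge0 ler_norm.
by apply: affine_growthD; [exact: affine_growth_id|exact: affine_growth_cst].
Qed.

Lemma affine_growth_negp b : affine_growth (negp b).
Proof.
apply: (@affine_growth_dom _ (fun x => x + - b)).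
  by move=> x; rewrite ger0_norm ?negp_ge0// /negp ge_max normr_ge0 -normrN opprB ler_norm.
by apply: affine_growthD; [exact: affine_growth_id|exact: affine_growth_cst].
Qed.

Lemma affine_growth_tent a : 0 < a < 1 -> affine_growth (tent a).
Proof.
move=> a01; apply: (@affine_growth_dom _ (fun=> 1)); last exact: affine_growth_cst.
move=> x; rewrite normr1 ger0_norm ?tent_ge0// /tent; case/andP: a01 => ? ?.
by case: ifPn => [/andP[? ?]|_]; case: ifPn => [/andP[? ?]|_]; nra.
Qed.

Context (J : choiceType) (l : J -> R) (w : J -> R) (t s M d : R).
Hypotheses (lM : forall j, `|l j| <= M) (w0 : forall j, 0 <= w j) (t0 : 0 <= t) (s0 : 0 <= s).
Hypothesis wsum : (nsum w + (t + s)%:E = 1)%E.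
Hypothesis mean : rsum (fun j => w j * l j) + t = d.

Definition avg (f : R -> R) := rsum (fun j => w j * f (l j)) + t * f 1 + s * f 0.

Lemma w_fin : (nsum w < +oo)%E.
Proof. by move: wsum; case: (nsum w) => //= r _; rewrite ltry. Qed.

Lemma absum_avg f : affine_growth f -> absum (fun j => w j * f (l j)).
Proof.
move=> [C hC]; have hw := w_fin.
apply: (@absum_dom _ _ _ (fun j => `|C| * (1 + M) * w j)).
  move=> j; rewrite normrM (ger0_norm (w0 j)) mulrC ler_wpM2r//.
  apply: le_trans (hC _) _; apply: le_trans (ler_wpM2r _ (ler_norm C)) _.
    by rewrite addr_ge0.
  by rewrite ler_wpM2l// lerD2l.
by apply: absumZ; rewrite absumE.
Qed.

Lemma avgD f g : affine_growth f -> affine_growth g ->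
  avg (fun x => f x + g x) = avg f + avg g.
Proof.
move=> hf hg; rewrite /avg (@eq_rsum _ _ _ (fun j => w j * f (l j) + w j * g (l j))).
  by rewrite rsumD; [ring|exact: absum_avg|exact: absum_avg].
by move=> j; rewrite mulrDr.
Qed.

Lemma avgZ c f : affine_growth f -> avg (fun x => c * f x) = c * avg f.
Proof.
move=> hf; rewrite /avg (@eq_rsum _ _ _ (fun j => c * (w j * f (l j)))).
  by rewrite rsumZ; [ring|exact: absum_avg].
by move=> j; ring.
Qed.

Lemma avg_cst c : avg (fun=> c) = c.
Proof.
rewrite /avg (@eq_rsum _ _ _ (fun j => c * w j)); last by move=> j; rewrite mulrC.
have aw : absum w by rewrite absumE ?w_fin.
rewrite rsumZ// rsum_ge0E ?w_fin//.
have : fine (nsum w) + (t + s) = 1.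
  apply: EFin_inj; rewrite EFinD fineK; [exact: wsum|apply: nsum_fin w_fin; exact: w0].
by move=> h; transitivity (c * (fine (nsum w) + (t + s))); [ring|rewrite h mulr1].
Qed.

Lemma avg_id : avg id = d.
Proof. by rewrite /avg mulr1 mulr0 addr0 -[RHS]mean. Qed.

Lemma avg_ge0 f : (forall x, 0 <= f x) -> 0 <= avg f.
Proof.
move=> f0; apply: addr_ge0; last exact: mulr_ge0.
by apply: addr_ge0; [apply: rsum_ge0 => j|]; exact: mulr_ge0.
Qed.

Lemma avg_affine f g a b : affine_growth g -> (forall x, f x = g x + (a + b * x)) ->
  avg f = avg g + (a + b * d).
Proof.
move=> hg fE; have -> : f = (fun x => g x + (a + b * x)) by apply/funext => x; exact: fE.
have hb : affine_growth (fun x : R => b * x) by apply: affine_growthZ; exact: affine_growth_id.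
have ha := affine_growth_cst a.
rewrite avgD//; last exact: affine_growthD.
by rewrite avgD// avg_cst (avgZ _ affine_growth_id) avg_id.
Qed.

Lemma avg_le f g : affine_growth f -> affine_growth g -> (forall x, f x <= g x) -> avg f <= avg g.
Proof.
move=> hf hg fg; rewrite -subr_ge0 -mulN1r -avgZ// -avgD//.
  by apply: avg_ge0 => x; rewrite mulN1r subr_ge0.
exact: affine_growthZ.
Qed.

(** Of the two hinges at [b], the one that vanishes at the mean [d]: its average is the Jensen
    defect with nothing to subtract, and it is supported on the opposite side of [b]. *)
Definition split_part b x := if d < b then posp b x else negp b x.

Lemma split_part_ge0 b x : 0 <= split_part b x.
Proof. by rewrite /split_part; case: ifP; rewrite ?posp_ge0 ?negp_ge0. Qed.

Lemma affine_growth_split b : affine_growth (split_part b).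
Proof.
by rewrite /split_part; case: (d < b); [exact: affine_growth_posp|exact: affine_growth_negp].
Qed.

(* The excess at [b] of the row with weights [w], [t], [s]: the defect in the
   Jensen inequality for the convex functions [posp b] and [negp b]. *)
Definition excess b := avg (split_part b).

Lemma excess_ge0 b : 0 <= excess b.
Proof. by apply: avg_ge0 => x; exact: split_part_ge0. Qed.

Lemma excess_negp b : avg (negp b) = negp b d + excess b.
Proof.
rewrite /excess /split_part; case: (ltP d b) => db; last first.
  by rewrite [X in X + _](_ : _ = 0) ?add0r// /negp max_r// subr_le0.
rewrite (@avg_affine _ (posp b) b (-1)); last 2 first.
- exact: affine_growth_posp.
- by move=> x; rewrite /negp /posp; case: (leP (b - x) 0); case: (leP (x - b) 0); lra.
by rewrite /negp max_l; lra.
Qed.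

Lemma excess_posp b : avg (posp b) = posp b d + excess b.
Proof.
rewrite (@avg_affine _ (negp b) (- b) 1); last 2 first.
- exact: affine_growth_negp.
- by move=> x; rewrite /negp /posp; case: (leP (b - x) 0); case: (leP (x - b) 0); lra.
by rewrite excess_negp /negp /posp; case: (leP (b - d) 0); case: (leP (d - b) 0); lra.
Qed.

(** Averaging the pointwise identity tent_a(x) + (x - a)_+ = (1 - a) x_+ + a (x - 1)_+ and
    subtracting its value at the mean. *)
Lemma excess_tent a : 0 < a < 1 ->
  avg (tent a) + excess a = tent a d + (1 - a) * excess 0 + a * excess 1.
Proof.
move=> a01; have [a0 a1] := andP a01.
have h0 := excess_posp 0; have h1 := excess_posp 1; have ha := excess_posp a.
have tE x : tent a x + posp a x = (1 - a) * posp 0 x + a * posp 1 x.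
  rewrite /tent /posp; case: (ltP x 0) => [x0|x0]; case: (ltP x a) => [xa|xa];
    case: (leP x 1) => [x1|x1] /=; case: (leP (x - a) 0); case: (leP (x - 0) 0);
    case: (leP (x - 1) 0); nra.
have E : avg (tent a) + avg (posp a) = (1 - a) * avg (posp 0) + a * avg (posp 1).
  rewrite -avgD; [|exact: affine_growth_tent|exact: affine_growth_posp].
  have -> : (fun x => tent a x + posp a x) = (fun x => (1 - a) * posp 0 x + a * posp 1 x).
    by apply/funext.
  rewrite avgD ?avgZ//; try exact: affine_growth_posp;
    by apply: affine_growthZ; exact: affine_growth_posp.
by have := tE d; move: E; rewrite h0 h1 ha; lra.
Qed.

(** Continuity in the level, for use in Fatou's lemma. Both terms of the defect
    [avg (negp b) - negp b d] move by at most c - b. *)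
Lemma excess_lip b c : b <= c -> `|excess b - excess c| <= 2 * (c - b).
Proof.
move=> bc; have hb := excess_negp b; have hc := excess_negp c.
have h1 : avg (negp b) <= avg (negp c).
  apply: avg_le; try exact: affine_growth_negp.
  by move=> x; rewrite /negp; case: (leP (b - x) 0); case: (leP (c - x) 0); lra.
have h2 : avg (negp c) <= avg (negp b) + (c - b).
  rewrite -[X in _ + X](avg_cst) -avgD; [|exact: affine_growth_negp|exact: affine_growth_cst].
  apply: avg_le; [exact: affine_growth_negp| |].
    by apply: affine_growthD; [exact: affine_growth_negp|exact: affine_growth_cst].
  by move=> x; rewrite /negp; case: (leP (b - x) 0); case: (leP (c - x) 0); lra.
have h3 : negp b d <= negp c d <= negp b d + (c - b).
  by rewrite /negp; case: (leP (b - d) 0); case: (leP (c - d) 0); lra.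
by rewrite ler_norml; move: h3 => /andP[]; lra.
Qed.

Lemma excess_weight b j : w j * split_part b (l j) <= excess b.
Proof.
rewrite /excess /avg -addrA; apply: ler_wpDr.
  by rewrite addr_ge0// mulr_ge0// split_part_ge0.
have h j' : 0 <= w j' * split_part b (l j') by rewrite mulr_ge0// split_part_ge0.
have hs := absum_avg (affine_growth_split b); rewrite absumE// in hs.
rewrite rsum_ge0E//.
by rewrite -lee_fin fineK; [exact: le_nsum1|exact: nsum_fin].
Qed.

Lemma excess_ts b : t * split_part b 1 + s * split_part b 0 <= excess b.
Proof.
rewrite /excess /avg -addrA lerDr rsum_ge0// => j.
by rewrite mulr_ge0// split_part_ge0.
Qed.

Lemma avg_nsum f : (forall x, 0 <= f x) -> affine_growth f -> f 0 = 0 -> f 1 = 0 ->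
  (avg f)%:E = nsum (fun j => w j * f (l j)).
Proof.
move=> f0 hf h0 h1; rewrite /avg h0 h1 !mulr0 !addr0.
have h j : 0 <= w j * f (l j) by rewrite mulr_ge0.
have hs := absum_avg hf; rewrite absumE// in hs.
by rewrite rsum_ge0E// fineK// nsum_fin.
Qed.

End Averages.

(** * The total excess and its relation to the majorization functions *)

Section TotalExcess.
Context {R : realType} (I J : countType) (l : J -> R) (d : I -> R).
Context (w : I -> J -> R) (t s : I -> R) (M : R).
Hypotheses (lM : forall j, `|l j| <= M) (w0 : forall i j, 0 <= w i j).
Hypotheses (t0 : forall i, 0 <= t i) (s0 : forall i, 0 <= s i).
Hypothesis rows : forall i, (nsum (w i) + (t i + s i)%:E = 1)%E.
Hypothesis mean : forall i, rsum (fun j => w i j * l j) + t i = d i.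

Local Notation ex i := (excess l (w i) (t i) (s i) (d i)).
Definition total_excess b := nsum (fun i => ex i b).

Let ex0 i b : 0 <= ex i b. Proof. exact: excess_ge0. Qed.

(** Interchange of summation. The zeros of [f] at 0 and 1 remove [t] and [s], about whose totals
    over the rows nothing is assumed. *)
Lemma nsum_avg f : (forall x, 0 <= f x) -> affine_growth f -> f 0 = 0 -> f 1 = 0 ->
  (forall j, f (l j) != 0 -> nsum (w ^~ j) = 1%E) ->
  nsum (fun i => avg l (w i) (t i) (s i) f) = nsum (fun j => f (l j)).
Proof.
move=> f0 hf h0 h1 cols.
transitivity (\esum_(i in setT) \esum_(j in setT) (w i j * f (l j))%:E)%E.
  by apply: eq_esum => i _; exact: (avg_nsum lM).
rewrite esum_swap; last by move=> i j; rewrite lee_fin mulr_ge0.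
apply: eq_esum => j _.
have -> : (\esum_(i in setT) (w i j * f (l j))%:E = (f (l j))%:E * nsum (w ^~ j))%E.
  by rewrite -nsumZ//; apply: eq_esum => i _; rewrite mulrC.
by have [->|/cols ->] := eqVneq (f (l j)) 0; rewrite ?mul0e// mule1.
Qed.

Section PartialColumns.
Hypothesis cols : forall j, ~~ (0 <= l j <= 1) -> nsum (w ^~ j) = 1%E.

Lemma majf_le0_excess b : b <= 0 -> majf l b = (majf d b + total_excess b)%E.
Proof.
move=> b0; rewrite !majf_le0// -nsumD//; last by move=> i; exact: negp_ge0.
rewrite -(@nsum_avg (negp b)).
- by apply: eq_nsum => i; exact: (excess_negp lM).
- exact: negp_ge0.
- exact: affine_growth_negp.
- by rewrite /negp max_r//; lra.
- by rewrite /negp max_r//; lra.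
move=> j nz; apply: cols; apply: contraNN nz => /andP[l0 l1].
by rewrite /negp max_r//; lra.
Qed.

Lemma majf_ge1_excess b : 1 <= b -> majf l b = (majf d b + total_excess b)%E.
Proof.
move=> b0; rewrite !majf_ge1// -nsumD//; last by move=> i; exact: posp_ge0.
rewrite -(@nsum_avg (posp b)).
- by apply: eq_nsum => i; exact: (excess_posp lM).
- exact: posp_ge0.
- exact: affine_growth_posp.
- by rewrite /posp max_r//; lra.
- by rewrite /posp max_r//; lra.
move=> j nz; apply: cols; apply: contraNN nz => /andP[l0 l1].
by rewrite /posp max_r//; lra.
Qed.

Lemma total_excess_ge0 b : (0 <= total_excess b)%E.
Proof. exact: nsum_ge0. Qed.

Let excess_cvg i b : ex i x @[x --> b] --> ex i b.
Proof.
apply/cvgrPdist_lt => e e0; near=> x.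
have h : `|b - x| < e / 2 by near: x; apply: cvgr_dist_lt => //; rewrite divr_gt0.
have [bx|/ltW xb] := leP b x.
  have := excess_lip lM (w0 i) (t0 i) (s0 i) (rows i) (mean i) bx.
  by move: h; rewrite ler0_norm; lra.
have := excess_lip lM (w0 i) (t0 i) (s0 i) (rows i) (mean i) xb.
by rewrite distrC; move: h; rewrite ger0_norm; lra.
Unshelve. all: by end_near. Qed.

Lemma limf_einf_ge (F : set_system R) {FF : ProperFilter F} (h : R -> \bar R) (x : \bar R) :
  (0 <= x)%E -> (forall m : R, (m%:E < x)%E -> \forall b \near F, (m%:E <= h b)%E) ->
  (x <= limf_einf h F)%E.
Proof.
move=> x0 hm; rewrite limf_einfE.
have key (m : R) : (m%:E < x)%E ->
    (m%:E <= ereal_sup [set ereal_inf (h @` V) | V in F])%E.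
  move=> /hm hF; apply: (@le_trans _ _ (ereal_inf (h @` [set b | (m%:E <= h b)%E]))).
    by apply: le_ereal_inf_tmp => _ [b /= hb <-].
  by apply: ereal_sup_ubound; exists [set b | (m%:E <= h b)%E].
case: x x0 hm key => [r| |] // r0 _ key.
  apply/lee_subgt0Pr => e e0; rewrite -EFinB; apply: key.
  by rewrite lte_fin ltrBlDr ltrDl.
rewrite leye_eq; apply/eqP/eqyP => A A0.
by apply: key; rewrite ltry.
Qed.

Lemma limf_einf_le (F : set_system R) {FF : ProperFilter F} (h : R -> \bar R) (x : \bar R) :
  (forall e : R, 0 < e -> \forall b \near F, (h b <= x + e%:E)%E) ->
  (limf_einf h F <= x)%E.
Proof.
move=> hx; apply/lee_addgt0Pr => e e0; rewrite limf_einfE.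
apply: ge_ereal_sup => _ [V FV <-].
have [b [Vb hb]] := filter_ex (filterI FV (hx e e0)).
by apply: le_trans hb; apply: ereal_inf_lbound; exists b.
Qed.

(** Along the filter both majorization values are finite and differ by the total excess, which is
    lower semicontinuous in the level by Fatou. *)
Lemma total_excess_le_delta (F : set_system R) {FF : ProperFilter F} c :
  (forall (f : R -> R), f x @[x --> c] --> f c -> f x @[x --> F] --> f c) ->
  (\forall b \near F, majf l b = (majf d b + total_excess b)%E /\ (majf l b < +oo)%E) ->
  (total_excess c <= limf_einf (fun b => majf l b - majf d b)%E F)%E.
Proof.
move=> Fc hF; apply: limf_einf_ge => [|m hm]; first exact: nsum_ge0.
have cF i := Fc _ (excess_cvg (i := i) (b := c)).
have hG : \forall b \near F, (m%:E < total_excess b)%E.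
  exact: (nsum_fatou (fun b i => ex0 i b) cF hm).
apply: filterS2 hF hG => b [hb fb] hmb; rewrite hb addeAC subee ?add0e; first exact: ltW.
rewrite ge0_fin_numE ?majf_ge0//; apply: le_lt_trans fb.
by rewrite hb leeDl// total_excess_ge0.
Qed.

Lemma total_excess_left : (forall b, b < 0 -> (majf l b < +oo)%E) ->
  (total_excess 0%R <= deltaL l d)%E.
Proof.
move=> hfin; apply: total_excess_le_delta => [f|]; first exact: cvg_at_left_filter.
near=> b; have b0 : b < 0 by near: b; exact: nbhs_left_lt.
by split; [exact/majf_le0_excess/ltW|exact: hfin].
Unshelve. all: by end_near. Qed.

Lemma total_excess_right : (forall b, 1 < b -> (majf l b < +oo)%E) ->
  (total_excess 1%R <= deltaU l d)%E.
Proof.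
move=> hfin; apply: total_excess_le_delta => [f|]; first exact: cvg_at_right_filter.
near=> b; have b0 : 1 < b by near: b; exact: nbhs_right_gt.
by split; [exact/majf_ge1_excess/ltW|exact: hfin].
Unshelve. all: by end_near. Qed.

End PartialColumns.

Lemma total_excess_mid a : 0 < a < 1 ->
  (total_excess a <= majf d a + ((1 - a)%:E * total_excess 0%R + a%:E * total_excess 1%R))%E.
Proof.
move=> a01; have [a0 a1] := andP a01.
have a2 : 0 <= 1 - a by rewrite subr_ge0 ltW.
have p1 i : 0 <= (1 - a) * ex i 0 by rewrite mulr_ge0.
have p2 i : 0 <= a * ex i 1 by rewrite mulr_ge0// ltW.
have p3 i : 0 <= tent a (d i) by exact: tent_ge0.
rewrite majf_mid// -(nsumZ (fun i => ex0 i 0) a2) -(nsumZ (fun i => ex0 i 1) (ltW a0)).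
rewrite -(nsumD p1 p2) -(nsumD p3 (fun i => addr_ge0 (p1 i) (p2 i))).
apply: le_nsum => i.
have := excess_tent lM (w0 i) (rows i) (mean i) a01.
have : 0 <= avg l (w i) (t i) (s i) (tent a).
  by apply: avg_ge0 => // x; exact: tent_ge0.
lra.
Qed.

Lemma majf_mid_excess a : (forall j, nsum (w ^~ j) = 1%E) -> 0 < a < 1 ->
  (majf l a + total_excess a =
   majf d a + ((1 - a)%:E * total_excess 0%R + a%:E * total_excess 1%R))%E.
Proof.
move=> cols a01; have [a0 a1] := andP a01.
have avg0 i : 0 <= avg l (w i) (t i) (s i) (tent a).
  by apply: avg_ge0 => // x; exact: tent_ge0.
have a2 : 0 <= 1 - a by rewrite subr_ge0 ltW.
have p1 i : 0 <= (1 - a) * ex i 0 by rewrite mulr_ge0.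
have p2 i : 0 <= a * ex i 1 by rewrite mulr_ge0// ltW.
have p3 i : 0 <= tent a (d i) by exact: tent_ge0.
rewrite [majf d a]majf_mid// -(nsumZ (fun i => ex0 i 0) a2) -(nsumZ (fun i => ex0 i 1) (ltW a0)).
rewrite -(nsumD p1 p2) -(nsumD p3 (fun i => addr_ge0 (p1 i) (p2 i))).
rewrite majf_mid// -(@nsum_avg (tent a)).
- rewrite -nsumD//; apply: eq_nsum => i.
  by rewrite (excess_tent lM (w0 i) (rows i) (mean i) a01) addrA.
- by move=> x; exact: tent_ge0.
- exact: affine_growth_tent.
- by rewrite /tent; case: ifP; case: ifP; lra.
- by rewrite /tent ltNge (ltW a1) andbF; case: ifP; lra.
by move=> j _.
Qed.

End TotalExcess.

(** * The majorization function inside (0, 1) *)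

Section LocalStructure.
Context {R : realType}.

Lemma isolated_point (s : seq R) (a b : R) : a < b ->
  exists c eta, [/\ a < c < b, 0 < eta & forall x, x \in s -> eta <= `|x - c|].
Proof.
elim: s a b => [|y s ih] a b ab.
  by exists ((a + b) / 2), 1; split => //; lra.
pose m := (a + b) / 2; have mE : m = (a + b) / 2 by [].
have [ym|my] := leP y m.
- have [c [eta [cI e0 hs]]] := ih m b ltac:(lra).
  exists c, (Num.min eta (c - m)); split; first lra.
    by rewrite lt_min e0 subr_gt0; case/andP: cI.
  move=> x; rewrite inE => /orP[/eqP ->|/hs h]; last by rewrite ge_min h.
  by rewrite ge_min; apply/orP; right; rewrite distrC ger0_norm; lra.
- have [c [eta [cI e0 hs]]] := ih a m ltac:(lra).
  exists c, (Num.min eta (m - c)); split; first lra.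
    by rewrite lt_min e0 subr_gt0; case/andP: cI.
  move=> x; rewrite inE => /orP[/eqP ->|/hs h]; last by rewrite ge_min h.
  by rewrite ge_min; apply/orP; right; rewrite ger0_norm; lra.
Qed.

Lemma tent_inside (a x : R) : 0 <= x <= 1 -> 0 < a < 1 ->
  tent a x = if x < a then (1 - a) * x else a * (1 - x).
Proof.
move=> /andP[x0 x1] /andP[a0 a1]; rewrite /tent x0 x1 andbT /=.
by case: ltP; rewrite ?addr0 ?add0r.
Qed.

Lemma tent_outside (a x : R) : ~~ (0 <= x <= 1) -> 0 < a < 1 -> tent a x = 0.
Proof.
rewrite negb_and -!ltNge => h /andP[a0 a1]; rewrite /tent.
by case: ifPn => [/andP[? ?]|_]; case: ifPn => [/andP[? ?]|_];
  move: h => /orP[?|?]; rewrite ?addr0//; lra.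
Qed.

(** On [0, 1] every tent is comparable to min(x, 1 - x). Hence finiteness at one level in (0, 1)
    gives it at all of them. *)
Lemma tent_compare (a b x : R) : 0 < a < 1 -> 0 < b < 1 -> tent b x * (a * (1 - a)) <= tent a x.
Proof.
move=> a01 b01; have [xI|xO] := boolP (0 <= x <= 1); last by rewrite !tent_outside// mul0r.
have [x0 x1] := andP xI; have [a0 a1] := andP a01; have [b0 b1] := andP b01.
have m0 := tent_ge0 x b01.
have mx : tent b x <= x by rewrite tent_inside//; case: ltP => ?; nra.
have mx1 : tent b x <= 1 - x by rewrite tent_inside//; case: ltP => ?; nra.
rewrite (tent_inside xI a01); set m := tent b x in m0 mx mx1 *.
have ma : m * a <= m by rewrite ler_piMr// ltW.
have ma' : m * (1 - a) <= m by rewrite ler_piMr//; lra.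
case: ifP => _.
  by rewrite mulrA [X in X <= _]mulrC ler_wpM2l//; lra.
by rewrite mulrCA ler_wpM2l//; lra.
Qed.

Section Sequence.
Context (I : countType) (x : I -> R).

Lemma majf_mid_lty a b : 0 < a < 1 -> 0 < b < 1 -> (majf x a < +oo)%E -> (majf x b < +oo)%E.
Proof.
move=> a01 b01; rewrite !majf_mid// => ha.
have c0 : 0 < a * (1 - a) by case/andP: a01 => ? ?; rewrite mulr_gt0// subr_gt0.
apply: (@nsum_dom _ _ _ (fun i => (a * (1 - a))^-1 * tent a (x i))); last first.
  by apply: nsumZ_lty => // [i|]; [exact: tent_ge0|rewrite invr_ge0 ltW].
move=> i; rewrite mulrC ler_pdivlMr//; exact: tent_compare.
Qed.

Lemma majC_ge0 a : (0 <= majC x a)%E.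
Proof. by apply: esum_ge0 => i /= /andP[? _]; rewrite lee_fin. Qed.

Lemma majD_ge0 a : (0 <= majD x a)%E.
Proof. by apply: esum_ge0 => i /= /andP[_ ?]; rewrite lee_fin subr_ge0. Qed.

(** No [x i] lies between [c] and [a], so the sums [majC] and [majD] at [a] are those at [c]; as c
    and 1 - c are positive, finiteness at [c] makes both finite. *)
Lemma majf_locally_affine c eta : 0 < c < 1 -> (forall i, eta <= `|x i - c|) ->
  (majf x c < +oo)%E ->
  exists C D, forall a, 0 < a < 1 -> `|a - c| < eta -> majf x a = ((1 - a) * C + a * D)%:E.
Proof.
move=> c01 hx hc; have [c0 c1] := andP c01.
have E a : 0 < a < 1 -> majf x a = ((1 - a)%:E * majC x a + a%:E * majD x a)%E.
  by move=> /andP[a0 a1]; rewrite /majf leNgt a0/= a1.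
have Cf : majC x c \is a fin_num.
  rewrite ge0_fin_numE ?majC_ge0// ltey; apply/eqP => h; move: hc; rewrite E// h.
  by rewrite gt0_muley ?lte_fin ?subr_gt0// addye ?ltxx// gt_eqF// (lt_le_trans (ltNyr 0))//
    mule_ge0 ?majD_ge0// lee_fin ltW.
have Df : majD x c \is a fin_num.
  rewrite ge0_fin_numE ?majD_ge0// ltey; apply/eqP => h; move: hc; rewrite E// h.
  by rewrite gt0_muley ?lte_fin// addey ?ltxx// gt_eqF// (lt_le_trans (ltNyr 0))// mule_ge0
    ?majC_ge0// lee_fin subr_ge0 ltW.
exists (fine (majC x c)), (fine (majD x c)) => a a01 ac.
have hlt i : (x i < a) = (x i < c).
  move: (hx i) ac; rewrite ltr_norml => h /andP[h3 h4].
  case: (ltP (x i) c) => h1.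
    by move: h; rewrite ler0_norm => [h|]; [apply/idP; lra|lra].
  by move: h; rewrite ger0_norm => [h|]; [apply/negbTE; rewrite -leNgt; lra|lra].
have hC : majC x a = majC x c.
  by rewrite /majC; congr esum; apply/seteqP; split => i /=; rewrite hlt.
have hD : majD x a = majD x c.
  by rewrite /majD; congr esum; apply/seteqP; split => i /=; rewrite !leNgt hlt.
by rewrite E// hC hD -(fineK Cf) -(fineK Df) -!EFinM -EFinD.
Qed.

Lemma finite_mid c : 0 < c < 1 -> (majf x c < +oo)%E ->
  finite_set [set i | 4^-1 <= x i <= 3 / 4].
Proof.
move=> c01 /(majf_mid_lty (b := 2^-1) c01) h.
have h2 : 0 < (2^-1 : R) < 1 by apply/andP; split; [rewrite invr_gt0|rewrite invf_lt1 ?ltr1n].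
have := h h2; rewrite majf_mid// => {}h.
(* [tent 2^-1] is at least 1/8 on [1/4, 3/4], with equality at the end points. *)
have := finite_ge_nsum (fun i => tent_ge0 (x i) h2) h (c := 8^-1) ltac:(by rewrite invr_gt0).
apply: sub_finite_set => i /= /andP[h3 h4]; rewrite /tent.
by case: (ltP (x i) 0) => [h0|h0]; case: (ltP (x i) 2^-1) => [ha'|ha'];
  case: (leP (x i) 1) => [h1|h1] /=; lra.
Qed.

End Sequence.

Lemma affine_ediff (f : R -> \bar R) (c eta C D : R) : 0 < c < 1 -> 0 < eta ->
  (forall a, 0 < a < 1 -> `|a - c| < eta -> f a = ((1 - a) * C + a * D)%:E) ->
  ediff_at f c /\ derive1 (fine \o f) c = D - C.
Proof.
move=> /andP[c0 c1] e0 hf.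
have nf : \forall a \near c, f a = ((1 - a) * C + a * D)%:E.
  near=> a; apply: hf.
    by apply/andP; split; near: a; [exact: lt_nbhsr|exact: lt_nbhsl].
  by rewrite distrC; near: a; exact: cvgr_dist_lt.
pose g a := (1 - a) * C + a * D.
have gD : is_derive (c : R) (1 : R) g (D - C).
  have gE : g = cst C + ((D - C) \*: (id : R -> R)).
    by apply/funext => a; rewrite /g /= fctE /= /GRing.scale /=; ring.
  have h := is_deriveD (is_derive_cst C c (1 : R)) (is_deriveZ (D - C) (is_derive_id c (1 : R))).
  by rewrite gE; apply: is_derive_eq h _; rewrite add0r /GRing.scale /= mulr1.
have gf : {near c, g =1 fine \o f}.
  by near=> a; rewrite /= (near nf a)//.
split.
  split; first by near=> a; rewrite (near nf a).
  by apply: (near_eq_derivable gf); exact: ex_derive.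
rewrite derive1E -(near_eq_derive _ gf); exact: derive_val.
Unshelve. all: by end_near. Qed.

End LocalStructure.

(** * Doubly stochastic weights: slope of the total excess and the lower liminf *)

Section DoublyStochastic.
Context {R : realType} (I J : countType) (l : J -> R) (d : I -> R) (w : I -> J -> R) (M : R).
Hypotheses (lM : forall j, `|l j| <= M) (w0 : forall i j, 0 <= w i j).
Hypothesis rows : forall i, nsum (w i) = 1%E.
Hypothesis cols : forall j, nsum (w ^~ j) = 1%E.
Hypothesis mean : forall i, rsum (fun j => w i j * l j) = d i.

Let z0 (i : I) : 0 <= (0 : R) := lexx 0.
Let rows' i : (nsum (w i) + (0 + 0)%:E = 1)%E. Proof. by rewrite addr0 adde0. Qed.
Let mean' i : rsum (fun j => w i j * l j) + 0 = d i. Proof. by rewrite addr0. Qed.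
Let cols' j : ~~ (0 <= l j <= 1) -> nsum (w ^~ j) = 1%E. Proof. by []. Qed.

Local Notation ex i := (excess l (w i) 0 0 (d i)).
Local Notation ET := (total_excess l d w (fun=> 0) (fun=> 0)).

Lemma excess_nsum i b : (ex i b)%:E = nsum (fun j => w i j * split_part (d i) b (l j)).
Proof.
rewrite /excess /avg !mul0r !addr0.
have h j : 0 <= w i j * split_part (d i) b (l j) by rewrite mulr_ge0// split_part_ge0.
have hs := absum_avg lM (w0 i) (rows' i) (affine_growth_split (d i) b).
by rewrite absumE// in hs; rewrite rsum_ge0E// fineK// nsum_fin.
Qed.

Lemma total_excess_esum b :
  ET b = (\esum_(i in setT) \esum_(j in setT) (w i j * split_part (d i) b (l j))%:E)%E.
Proof. by apply: eq_esum => i _; exact: excess_nsum. Qed.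

(** The mass that a row with mean on one side of [c] places on values on the other side. The totals
    are the one-sided rates at which the total excess changes in a gap around [c]. *)
Definition cross_low c i := nsum (fun j => if (d i < c) && (c < l j) then w i j else 0).
Definition cross_high c i := nsum (fun j => if (c <= d i) && (l j <= c) then w i j else 0).
Definition cross_low_total c := (\esum_(i in setT) cross_low c i)%E.
Definition cross_high_total c := (\esum_(i in setT) cross_high c i)%E.

Section Isolated.
Variables (c eta : R).
Hypotheses (eta0 : 0 < eta) (hd : forall i, eta <= `|d i - c|) (hl : forall j, eta <= `|l j - c|).

Let low i j := if (d i < c) && (c < l j) then w i j else 0.
Let high i j := if (c <= d i) && (l j <= c) then w i j else 0.
Let low0 i j : 0 <= low i j. Proof. by rewrite /low; case: ifP. Qed.
Let high0 i j : 0 <= high i j. Proof. by rewrite /high; case: ifP. Qed.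
Let sp0 b i j : 0 <= w i j * split_part (d i) b (l j).
Proof. by rewrite mulr_ge0// split_part_ge0. Qed.

Let dist x : eta <= `|x - c| -> x <= c - eta \/ c + eta <= x.
Proof.
by move=> h; case: (leP x c) => xc; move: h; [rewrite ler0_norm|rewrite gtr0_norm]; lra.
Qed.

Let le_esum2 (f g : I -> J -> R) : (forall i j, f i j <= g i j) ->
  (\esum_(i in setT) \esum_(j in setT) (f i j)%:E <=
   \esum_(i in setT) \esum_(j in setT) (g i j)%:E)%E.
Proof. by move=> fg; apply: le_esum => i _; apply: le_nsum. Qed.

Let esum2D (f g : I -> J -> R) : (forall i j, 0 <= f i j) -> (forall i j, 0 <= g i j) ->
  (\esum_(i in setT) \esum_(j in setT) (f i j + g i j)%:E =
   \esum_(i in setT) \esum_(j in setT) (f i j)%:E +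
   \esum_(i in setT) \esum_(j in setT) (g i j)%:E)%E.
Proof.
move=> f0 g0; rewrite -esumD; try by move=> i _; apply: nsum_ge0.
by apply: eq_esum => i _; exact: nsumD.
Qed.

Let esum2Z k (f : I -> J -> R) : (forall i j, 0 <= f i j) -> 0 <= k ->
  (\esum_(i in setT) \esum_(j in setT) (k * f i j)%:E =
   k%:E * \esum_(i in setT) \esum_(j in setT) (f i j)%:E)%E.
Proof.
move=> f0 k0; rewrite -esumZ//; last by move=> i; exact: nsum_ge0.
by apply: eq_esum => i _; exact: nsumZ.
Qed.

Lemma cross_low_le : (eta%:E * cross_low_total c <= ET c)%E.
Proof.
rewrite total_excess_esum -(esum2Z low0 (ltW eta0)); apply: le_esum2 => i j.
rewrite /low; case: ifPn => [/andP[dc cl]|_]; last by rewrite mulr0.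
rewrite mulrC ler_wpM2l// /split_part dc /posp.
by have [h|h] := dist (hl j); rewrite le_max; apply/orP; left; lra.
Qed.

Lemma cross_high_le : (eta%:E * cross_high_total c <= ET c)%E.
Proof.
rewrite total_excess_esum -(esum2Z high0 (ltW eta0)); apply: le_esum2 => i j.
rewrite /high; case: ifPn => [/andP[dc cl]|_]; last by rewrite mulr0.
rewrite mulrC ler_wpM2l// /split_part ltNge dc /negp.
by have [h|h] := dist (hl j); rewrite le_max; apply/orP; left; lra.
Qed.

(** Inside the gap no pair changes sides. Terms x - b of the low rows lose h, terms b - x of the
    high rows gain h, each times its crossing weight. The additive form avoids subtracting infinite
    totals. *)
Lemma total_excess_slope h : 0 < h < eta ->
  (ET (c + h)%R + h%:E * cross_low_total c = ET c + h%:E * cross_high_total c)%E.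
Proof.
move=> /andP[h0 he]; rewrite !total_excess_esum -(esum2Z low0 (ltW h0)) -(esum2Z high0 (ltW h0)).
have l0 i j : 0 <= h * low i j by rewrite mulr_ge0// ltW.
have u0 i j : 0 <= h * high i j by rewrite mulr_ge0// ltW.
rewrite -(esum2D (sp0 (c + h)) l0) -(esum2D (sp0 c) u0).
apply: eq_esum => i _; apply: eq_nsum => j.
rewrite /low /high /split_part /posp /negp.
have [hi|hi] := dist (hd i); have [hj|hj] := dist (hl j).
- have -> : d i < c by lra. have -> : d i < c + h by lra.
  have -> : (c < l j) = false by lra. have -> : (c <= d i) = false by lra.
  by rewrite /= !max_r; lra.
- have -> : d i < c by lra. have -> : d i < c + h by lra.
  have -> : c < l j by lra. have -> : (c <= d i) = false by lra.
  by rewrite /= !max_l; lra.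
- have -> : (d i < c) = false by lra. have -> : (d i < c + h) = false by lra.
  have -> : l j <= c by lra. have -> : c <= d i by lra.
  by rewrite /= !max_l; lra.
- have -> : (d i < c) = false by lra. have -> : (d i < c + h) = false by lra.
  have -> : (l j <= c) = false by lra. have -> : c <= d i by lra.
  by rewrite /= !max_r; lra.
Qed.

End Isolated.

(** For b < 0, f_l(b) <= f_l(0) = f_d(0) + T(0), while Fatou gives f_d(b) > f_d(0) - e near 0;
    finiteness of f_l(0) allows the subtraction. *)
Lemma deltaL_le : (majf l 0 < +oo)%E -> (deltaL l d <= ET 0%R)%E.
Proof.
move=> l0; have E := majf_le0_excess lM w0 z0 z0 rows' mean' cols' (lexx 0).
have d0 : (majf d 0 < +oo)%E.
  by apply: le_lt_trans l0; rewrite E leeDl// total_excess_ge0.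
have df : majf d 0 \is a fin_num by rewrite ge0_fin_numE// majf_ge0.
apply: limf_einf_le => e e0.
have hm : ((fine (majf d 0) - e)%:E < nsum (fun i => negp 0 (d i)))%E.
  by rewrite -majf_le0// -[X in (_ < X)%E](fineK df) lte_fin; lra.
have cn i : negp b (d i) @[b --> (0 : R)^'-] --> negp 0 (d i).
  apply/cvgrPdist_lt => r r0; near=> b.
  have b0 : b < 0 by near: b; exact: nbhs_left_lt.
  have br : - r < b by near: b; apply: nbhs_left_gt; lra.
  by rewrite /negp ltr_norml; case: (leP (0 - d i) 0); case: (leP (b - d i) 0); lra.
have hG := nsum_fatou (fun b i => negp_ge0 b (d i)) cn hm.
apply: filterS2 (hG _) (nbhs_left_lt 0) => b hb b0.
have h1 : ((fine (majf d 0) - e)%:E < majf d b)%E.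
  by rewrite [majf d b]majf_le0 ?(ltW b0).
have h2 : (majf l b <= majf l 0)%E.
  rewrite !majf_le0 ?(ltW b0)//; apply: le_nsum => j.
  by rewrite /negp; case: (leP (0 - l j) 0); case: (leP (b - l j) 0); lra.
have Ef : ET 0 \is a fin_num.
  rewrite ge0_fin_numE ?total_excess_ge0//; apply: le_lt_trans l0.
  by rewrite E leeDr// majf_ge0.
apply: le_trans (leeB h2 (ltW h1)) _.
have [x hx] : exists x, majf d 0 = x%:E by exists (fine (majf d 0)); rewrite fineK.
have [y hy] : exists y, ET 0 = y%:E by exists (fine (ET 0)); rewrite fineK.
rewrite E hx hy.
have h : x + y - (fine x%:E - e) <= y + e by rewrite /=; lra.
by rewrite -lee_fin in h.
Unshelve. all: by end_near. Qed.

End DoublyStochastic.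

(** * Upper liminf, counting columns, and the slope congruence *)

Section DoublyStochasticTheorems.
Context {R : realType} (I J : countType) (l : J -> R) (d : I -> R) (w : I -> J -> R) (M : R).
Hypotheses (lM : forall j, `|l j| <= M) (w0 : forall i j, 0 <= w i j).
Hypothesis rows : forall i, nsum (w i) = 1%E.
Hypothesis cols : forall j, nsum (w ^~ j) = 1%E.
Hypothesis mean : forall i, rsum (fun j => w i j * l j) = d i.

Let z0 (i : I) : 0 <= (0 : R) := lexx 0.
Let rows' i : (nsum (w i) + (0 + 0)%:E = 1)%E. Proof. by rewrite addr0 adde0. Qed.
Let mean' i : rsum (fun j => w i j * l j) + 0 = d i. Proof. by rewrite addr0. Qed.
Let cols' j : ~~ (0 <= l j <= 1) -> nsum (w ^~ j) = 1%E. Proof. by []. Qed.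

Local Notation ex i := (excess l (w i) 0 0 (d i)).
Local Notation ET := (total_excess l d w (fun=> 0) (fun=> 0)).

Lemma deltaU_le : (majf l 1 < +oo)%E -> (deltaU l d <= ET 1%R)%E.
Proof.
move=> l0; have E := majf_ge1_excess lM w0 z0 z0 rows' mean' cols' (lexx 1).
have d0 : (majf d 1 < +oo)%E.
  by apply: le_lt_trans l0; rewrite E leeDl// total_excess_ge0.
have df : majf d 1 \is a fin_num by rewrite ge0_fin_numE// majf_ge0.
apply: limf_einf_le => e e0.
have hm : ((fine (majf d 1) - e)%:E < nsum (fun i => posp 1 (d i)))%E.
  by rewrite -majf_ge1// -[X in (_ < X)%E](fineK df) lte_fin; lra.
have cn i : posp b (d i) @[b --> (1 : R)^'+] --> posp 1 (d i).
  apply/cvgrPdist_lt => r r0; near=> b.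
  have b0 : 1 < b by near: b; exact: nbhs_right_gt.
  have br : b < 1 + r by near: b; apply: nbhs_right_lt; lra.
  by rewrite /posp ltr_norml; case: (leP (d i - 1) 0); case: (leP (d i - b) 0); lra.
have hG := nsum_fatou (fun b i => posp_ge0 b (d i)) cn hm.
apply: filterS2 (hG _) (nbhs_right_gt 1) => b hb b0.
have h1 : ((fine (majf d 1) - e)%:E < majf d b)%E.
  by rewrite [majf d b]majf_ge1 ?(ltW b0).
have h2 : (majf l b <= majf l 1)%E.
  rewrite !majf_ge1 ?(ltW b0)//; apply: le_nsum => j.
  by rewrite /posp; case: (leP (l j - 1) 0); case: (leP (l j - b) 0); lra.
have Ef : ET 1 \is a fin_num.
  rewrite ge0_fin_numE ?total_excess_ge0//; apply: le_lt_trans l0.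
  by rewrite E leeDr// majf_ge0.
apply: le_trans (leeB h2 (ltW h1)) _.
have [x hx] : exists x, majf d 1 = x%:E by exists (fine (majf d 1)); rewrite fineK.
have [y hy] : exists y, ET 1 = y%:E by exists (fine (ET 1)); rewrite fineK.
rewrite E hx hy.
have h : x + y - (fine x%:E - e) <= y + e by rewrite /=; lra.
by rewrite -lee_fin in h.
Unshelve. all: by end_near. Qed.

Lemma nsum_finite (T : choiceType) (A : set T) : finite_set A ->
  (nsum (fun i => (i \in A)%:R : R) < +oo)%E.
Proof.
move=> /finite_seqP[s ->]; apply: le_lt_trans (ltry (size s)%:R).
apply: nsum_le_seq => r ur; rewrite lee_fin.
have -> : \sum_(i <- r) (i \in [set` s])%:R = (size [seq i <- r | i \in s])%:R :> R.
  by rewrite size_filter -sum1_count natr_sum [RHS]big_mkcond/=; apply: eq_bigr => i _;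
    rewrite mem_setE; case: ifP.
rewrite ler_nat; apply: uniq_leq_size; first exact: filter_uniq.
by move=> i; rewrite mem_filter => /andP[].
Qed.

(** Columns are counted by their mass. An exceptional row gives the selected columns at most 1, any
    other row at most its excess divided by [k]; their number is thus at most the number of
    exceptional rows plus T(c) / k. *)
Lemma finite_transfer c k (p : J -> bool) : 0 < k -> (ET c < +oo)%E ->
  finite_set [set i | ~ forall j, p j -> k <= split_part (d i) c (l j)] ->
  finite_set [set j | p j].
Proof.
move=> k0 hE; set A := [set i | _] => fA.
have e0 i : 0 <= ex i c by exact: excess_ge0.
pose q i j := if p j then w i j else 0.
have q0 i j : 0 <= q i j by rewrite /q; case: ifP.
have fin : (nsum (fun i => ((i \in A)%:R + k^-1 * ex i c)%R) < +oo)%E.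
  apply: nsumD_lty => // [i||]; first by rewrite mulr_ge0// invr_ge0 ltW.
    exact: nsum_finite.
  by apply: nsumZ_lty => //; rewrite invr_ge0 ltW.
have le1 i : (nsum (q i) <= ((i \in A)%:R + k^-1 * ex i c)%R%:E)%E.
  have [iA|iA] := boolP (i \in A).
    apply: (@le_trans _ _ (nsum (w i))).
      by apply: le_nsum => j; rewrite /q; case: ifP.
    by rewrite rows lee_fin lerDl mulr_ge0// invr_ge0 ltW.
  have hi : forall j, p j -> k <= split_part (d i) c (l j).
    by apply: contrapT => h; move: iA; rewrite notin_setE; apply.
  rewrite add0r EFinM (excess_nsum d lM w0 rows).
  rewrite -nsumZ; [|by move=> j; rewrite mulr_ge0// split_part_ge0|by rewrite invr_ge0 ltW].
  apply: le_nsum => j; rewrite /q; case: ifP => [pj|_].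
    by rewrite mulrC -mulrA ler_peMr// ler_pdivlMr// mul1r hi.
  by rewrite !mulr_ge0// ?split_part_ge0// invr_ge0 ltW.
have colE : nsum (fun j => (p j)%:R : R) = (\esum_(i in setT) nsum (q i))%E.
  rewrite /nsum esum_swap; last by move=> i j; rewrite lee_fin.
  apply: eq_esum => j _; rewrite /q; case: (p j); last by rewrite esum1.
  exact/esym/cols.
have hp : (nsum (fun j => (p j)%:R : R) < +oo)%E.
  by rewrite colE; apply: le_lt_trans fin; apply: le_esum => i _; exact: le1.
have := finite_ge_nsum (fun j => ler0n _ (p j)) hp ltr01.
by apply: sub_finite_set => j /= ->.
Qed.

(** Differentiating f_l + T = f_d + (1 - a) d0 + a d1 in a gap: T' is the difference of the crossing
    totals, an integer by hypothesis. *)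
Lemma slope_congruence (a0 d0 d1 : R) : 0 < a0 < 1 -> (majf d a0 < +oo)%E ->
  ET 0 = d0%:E -> ET 1 = d1%:E ->
  (forall c, (cross_low_total l d w c < +oo)%E -> (cross_high_total l d w c < +oo)%E ->
     exists z : int, fine (cross_high_total l d w c) - fine (cross_low_total l d w c) = z%:~R) ->
  exists a : R, [/\ 0 < a < 1, ediff_at (majf l) a, ediff_at (majf d) a &
    exists n : int, derive1 (fine \o majf l) a - derive1 (fine \o majf d) a
      = d1 - d0 + n%:~R].
Proof.
move=> a01 hd0 E0 E1 hz.
have dfin a : 0 < a < 1 -> (majf d a < +oo)%E by move=> h; exact: (majf_mid_lty a01 h).
have EQ a : 0 < a < 1 -> (majf l a + ET a = majf d a + ((1 - a) * d0 + a * d1)%:E)%E.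
  by move=> h; rewrite (majf_mid_excess lM w0 z0 z0 rows' mean' cols h) E0 E1.
have sfin a : 0 < a < 1 -> (majf l a + ET a < +oo)%E.
  by move=> h; rewrite EQ// lte_add_pinfty ?ltry// dfin.
have T0 a : (0 <= ET a)%E by apply: total_excess_ge0.
have lfin a : 0 < a < 1 -> (majf l a < +oo)%E.
  by move=> /sfin; apply: le_lt_trans; rewrite leeDl.
have efin a : 0 < a < 1 -> (ET a < +oo)%E.
  by move=> /sfin; apply: le_lt_trans; rewrite leeDr// majf_ge0.
have /(finite_image l)/finite_seqP[sl hsl] := finite_mid a01 (lfin _ a01).
have /(finite_image d)/finite_seqP[sd hsd] := finite_mid a01 (dfin _ a01).
(* Only the finitely many values in [1/4, 3/4] have to be avoided: anything outside is at distance
   at least 1/8 from a point of (3/8, 5/8). *)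
have [c [eta' [/andP[c1 c2] e0' hs]]] := isolated_point (sd ++ sl) (a := 3/8 : R) (b := 5/8)
  ltac:(lra).
pose eta := Num.min eta' 8^-1.
have e0 : 0 < eta by rewrite lt_min e0' invr_gt0 ltr0n.
have e1 : eta <= 8^-1 by rewrite ge_min lexx orbT.
have ee : eta <= eta' by rewrite ge_min lexx.
have sep (x : R) : (4^-1 <= x <= 3 / 4 -> x \in sd ++ sl) -> eta <= `|x - c|.
  move=> h; have [/h/hs|xo] := boolP (4^-1 <= x <= 3 / 4); first exact: le_trans.
  apply: le_trans e1 _; move: xo; rewrite negb_and -!ltNge => /orP[xo|xo].
    by rewrite ler0_norm; lra.
  by rewrite ger0_norm; lra.
have hd i : eta <= `|d i - c|.
  apply: sep => h; rewrite mem_cat; apply/orP; left.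
  have : [set d i | i in [set i | 4^-1 <= d i <= 3 / 4]] (d i) by exists i.
  by rewrite hsd.
have hl j : eta <= `|l j - c|.
  apply: sep => h; rewrite mem_cat; apply/orP; right.
  have : [set l j | j in [set j | 4^-1 <= l j <= 3 / 4]] (l j) by exists j.
  by rewrite hsl.
have c01 : 0 < c < 1 by lra.
have [Cl [Dl hL]] := majf_locally_affine c01 hl (lfin _ c01).
have [Cd [Dd hD]] := majf_locally_affine c01 hd (dfin _ c01).
have [el dl] := affine_ediff c01 e0 hL.
have [ed dd] := affine_ediff c01 e0 hD.
have fin (x : \bar R) : (0 <= x)%E -> (x < +oo)%E -> exists r, x = r%:E.
  by move=> x0 x1; exists (fine x); rewrite fineK// ge0_fin_numE.
have cl0 : (0 <= cross_low_total l d w c)%E.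
  by apply: esum_ge0 => i _; apply: nsum_ge0 => j; case: ifP.
have ch0 : (0 <= cross_high_total l d w c)%E.
  by apply: esum_ge0 => i _; apply: nsum_ge0 => j; case: ifP.
have divfin (x : \bar R) : (0 <= x)%E -> (eta%:E * x <= ET c)%E -> (x < +oo)%E.
  move=> x0 h; rewrite ltey; apply/eqP => xE; move: h; rewrite xE gt0_muley ?lte_fin//.
  by rewrite leye_eq => /eqP h; have := efin c c01; rewrite h ltxx.
have lf := divfin _ cl0 (cross_low_le d lM w0 rows e0 hl).
have hf := divfin _ ch0 (cross_high_le d lM w0 rows e0 hl).
have [z] := hz c lf hf.
have [A hA] := fin _ cl0 lf; have [B hB] := fin _ ch0 hf; rewrite hA hB /= => hz'.
pose h := eta / 2; have h0 : 0 < h < eta by rewrite /h; lra.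
have ch01 : 0 < c + h < 1 by move: h0; lra.
have := total_excess_slope lM w0 rows hd hl h0; rewrite hA hB.
have [y hy] := fin _ (T0 c) (efin _ c01).
have [y' hy'] := fin _ (T0 (c + h)) (efin _ ch01).
have := EQ _ c01; have := EQ _ ch01.
have hh : `|c + h - c| < eta by rewrite addrC addKr ger0_norm; lra.
have cc : `|c - c| < eta by rewrite subrr normr0.
rewrite hy hy' !hL// !hD// => -[q1] [q2] [q3].
exists c; split => //; exists (- z); rewrite dl dd mulrNz -hz'.
have hn : h != 0 by rewrite gt_eqF//; case/andP: h0.
apply: (mulfI hn); move: q1 q2 q3; lra.
Qed.

End DoublyStochasticTheorems.

(** * Consequences of the Fredholm property for self-adjoint operators *)

Section SpectralFacts.
Context {R : realType} {H : completeNormedModType R[i]}.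
Variable ip : {dot H for (@Num.conj R[i])}.
Hypothesis hH : hilbert_norm ip.
Local Notation rip := (rip ip).
Local Notation sq := (sq ip).
Local Notation cw := (cw ip).
Local Notation nrm := (nrm ip).

Lemma bounded_on_sq (T : H -> H) : bounded_on setT T ->
  exists K, forall x, sq (T x) <= K * sq x.
Proof.
move=> [M hM]; exists (M ^+ 2) => x; have := hM x Logic.I.
rewrite !(normE hH) -CM lecR => h; rewrite -!nrm2 -exprMn.
by rewrite ler_pXn2r// ?nnegrE ?nrm_ge0// (le_trans _ h)// nrm_ge0.
Qed.

Lemma finite_dimensional_onf (W : set H) (J : choiceType) (v : J -> H) :
  finite_dimensional W -> orthonormal_family ip v -> finite_set [set j | W (v j)].
Proof.
move=> [n [u hu]] ov; apply: contrapT => hinf.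
have [X XW Xn] := infinite_set_fset n.+1 hinf.
pose s : seq J := take n.+1 X.
have ss : size s = n.+1 by rewrite size_takel.
have us : uniq s by exact/take_uniq/fset_uniq.
have [j0 _] : exists j, j \in s by case: (s) ss => // a ? _; exists a; rewrite mem_head.
pose f (k : 'I_n.+1) := nth j0 s k.
have fW k : W (v (f k)).
  by apply: XW; apply/mem_take; rewrite -/s; apply: mem_nth; rewrite ss.
have /choice[c hc] : forall k, exists c : 'I_n -> R[i], v (f k) = \sum_(m < n) c m *: u m.
  move=> k; have [m [c [y [hy ->]]]] := hu _ (fW k).
  have /choice[g hg] : forall a, exists b, u b = y a by move=> a; have [b _ <-] := hy a; exists b.
  exists (fun b => \sum_(a < m | g a == b) c a).
  under [RHS]eq_bigr do rewrite scaler_suml.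
  rewrite (exchange_big_dep xpredT)//=; apply: eq_bigr => a _.
  by rewrite (big_pred1 (g a)) ?hg// => b; rewrite eq_sym.
(* The Gram matrix of n + 1 orthonormal vectors, an identity matrix, would factor through dimension
   n. *)
pose A : 'M[R[i]]_(n.+1, n) := \matrix_(k, m) c k m.
pose B : 'M[R[i]]_(n, n.+1) := \matrix_(m, k) ip (u m) (v (f k)).
have AB : A *m B = 1%:M.
  apply/matrixP => k k'; rewrite !mxE.
  have -> : (k == k')%:R = ip (v (f k)) (v (f k')).
    by rewrite ov /f nth_uniq ?ss.
  rewrite hc ip_suml; apply: eq_bigr => m _; by rewrite !mxE ipZl.
have := mulmx_max_rank A B; rewrite AB mxrank1; by rewrite ltnn.
Qed.

Section Operator.
Variables (E : H -> H) (K : R).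
Hypotheses (sE : self_adjoint ip E) (EK : forall x, sq (E x) <= K * sq x).

Lemma shift_sa (mu : R) : self_adjoint ip (Defs.shift E mu%:C).
Proof. by move=> x y; rewrite /Defs.shift ipBl ipBr ipZl ipZr conjR sE. Qed.

Lemma shift_bounded (mu : R) x : sq (Defs.shift E mu%:C x) <= (2 * K + 2 * mu ^+ 2) * sq x.
Proof.
apply: le_trans (sqD_le ip _ _) _; rewrite sqN sqZr; have := EK x; lra.
Qed.

Lemma fredholm_coercive (mu : R) : fredholm (Defs.shift E mu%:C) ->
  exists2 c, 0 < c & forall x, (forall y, E y = mu%:C *: y -> ip x y = 0) ->
    c * sq x <= sq (Defs.shift E mu%:C x).
Proof.
move=> [_ clT _].
have [c c0 hc] := closed_range_coercive hH (shift_sa mu) (shift_bounded mu) clT.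
exists c => // x hx; apply: hc => y /eqP; rewrite /Defs.shift subr_eq0 => /eqP; exact: hx.
Qed.

Lemma eigen_orth (a b : R[i]) x y : a^* = a -> a != b -> E x = a *: x -> E y = b *: y -> ip y x = 0.
Proof.
move=> ar ab hx hy; have := sE y x; rewrite hx hy ipZl ipZr ar => /eqP.
by rewrite -subr_eq0 -mulrBl mulf_eq0 subr_eq0 eq_sym (negbTE ab) => /eqP.
Qed.

Section Eigenvectors.
Context (J : countType) (l : J -> R) (v : J -> H).
Hypotheses (ov : orthonormal_family ip v) (hv : forall j, E (v j) = (l j)%:C *: v j).

Lemma eigenvalue_bounded j : `|l j| <= Num.sqrt K.
Proof.
have := EK (v j); rewrite hv sqZr (onf_sq ov) !mulr1 => h.
by rewrite -sqrtr_sqr ler_wsqrtr.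
Qed.

(** An eigenvector with eigenvalue different from mu is orthogonal to the kernel of E - mu, so
    coercivity keeps that eigenvalue away from mu; the kernel itself has finite dimension. *)
Lemma eigenvalues_isolated (mu : R) : fredholm (Defs.shift E mu%:C) ->
  exists2 r, 0 < r & finite_set [set j | `|l j - mu| < r].
Proof.
move=> fr; have [c c0 hc] := fredholm_coercive fr.
exists (Num.sqrt c); first by rewrite sqrtr_gt0.
have [fd _ _] := fr; have := finite_dimensional_onf fd ov.
apply: sub_finite_set => j /= hj.
suff lm : l j = mu by rewrite /Defs.shift hv lm subrr.
apply/eqP; apply: contraT => ne.
have := hc (v j); rewrite /Defs.shift hv -scalerBl -CB sqZr (onf_sq ov) !mulr1.
have h : forall y, E y = mu%:C *: y -> ip (v j) y = 0.
  move=> y hy; apply: (eigen_orth _ _ hy (hv j)); first exact: conjR.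
  by rewrite eq_sym; apply: contra ne => /eqP/complexI ->.
move=> /(_ h); move: hj; rewrite -(@ltr_pXn2r _ 2)// ?nnegrE ?sqrtr_ge0//.
by rewrite real_normK ?num_real// sqr_sqrtr ?(ltW c0)// leNgt => ->.
Qed.

End Eigenvectors.

(** Let m be the infimum of the form on unit vectors of V. If m < 0, a scaled E - m is a positive
    contraction S on V, so |S y|^2 <= <S y, y>; coercivity at m then raises the lower bound to m + c
    / B. *)
Lemma quadratic_ge0 (V : set H) : (forall x y, V x -> V y -> V (x - y)) ->
  (forall (a : R) x, V x -> V (a%:C *: x)) -> (forall x, V x -> V (E x)) ->
  (forall m : R, m < 0 -> exists2 c, 0 < c &
     forall x, V x -> c * sq x <= sq (Defs.shift E m%:C x)) ->
  forall x, V x -> 0 <= rip (E x) x.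
Proof.
move=> VB VZ VE hm x Vx; rewrite leNgt; apply/negP => xn.
have lb y : - ((K + 1) / 2) * sq y <= rip (E y) y.
  have := sq_ge0 ip (E y + y); rewrite sqD; have := EK y; lra.
have xp : 0 < sq x.
  rewrite lt_def sq_ge0 andbT; apply: contraTneq xn => /sq_eq0 ->.
  by rewrite rip0r ltxx.
pose A := [set a | exists y, [/\ V y, sq y = 1 & a = rip (E y) y]].
have unit y : V y -> 0 < sq y -> A (rip (E y) y / sq y).
  move=> Vy yp; exists ((nrm y)^-1%:C *: y); split; first exact: VZ.
    by rewrite sqZr exprVn nrm2 mulVf ?gt_eqF.
  by rewrite (sa_scale sE) ripZl ripZr mulrA -expr2 exprVn nrm2 mulrC.
have Alb : has_lbound A.
  exists (- ((K + 1) / 2)) => _ [y [Vy y1 ->]].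
  by have := lb y; rewrite y1 mulr1.
pose m := inf A.
have m0 : m < 0.
  apply: le_lt_trans (ge_inf Alb (unit x Vx xp)) _.
  by rewrite pmulr_llt0 ?invr_gt0.
have mle y : V y -> m * sq y <= rip (E y) y.
  move=> Vy; have [/sq_eq0 ->|yn] := eqVneq (sq y) 0; first by rewrite sq0 rip0r mulr0.
  have yp : 0 < sq y by rewrite lt_def yn sq_ge0.
  by rewrite -ler_pdivlMr//; exact: ge_inf (unit y Vy yp).
have [c c0 hc] := hm m m0.
pose B := `|K| + 1 - m.
have B0 : 0 < B by have := normr_ge0 K; rewrite /B; lra.
pose S y := B^-1%:C *: Defs.shift E m%:C y.
have sS : self_adjoint ip S by move=> y z; rewrite ipZl ipZr conjR (shift_sa m).
have ripS y : rip (S y) y = B^-1 * (rip (E y) y - m * sq y).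
  by rewrite ripZl /Defs.shift ripBl ripZl.
have VS y : V y -> V (S y).
  by move=> Vy; apply/VZ/VB; [exact: VE|exact: VZ].
have S0 y : V y -> 0 <= rip (S y) y.
  by move=> Vy; rewrite ripS mulr_ge0 ?invr_ge0 ?(ltW B0)// subr_ge0 mle.
have S1 y : V y -> rip (S y) y <= sq y.
  move=> Vy; rewrite ripS ler_pdivrMl// /B.
  have := sq_ge0 ip (E y - y); rewrite sqB; have := EK y; have := ler_norm K.
  have := sq_ge0 ip y; have := sq_ge0 ip (E y); nra.
have key y : V y -> sq y = 1 -> m + c / B <= rip (E y) y.
  move=> Vy y1; have := sq_contract VB VS (sa_sub sS) (sa_rip sS) S0 S1 Vy.
  rewrite sqZr ripS y1 mulr1; have := hc y Vy; rewrite y1 mulr1 => h1 h2.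
  have h3 : B^-1 * sq (Defs.shift E m%:C y) <= rip (E y) y - m.
    by move: h2; rewrite expr2 -mulrA ler_pM2l ?invr_gt0.
  have h4 : c / B <= B^-1 * sq (Defs.shift E m%:C y).
    by rewrite mulrC ler_pM2l ?invr_gt0.
  lra.
have : m + c / B <= m.
  apply: lb_le_inf; first by exists (rip (E x) x / sq x); exact: unit.
  by move=> _ [y [Vy y1 ->]]; exact: key.
by rewrite gerDl leNgt divr_gt0.
Qed.

End Operator.

End SpectralFacts.

(** * Finitely many eigenvalues beyond a level *)

Section EigenvalueTails.
Context {R : realType} (J : countType) (l : J -> R) (M : R).
Hypothesis lM : forall j, `|l j| <= M.

(** Compactness of [-M, b] in supremum form: isolation at the supremum of the levels t <= b with
    finitely many values up to t carries finiteness past that supremum. *)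
Lemma finite_below (b : R) :
  (forall mu, mu <= b -> exists2 r, 0 < r & finite_set [set j | `|l j - mu| < r]) ->
  finite_set [set j | l j <= b].
Proof.
move=> iso; pose A := [set t | t <= b /\ finite_set [set j | l j <= t]].
have low t : t < - M -> finite_set [set j | l j <= t].
  move=> tM; rewrite (_ : [set j | _] = set0)//; apply/seteqP; split => // j /= h.
  by have := lM j; rewrite ler_norml => /andP[]; lra.
have A0 : A !=set0.
  exists (Num.min b (- M - 1)); split; first by rewrite ge_min lexx.
  by apply: low; rewrite gt_min; apply/orP; right; lra.
have Ab : has_ubound A by exists b => t [].
have As : has_sup A by [].
have sb : sup A <= b by apply: ge_sup => // t [].
have [r r0 fr] := iso _ sb.
have [t [tb ft] tr] := sup_adherent r0 As.
have all s : s < sup A + r -> finite_set [set j | l j <= s].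
  move=> sr; apply: (@sub_finite_set _ _ ([set j | l j <= t] `|` [set j | `|l j - sup A| < r])).
    move=> j /= ljs; have [h|h] := leP (l j) t; [by left|right].
    by rewrite ltr_norml; lra.
  by rewrite finite_setU.
have [bs|bs] := ltP b (sup A + r); first exact: all.
have : sup A + r / 2 <= sup A.
  apply: ub_le_sup => //; split; first lra.
  by apply: all; lra.
by move=> h; exfalso; lra.
Qed.

Lemma nsum_finite_support (f : J -> R) (C : R) (A : set J) : finite_set A ->
  (forall j, 0 <= f j <= C) -> (forall j, ~ A j -> f j = 0) -> (nsum f < +oo)%E.
Proof.
move=> fA f0 fz.
have [[j _]|nJ] := pselect (exists j : J, True); last first.
  by apply: le_lt_trans (ltry 0); apply: nsum_le_seq => -[|j s] _; [rewrite big_nil|case: nJ;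
    exists j].
have C0 : 0 <= C by have /andP[] := f0 j; exact: le_trans.
apply: (@nsum_dom _ _ _ (fun j => C * (j \in A)%:R)); last first.
  by apply: nsumZ_lty => //; exact: nsum_finite.
move=> k; have [kA|] := boolP (k \in A); first by rewrite mulr1; case/andP: (f0 k).
by rewrite notin_setE => /fz ->; rewrite mulr0.
Qed.

Lemma majf_below_lty (b : R) : b <= 0 -> finite_set [set j | l j <= b] -> (majf l b < +oo)%E.
Proof.
move=> b0 fA; rewrite majf_le0//; apply: (@nsum_finite_support _ (`|b| + M) _ fA).
  move=> j; rewrite negp_ge0 /negp ge_max addr_ge0 ?andbT//; last exact: le_trans (lM j).
  by have := lM j; have := ler_norm b; rewrite ler_norml => ? /andP[]; lra.
by move=> j /= /negP; rewrite -ltNge /negp => h; rewrite max_r//; lra.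
Qed.

Lemma majf_above_lty (b : R) : 1 <= b -> finite_set [set j | b <= l j] -> (majf l b < +oo)%E.
Proof.
move=> b0 fA; rewrite majf_ge1//; apply: (@nsum_finite_support _ (`|b| + M) _ fA).
  move=> j; rewrite posp_ge0 /posp ge_max addr_ge0 ?andbT//; last exact: le_trans (lM j).
  by have := lM j; have := ler_norm (- b); rewrite normrN ler_norml => ? /andP[]; lra.
by move=> j /= /negP; rewrite -ltNge /posp => h; rewrite max_r//; lra.
Qed.

End EigenvalueTails.

Lemma finite_above {R : realType} (J : countType) (l : J -> R) (M b : R) :
  (forall j, `|l j| <= M) ->
  (forall mu, b <= mu -> exists2 r, 0 < r & finite_set [set j | `|l j - mu| < r]) ->
  finite_set [set j | b <= l j].
Proof.
move=> lM iso; have := @finite_below R J (fun j => - l j) M _ (- b) _.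
rewrite (_ : [set j | - l j <= - b] = [set j | b <= l j]); last first.
  by apply/seteqP; split => j /=; rewrite lerN2.
apply=> [j|mu mub]; first by rewrite normrN.
have [r r0 fr] := iso (- mu) ltac:(lra); exists r => //.
apply: sub_finite_set fr => j /=.
by rewrite -normrN opprB !opprK addrC.
Qed.

(** * Eigenvectors for the eigenvalue list *)

Section Diagonalization.
Context {R : realType} {H : completeNormedModType R[i]}.
Variable ip : {dot H for (@Num.conj R[i])}.
Hypothesis hH : hilbert_norm ip.
Local Notation rip := (rip ip).
Local Notation sq := (sq ip).
Local Notation cw := (cw ip).
Variables (E : H -> H) (K : R).
Hypotheses (sE : self_adjoint ip E) (EK : forall x, sq (E x) <= K * sq x).
Context (J : countType) (l : J -> R).

(** The definition provides a separate family for each number mu; index j takes its vector from the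
    family of [l j]. Vectors for different eigenvalues are orthogonal by self-adjointness. *)
Lemma eigenvalue_list_family : eigenvalue_list ip E l -> exists v : J -> H,
  [/\ orthonormal_family ip v, (forall j, E (v j) = (l j)%:C *: v j) &
      forall mu x, E x = mu *: x -> (forall j, ip x (v j) = 0) -> x = 0].
Proof.
move=> /choice[V hV]; pose v j := V (l j)%:C j.
have Ev j : E (v j) = (l j)%:C *: v j.
  have [_ h] := hV (l j)%:C; suff : eigenspace_of E (l j)%:C (v j) by [].
  rewrite -h; apply: subset_closure; exists 1%N, (fun=> 1), (fun=> v j); split.
    by move=> _; exists j.
  by rewrite big_ord1 scale1r.
exists v; split => // [i j|mu x Ex xv].
  have [lij|lij] := eqVneq (l i) (l j).
    by rewrite /v -lij; have [h _] := hV (l i)%:C; apply: h => //=; rewrite lij.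
  have -> : (i == j) = false by apply: contraNF lij => /eqP ->.
  apply: (eigen_orth sE _ _ (Ev j) (Ev i)); first exact: conjR.
  by rewrite eq_sym; apply: contra lij => /eqP/complexI ->.
have [_ h] := hV mu.
have cx : clspan (V mu @` [set j | (l j)%:C = mu]) x by rewrite h.
apply: (@sq_eq0 _ _ ip); apply: rip_ip0; apply: (clspan_orth hH cx).
by move=> _ [j /= lj <-]; rewrite -lj; exact: xv.
Qed.

Variable v : J -> H.
Hypotheses (ov : orthonormal_family ip v) (hv : forall j, E (v j) = (l j)%:C *: v j).

(** Parseval at x + E x and at x - E x: the squared norms differ by 4 <E x, x>, and the coefficients
    termwise by 4 l_j |<x, v_j>|^2. *)
Lemma eigen_expansion x : clspan (range v) x ->
  rip (E x) x = rsum (fun j => cw x (v j) * l j).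
Proof.
move=> cx; have Ecw j : cw (E x) (v j) = l j ^+ 2 * cw x (v j).
  by rewrite !cw_nc sE hv ipZr conjR ncM; congr (_ * _); rewrite /nc /= expr0n addr0.
have Ecx : clspan (range v) (E x).
  apply/(clspanP hH ov) => z hz; rewrite -sE.
  apply: (clspan_orth hH cx) => _ [j _ <-].
  by rewrite sE hv ipZr hz// mulr0.
have addcw (a : R) j : cw (x + a%:C *: E x) (v j) = (1 + a * l j) ^+ 2 * cw x (v j).
  rewrite !cw_nc ipDl ipZl sE hv ipZr conjR.
  have -> : ip x (v j) + a%:C * ((l j)%:C * ip x (v j)) = (1 + a * l j)%:C * ip x (v j).
    by rewrite rmorphD rmorphM rmorph1 /=; ring.
  by rewrite ncM; congr (_ * _); rewrite /nc /= expr0n addr0.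
have cadd (a : R) : clspan (range v) (x + a%:C *: E x).
  apply/(clspanP hH ov) => z hz; rewrite ipDr ipZr.
  by rewrite ((clspanP hH ov _ _).1 cx)// ((clspanP hH ov _ _).1 Ecx)// mulr0 addr0.
have P (a : R) : nsum (fun j => (1 + a * l j) ^+ 2 * cw x (v j)) = (sq (x + a%:C *: E x))%:E.
  by rewrite -(parseval hH ov (cadd a)); apply: eq_nsum => j; rewrite addcw.
have pos (a : R) j : 0 <= (1 + a * l j) ^+ 2 * cw x (v j).
  by rewrite mulr_ge0 ?sqr_ge0 ?cw_ge0.
have := @rsum_split _ _ (fun j => 4 * (cw x (v j) * l j)) _ _ (pos 1) (pos (-1)).
rewrite !P !ltry => /(_ isT isT).
have -> : x + (-1)%:C *: E x = x - E x by rewrite rmorphN1 scaleN1r.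
rewrite scale1r /= sqD sqB (ripC _ x) => h.
have aw : absum (fun j => cw x (v j) * l j).
  apply: (@absum_dom _ _ _ (fun j => Num.sqrt K * cw x (v j))).
    move=> j; rewrite normrM mulrC (ger0_norm (cw_ge0 _ _ _)) ler_wpM2r ?cw_ge0//.
    exact: (eigenvalue_bounded EK ov hv).
  apply: absumZ; rewrite absumE; last by move=> j; exact: cw_ge0.
  by rewrite (parseval hH ov cx) ltry.
have h4 : 4 * rsum (fun j => cw x (v j) * l j) = 4 * rip (E x) x.
  rewrite -rsumZ// h; first ring.
  by move=> j; ring.
lra.
Qed.

End Diagonalization.

(** * The operator on the complement of its eigenvectors *)

Section Completeness.
Context {R : realType} {H : completeNormedModType R[i]}.
Variable ip : {dot H for (@Num.conj R[i])}.
Hypothesis hH : hilbert_norm ip.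
Local Notation rip := (rip ip).
Local Notation sq := (sq ip).
Local Notation cw := (cw ip).
Variables (E : H -> H) (K : R).
Hypotheses (sE : self_adjoint ip E) (EK : forall x, sq (E x) <= K * sq x).
Hypothesis fredE : forall mu : R, ~~ (0 <= mu <= 1) -> fredholm (Defs.shift E mu%:C).
Context (J : countType) (l : J -> R) (v : J -> H).
Hypotheses (ov : orthonormal_family ip v) (hv : forall j, E (v j) = (l j)%:C *: v j).
Hypothesis complete_eigen : forall mu x, E x = mu *: x -> (forall j, ip x (v j) = 0) -> x = 0.

Let M := Num.sqrt K.
Let lM j : `|l j| <= M. Proof. exact: (eigenvalue_bounded EK ov hv). Qed.
Let EB := sa_sub sE.
Let EZ := sa_scale sE.

Lemma majf_eigen_below b : b < 0 -> (majf l b < +oo)%E.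
Proof.
move=> b0; apply: (majf_below_lty lM (ltW b0)); apply: (finite_below lM) => mu mub.
by apply: (eigenvalues_isolated hH sE EK ov hv); apply: fredE; lra.
Qed.

Lemma majf_eigen_above b : 1 < b -> (majf l b < +oo)%E.
Proof.
move=> b0; apply: (majf_above_lty lM (ltW b0)); apply: (finite_above lM) => mu mub.
by apply: (eigenvalues_isolated hH sE EK ov hv); apply: fredE; lra.
Qed.

Let V : set H := [set x | forall j, ip x (v j) = 0].
Let VB x y : V x -> V y -> V (x - y).
Proof. by move=> Vx Vy j; rewrite ipBl Vx Vy subrr. Qed.
Let VZ (a : R) x : V x -> V (a%:C *: x).
Proof. by move=> Vx j; rewrite ipZl Vx mulr0. Qed.
Let VE x : V x -> V (E x).
Proof. by move=> Vx j; rewrite sE hv ipZr Vx mulr0. Qed.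

(** The projection onto the closed span of the eigenvectors. It commutes with E because V is
    invariant and, by self-adjointness, the closed span is too. *)
Let projection : exists p : H -> H, [/\ self_adjoint ip p, (forall x, clspan (range v) (p x)),
  (forall x, V (x - p x)), (forall x, V x -> p x = 0) &
  (forall x, p (E x) = E (p x))].
Proof.
have [p hp] := @diag_exists _ _ _ hH _ _ ov (fun=> 1) 1 ltac:(by move=> j;
  rewrite /nc /= expr1n expr0n addr0).
have Vp x : V (x - p x) by move=> j; rewrite ipBl (hp x).2 mul1r subrr.
have orth x y : ip (x - p x) (p y) = 0.
  by apply: (clspan_orth hH (hp y).1) => _ [j _ <-]; exact: Vp.
have sp : self_adjoint ip p.
  move=> x y; have h1 : ip x (p y) = ip (p x) (p y) by apply/eqP; rewrite -subr_eq0 -ipBl orth.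
  have h2 : ip y (p x) = ip (p y) (p x) by apply/eqP; rewrite -subr_eq0 -ipBl orth.
  by rewrite h1 ipC h2 -ipC.
have p0 x : V x -> p x = 0.
  move=> Vx; apply: (@sq_eq0 _ _ ip); apply: rip_ip0.
  by apply: (clspan_orth hH (hp x).1) => _ [j _ <-]; rewrite (hp x).2 Vx mulr0.
exists p; split => // [x|z]; first exact: (hp x).1.
have rE : p (E (z - p z)) = 0 by apply/p0/VE.
have Er : E (p z) - p (E (p z)) = 0.
  apply: (@ip_nondeg _ _ ip) => q.
  rewrite ipBl (sE (p z)) (sp z) (sp (E (p z))) (sE (p z)) (sp z) -ipBr -(sa_sub sp) -EB.
  by rewrite (p0 _ (VE (Vp q))) ip0l ip0r.
move: rE Er; rewrite EB (sa_sub sp) => /eqP; rewrite subr_eq0 => /eqP -> /eqP.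
by rewrite subr_eq0 => /eqP.
Qed.

(** Applied to F = E and to F = 1 - E. A shift of F at a negative number is, up to sign, a shift of
    E outside [0, 1], where E is Fredholm and hence coercive off the eigenspace. *)
Let quadratic (F : H -> H) (L : R) : self_adjoint ip F -> (forall x, sq (F x) <= L * sq x) ->
  (forall x, V x -> V (F x)) ->
  (forall m : R, m < 0 -> exists2 mu : R, ~~ (0 <= mu <= 1) &
     forall x, sq (Defs.shift F m%:C x) = sq (Defs.shift E mu%:C x)) ->
  forall x, V x -> 0 <= rip (F x) x.
Proof.
move=> sF FL VF hF; apply: (quadratic_ge0 sF FL VB VZ VF) => m m0.
have [mu mo hmu] := hF m m0.
have [c c0 hc] := fredholm_coercive hH sE EK (fredE mo).
exists c => // x Vx; rewrite hmu; apply: hc => y Ey.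
(* The part in V of an eigenvector is again an eigenvector, hence 0; so vectors of V are orthogonal
   to every eigenspace and coercivity applies to them. *)
have [p [sp pc Vp p0 pE]] := projection.
have y0 : y - p y = 0.
  apply: (complete_eigen (mu := mu%:C)) (Vp y).
  by rewrite EB -pE Ey (sa_scale sp) scalerBr.
move/eqP: y0; rewrite subr_eq0 => /eqP ->.
by apply: (clspan_orth hH (pc y)) => _ [j _ <-]; exact: Vx.
Qed.

Let V_ge0 x : V x -> 0 <= rip (E x) x.
Proof.
apply: (quadratic sE EK VE) => m m0; exists m => //.
by rewrite negb_and -ltNge m0.
Qed.

Let V_le1 x : V x -> rip (E x) x <= sq x.
Proof.
move=> Vx; pose F y := y - E y.
have sF : self_adjoint ip F by apply: sa_subop => //; exact: sa_id.
have FL y : sq (F y) <= (2 + 2 * K) * sq y.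
  apply: le_trans (sqD_le ip _ _) _; rewrite sqN; have := EK y; lra.
have VF y : V y -> V (F y) by move=> Vy; apply: VB => //; exact: VE.
have := quadratic sF FL VF _ Vx; rewrite /F ripBl subr_ge0; apply => m m0.
exists (1 - m); first by apply/negP => /andP[_]; lra.
move=> y; rewrite -sqN; congr sq; rewrite /Defs.shift CB scalerBl scale1r.
by rewrite opprB opprB addrC -addrA (addrC (- _)) opprB addrA.
Qed.

(* [E ^ 2 - E + m = 0] on [x] factors over the reals because [m <= 1/4]. *)
Let no_quadratic_root (m : R) x : 0 <= m -> V x -> E x - E (E x) = m%:C *: x -> x = 0.
Proof.
move=> m0 Vx h; apply: contrapT => xn.
have xp : 0 < sq x.
  by rewrite lt_def sq_ge0 andbT; apply/eqP => /sq_eq0.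
have m4 : 0 <= 1 - 4 * m.
  have h1 : sq (E x) = rip (E x) x - m * sq x.
    by have := congr1 (fun z => rip z x) h; rewrite ripBl ripZl (sa_rip sE (E x)) -/(sq _); lra.
  have := sq_ge0 ip (E x + E x - x); rewrite sqB sqD ripDl -[rip (E x) (E x)]/(sq (E x)) h1.
  by move=> h2; rewrite -(pmulr_lge0 _ xp); lra.
pose r := Num.sqrt (1 - 4 * m); have r2 : r * r = 1 - 4 * m by rewrite -expr2 sqr_sqrtr.
pose z := E x - ((1 + r) / 2)%:C *: x.
have Vz : V z by apply: VB; [exact: VE|exact: VZ].
have Ez : E z = ((1 - r) / 2)%:C *: z.
  have EEx : E (E x) = E x - m%:C *: x by rewrite -h opprB addrC subrK.
  rewrite /z EB EZ EEx scalerBr scalerA -CM.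
  have -> : (1 - r) / 2 * ((1 + r) / 2) = m.
    have -> : (1 - r) / 2 * ((1 + r) / 2) = (1 - r * r) / 4 by field.
    by rewrite r2; field.
  have -> : (1 - r) / 2 = 1 - (1 + r) / 2 by field.
  by rewrite CB scalerBl scale1r addrAC.
have z0 := complete_eigen Ez Vz.
by apply/xn/(complete_eigen _ Vx)/eqP; rewrite -subr_eq0; apply/eqP; exact: z0.
Qed.

Section DiagonalData.
Context (I : countType) (e : I -> H) (d : I -> R).
Hypothesis be : orthonormal_basis ip e.
Hypothesis hd : forall i, d i = rip (E (e i)) (e i).

Lemma eigenvectors_complete a : 0 < a < 1 -> (majf d a < +oo)%E ->
  (deltaL l d + deltaU l d < +oo)%E -> forall x, (forall j, ip x (v j) = 0) -> x = 0.
Proof.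
move=> a01 da ddelta; have [a0 a1] := andP a01.
have [p [sp pc Vp p0 pE]] := projection.
pose r x := x - p x.
have sr : self_adjoint ip r by apply: sa_subop => //; exact: sa_id.
have pp x : p (p x) = p x.
  by apply/eqP; rewrite eq_sym -subr_eq0 -(sa_sub sp); apply/eqP/p0/Vp.
have rE x : r (E x) = E (r x) by rewrite /r pE EB.
have rr x : r (r x) = r x by rewrite {1}/r (p0 _ (Vp x)) subr0.
have rV x : V x -> r x = x by move=> Vx; rewrite /r p0// subr0.
have prx x y : ip (p x) (r y) = 0 by rewrite sp p0 ?ip0r//; exact: Vp.
have xE x : x = p x + r x by rewrite /r addrC subrK.
pose w i j := cw (e i) (v j).
pose t i := rip (E (r (e i))) (r (e i)).
pose s i := sq (r (e i)) - t i.
have w0 i j : 0 <= w i j by exact: cw_ge0.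
have t0 i : 0 <= t i by apply/V_ge0/Vp.
have s0 i : 0 <= s i by rewrite subr_ge0; apply/V_le1/Vp.
have wE i j : w i j = cw (p (e i)) (v j).
  rewrite /w {1}(xE (e i)) !cw_nc ipDl.
  by rewrite (_ : ip (r (e i)) (v j) = 0) ?addr0//; exact: Vp.
have rows i : (nsum (w i) + (t i + s i)%:E = 1)%E.
  rewrite (eq_nsum (wE i)) (parseval hH ov (pc _)) /s addrCA subrr addr0 -EFinD.
  congr EFin; rewrite -(onf_sq (onb_family be) i) {3}(xE (e i)) sqD.
  by rewrite (rip_ip0 (prx _ _)) mulr0 addr0.
have rip4 (x1 x2 y1 y2 : H) : rip (x1 + x2) (y1 + y2) =
    rip x1 y1 + rip x1 y2 + (rip x2 y1 + rip x2 y2) by rewrite ripDl !ripDr.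
have mean i : rsum (fun j => w i j * l j) + t i = d i.
  rewrite hd {1 2}(xE (e i)) (@eq_rsum _ _ _ (fun j => cw (p (e i)) (v j) * l j)); last first.
    by move=> j; rewrite wE.
  rewrite -(eigen_expansion hH sE EK ov hv (pc _)) (sa_linear_add sE) rip4.
  have h1 : rip (E (p (e i))) (r (e i)) = 0 by rewrite -pE (rip_ip0 (prx _ _)).
  have h2 : rip (E (r (e i))) (p (e i)) = 0 by rewrite -rE ripC (rip_ip0 (prx _ _)).
  by rewrite h1 h2 addr0 add0r /t.
have cols j : ~~ (0 <= l j <= 1) -> nsum (w ^~ j) = 1%E.
  move=> _; rewrite -(onf_sq ov j) -(onb_parseval hH be); apply: eq_nsum => i.
  by rewrite /w cwC.
have tL := total_excess_left lM w0 t0 s0 rows mean cols majf_eigen_below.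
have tU := total_excess_right lM w0 t0 s0 rows mean cols majf_eigen_above.
have T0 b : (0 <= total_excess l d w t s b)%E by exact: total_excess_ge0.
have fL : (total_excess l d w t s 0%R < +oo)%E.
  apply: le_lt_trans tL (le_lt_trans _ ddelta).
  by rewrite leeDl//; exact: le_trans (T0 1) tU.
have fU : (total_excess l d w t s 1%R < +oo)%E.
  apply: le_lt_trans tU (le_lt_trans _ ddelta).
  by rewrite leeDr//; exact: le_trans (T0 0) tL.
have fa : (total_excess l d w t s a < +oo)%E.
  apply: le_lt_trans (total_excess_mid lM w0 t0 s0 rows mean a01) _.
  rewrite lte_add_pinfty// lte_add_pinfty// lte_mul_pinfty// lee_fin; lra.
pose T x := E (r x) - E (E (r x)).
have TE x : T x = r (E x - E (E x)) by rewrite /T (sa_sub sr) !rE.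
have sT : self_adjoint ip T.
  by move=> x y; rewrite TE sr ipBl !sE -ipBr.
have Trip x : rip (T x) x = rip (E (r x)) (r x) - sq (E (r x)).
  by rewrite TE -{1}rr (sa_rip sr) -TE /T ripBl (sa_rip sE (E (r x))).
have T0' x : 0 <= rip (T x) x.
  rewrite Trip; have : V (r x) by exact: Vp.
  move: (r x) => y Vy; have := V_le1 (VE Vy); have := V_ge0 (VB Vy (VE Vy)).
  rewrite EB ripBl !ripBr (sa_rip sE (E y) y) -[rip (E y) (E y)]/(sq (E y)); lra.
have rle x : sq (r x) <= sq x.
  by rewrite [X in _ <= sq X](xE x) sqD (rip_ip0 (prx _ _)) mulr0 addr0 lerDr sq_ge0.
have T1 x : rip (T x) x <= 1 * sq x.
  rewrite Trip mul1r; have := V_le1 (Vp x); have := rle x.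
  by have := sq_ge0 ip (E (r x)); rewrite -/(r x); lra.
(* <T e_i, e_i> is at most t_i and at most s_i, and the excess at a contains (1 - a) t_i or a s_i
   according to the side of d_i. *)
pose k := Num.min a (1 - a).
have k0 : 0 < k by rewrite lt_min a0 subr_gt0.
have trT : (nsum (fun i => rip (T (e i)) (e i)) < +oo)%E.
  apply: (@nsum_dom _ _ _ (fun i => k^-1 * excess l (w i) (t i) (s i) (d i) a)); last first.
    by apply: nsumZ_lty => // [i|]; [exact: excess_ge0|rewrite invr_ge0 ltW].
  move=> i; rewrite ler_pdivlMl//; apply: (le_trans _ (excess_ts l (t i) (s i) (d i) (w0 i) a)).
  have q0 := T0' (e i).
  have qt : rip (T (e i)) (e i) <= t i by rewrite Trip /t; have := sq_ge0 ip (E (r (e i))); lra.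
  have qs : rip (T (e i)) (e i) <= s i.
    rewrite Trip /s /t; have := sq_ge0 ip (r (e i) - E (r (e i))).
    by rewrite sqB (ripC _ (r (e i))); lra.
  have k1 : k <= a by rewrite ge_min lexx.
  have k2 : k <= 1 - a by rewrite ge_min lexx orbT.
  rewrite /split_part; case: ifP => _.
    apply: ler_wpDr; first by rewrite mulr_ge0// posp_ge0.
    rewrite /posp max_l; last lra.
    rewrite mulrC; apply: ler_pM => //; exact: ltW.
  apply: ler_wpDl; first by rewrite mulr_ge0// negp_ge0.
  rewrite /negp subr0 max_l; last lra.
  rewrite mulrC; apply: ler_pM => //; exact: ltW.
move=> x Vx; have [[y Ty]|nT] := pselect (exists y, T y <> 0).
  have [m [z [m0 zn Tz]]] := trace_eigenvector hH be sT T0' T1 trT (ex_intro _ y Ty).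
  exfalso; apply: zn.
  have zV : V z.
    have -> : z = m^-1%:C *: T z.
      by rewrite Tz scalerA -CM mulVf ?scale1r// gt_eqF.
    by rewrite TE; apply: VZ; exact: Vp.
  by apply: (no_quadratic_root (ltW m0) zV); rewrite -Tz /T (rV z zV).
(* If T vanishes, E - E^2 = 0 on V, and the factorization applies with m = 0. *)
have Tx : T x = 0 by apply: contrapT => h; apply: nT; exists x.
by apply: (no_quadratic_root (lexx 0) Vx); rewrite scale0r -Tx /T (rV x Vx).
Qed.

End DiagonalData.

End Completeness.

(** * Operators diagonal in an orthonormal basis *)

Section DiagonalOperators.
Context {R : realType} {H : completeNormedModType R[i]}.
Variable ip : {dot H for (@Num.conj R[i])}.
Hypothesis hH : hilbert_norm ip.
Local Notation rip := (rip ip).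
Local Notation sq := (sq ip).
Local Notation cw := (cw ip).

Lemma sq_bounded_on (T : H -> H) (K : R) V :
  (forall x, V x -> sq (T x) <= K * sq x) -> bounded_on V T.
Proof.
move=> hT; exists (Num.sqrt `|K|) => x Vx; rewrite !(normE hH) -rmorphM lecR.
rewrite -(@ler_pXn2r _ 2)// ?nnegrE ?mulr_ge0 ?nrm_ge0 ?sqrtr_ge0//.
rewrite exprMn !nrm2 sqr_sqrtr//; apply: le_trans (hT x Vx) _.
by rewrite ler_wpM2r ?sq_ge0// ler_norm.
Qed.

Lemma nc_real (a : R) : nc a%:C = a ^+ 2.
Proof. by rewrite /nc /= expr0n addr0. Qed.

Lemma linspan_mem (A : set H) x : A x -> linspan A x.
Proof.
move=> Ax; exists 1%N, (fun=> 1), (fun=> x); split => //.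
by rewrite big_ord1 scale1r.
Qed.

Section Basis.
Context (J : countType) (v : J -> H).
Hypothesis bv : orthonormal_basis ip v.

Lemma rip_parseval x y :
  rip x y = rsum (fun j => complex.Re (ip x (v j) * (ip y (v j))^*)).
Proof.
have c0 z j : 0 <= cw z (v j) by exact: cw_ge0.
have P z : nsum (fun j => cw z (v j)) = (sq z)%:E by exact: onb_parseval.
have := rsum_split (f := fun j => 4 * complex.Re (ip x (v j) * (ip y (v j))^*))
  (c0 (x + y)) (c0 (x - y)).
rewrite !P !ltry /= sqD sqB => /(_ isT isT) h.
have a : absum (fun j => complex.Re (ip x (v j) * (ip y (v j))^*)).
  apply: (@absum_dom _ _ _ (fun j => cw x (v j) + cw y (v j))).
    move=> j; rewrite /cw; case: (ip x (v j)) => a b; case: (ip y (v j)) => p q /=.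
    rewrite ler_norml; apply/andP; split.
      have := sqr_ge0 (a + p); have := sqr_ge0 (b + q); rewrite !sqrrD.
      have := sqr_ge0 a; have := sqr_ge0 b; have := sqr_ge0 p; have := sqr_ge0 q; lra.
    have := sqr_ge0 (a - p); have := sqr_ge0 (b - q); rewrite !sqrrB.
    have := sqr_ge0 a; have := sqr_ge0 b; have := sqr_ge0 p; have := sqr_ge0 q; lra.
  by apply: absumD; rewrite absumE// P ltry.
suff : 4 * rsum (fun j => complex.Re (ip x (v j) * (ip y (v j))^*)) = 4 * rip x y by lra.
rewrite -rsumZ// h; first ring.
move=> j; rewrite /cw ipBl ipDl.
by case: (ip x (v j)) => a' b; case: (ip y (v j)) => p q /=; ring.
Qed.

Lemma diagonal_operator (m : J -> R[i]) (C : R) : 0 <= C -> (forall j, nc (m j) <= C) ->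
  exists D : H -> H, (forall x j, ip (D x) (v j) = m j * ip x (v j)) /\
    forall x, sq (D x) <= C * sq x.
Proof.
move=> C0 mC; have [D hD] := diag_exists hH (onb_family bv) mC.
have D1 x j : ip (D x) (v j) = m j * ip x (v j) by exact: (hD x).2.
exists D; split => // x.
rewrite -lee_fin EFinM -!(onb_parseval hH bv) -nsumZ//; last by move=> j; exact: cw_ge0.
by apply: le_nsum => j; rewrite !cw_nc D1 ncM ler_wpM2r// nc_ge0.
Qed.

Lemma real_diagonal_sa (m : J -> R) (D : H -> H) :
  (forall x j, ip (D x) (v j) = (m j)%:C * ip x (v j)) -> self_adjoint ip D.
Proof.
move=> D1 x y; have rD a b : rip (D a) b = rip a (D b).
  rewrite !rip_parseval; apply: eq_rsum => j; rewrite !D1 rmorphM /= conjR.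
  by congr complex.Re; ring.
have Di a : D ('i *: a) = 'i *: D a.
  by apply: (onb_eq hH bv) => j; rewrite ipZl !D1 ipZl mulrCA.
(* Symmetry of the real parts at 'i x is symmetry of the imaginary parts at x. *)
have := rD ('i *: x) y; have := rD x y; rewrite Di /rip !ipZl.
case: (ip (D x) y) => a b; case: (ip x (D y)) => p q /= -> h.
congr (_ +i* _); move: h; rewrite !mul0r !mul1r !sub0r => h.
exact: oppr_inj.
Qed.

Lemma ip0_disjoint x y : (forall j, ip x (v j) = 0 \/ ip y (v j) = 0) -> ip x y = 0.
Proof.
move=> h; have yc : clspan (v @` [set j | ip y (v j) <> 0]) y.
  by apply/(onb_clspan hH bv) => j /= /contrapT.
by apply: (clspan_orth hH yc) => _ [j yj <-]; case: (h j).
Qed.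

End Basis.
End DiagonalOperators.

(** * Functions of a diagonalized operator: Fredholm property, index, decoupling *)

Section EigenBasis.
Context {R : realType} {H : completeNormedModType R[i]}.
Variable ip : {dot H for (@Num.conj R[i])}.
Hypothesis hH : hilbert_norm ip.
Local Notation rip := (rip ip).
Local Notation sq := (sq ip).
Local Notation cw := (cw ip).
Variable E : H -> H.
Hypothesis sE : self_adjoint ip E.
Context (J : countType) (l : J -> R) (v : J -> H).
Hypotheses (bv : orthonormal_basis ip v) (hv : forall j, E (v j) = (l j)%:C *: v j).

Lemma eigen_coord x j : ip (E x) (v j) = (l j)%:C * ip x (v j).
Proof. by rewrite sE hv ipZr conjR. Qed.

Lemma shift_coord mu x j :
  ip (Defs.shift E mu x) (v j) = ((l j)%:C - mu) * ip x (v j).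
Proof. by rewrite /Defs.shift ipBl eigen_coord ipZl mulrBl. Qed.

Lemma finite_support_span (s : seq J) x : (forall j, j \notin s -> ip x (v j) = 0) ->
  linspan (range (fun k => v (tnth (in_tuple (undup s)) k))) x.
Proof.
move=> hx; exists (size (undup s)), (fun k => ip x (v (tnth (in_tuple (undup s)) k))).
exists (fun k => v (tnth (in_tuple (undup s)) k)); split; first by move=> k; exists k.
rewrite -(big_tnth _ _ _ xpredT (fun j => ip x (v j) *: v j)).
apply: (onb_eq hH bv) => j; rewrite -/(comb v (undup s) (fun j => ip x (v j))).
rewrite (ip_comb (onb_family bv)) ?undup_uniq// mem_undup.
by case: ifPn => // /hx.
Qed.

(** D is a pseudo-inverse, with entries 1 / (l_j - mu) and 0 on the eigenspace; all but finitely
    many entries are at most 1/r in modulus. Then (E - mu) D projects off the finite-dimensional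
    eigenspace, which gives closed range and finite codimension. *)
Lemma isolated_fredholm (mu r : R) : 0 < r -> finite_set [set j | `|l j - mu| < r] ->
  fredholm (Defs.shift E mu%:C).
Proof.
move=> r0 fin.
pose m j := if l j == mu then 0 else (l j - mu)^-1.
have [C C0 hC] : exists2 C, 0 <= C & forall j, nc (m j)%:C <= C.
  have /(finite_image (fun j => `|m j|))/finite_seqP[s hs] := fin.
  exists (Num.max r^-1 (\sum_(x <- s) `|x|) ^+ 2) => [|j]; first exact: sqr_ge0.
  rewrite nc_real -(real_normK (num_real _)) lerXn2r ?nnegrE//.
    by rewrite le_max invr_ge0 (ltW r0).
  rewrite le_max.
  have [jr|jr] := ltP `|l j - mu| r; apply/orP; [right|left].
    have js : `|m j| \in s.
      have : [set `|m i| | i in [set i | `|l i - mu| < r]] `|m j| by exists j.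
      by rewrite hs.
    by rewrite (big_rem _ js) /= normr_id lerDl sumr_ge0.
  rewrite /m; case: eqP => [_|_]; first by rewrite normr0 invr_ge0 ltW.
  by rewrite normfV lef_pV2 ?posrE// (lt_le_trans r0).
have [D [D1 _]] := diagonal_operator hH bv C0 hC.
have /finite_seqP[s hs] : finite_set [set j | l j = mu].
  by apply: sub_finite_set fin => j /= ->; rewrite subrr normr0.
have ms j : (j \in s) = (l j == mu).
  have h : [set` s] j <-> l j = mu by rewrite -hs.
  by apply/idP/eqP => [/h|/h].
have TD y j : ip (Defs.shift E mu%:C (D y)) (v j) = if l j == mu then 0 else ip y (v j).
  rewrite shift_coord D1 -CB mulrA -CM /m; case: eqP => [->|/eqP h].
    by rewrite subrr !mul0r.
  by rewrite divff ?mul1r// subr_eq0.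
split.
- exists (size (undup s)), (fun k => v (tnth (in_tuple (undup s)) k)) => x /= Tx.
  apply: finite_support_span => j; rewrite ms => lj.
  have := shift_coord mu%:C x j; rewrite Tx ip0l -CB => /esym/eqP.
  by rewrite mulf_eq0 (inj_eq (@complexI _)) subr_eq0 (negPf lj) /= => /eqP.
- move=> y yc; exists (D y) => //; apply: (onb_eq hH bv) => j; rewrite TD.
  case: eqP => // lj; rewrite ipC.
  have yc' : clspan (range (Defs.shift E mu%:C)) y.
    by apply: closureS yc; exact: linspan_mem.
  rewrite (clspan_orth hH yc') ?rmorph0// => _ [x _ <-].
  by rewrite ipC shift_coord lj subrr mul0r rmorph0.
exists (size (undup s)), (fun k => v (tnth (in_tuple (undup s)) k)) => y.
exists (D y); apply: finite_support_span => j; rewrite ms => lj.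
by rewrite ipBl TD (negPf lj) subrr.
Qed.

Lemma essential_infinite (mu r : R) : essential_spectrum E mu%:C -> 0 < r ->
  infinite_set [set j | `|l j - mu| < r].
Proof. by move=> h r0 fin; apply: h; exact: isolated_fredholm r0 fin. Qed.

Section CrossTerms.
Context (I : countType) (e : I -> H) (d : I -> R) (c : R).
Hypothesis be : orthonormal_basis ip e.
Let w i j := cw (e i) (v j).

(** With P the projection onto the e_i with d_i >= c and Q onto the v_j with l_j > c, the totals are
    the squared Hilbert-Schmidt norms of Q P - P and Q (1 - P). *)
Lemma cross_totals_congruent :
  (cross_low_total l d w c < +oo)%E -> (cross_high_total l d w c < +oo)%E ->
  exists z : int,
    fine (cross_high_total l d w c) - fine (cross_low_total l d w c) = z%:~R.
Proof.
have b01 (b : bool) : nc (b%:R : R)%:C <= 1 by rewrite nc_real; case: b; rewrite ?expr1n ?expr0n.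
have [P [P1 _]] := diagonal_operator hH be ler01 (fun i => b01 (c <= d i)).
have [Q [Q1 _]] := diagonal_operator hH bv ler01 (fun j => b01 (c < l j)).
have sP := real_diagonal_sa hH be P1; have sQ := real_diagonal_sa hH bv Q1.
have idem (b : bool) (z : R[i]) : (b%:R : R)%:C * ((b%:R : R)%:C * z) = (b%:R : R)%:C * z.
  by case: b; rewrite ?mul1r ?mul0r.
have PP x : P (P x) = P x by apply: (onb_eq hH be) => i; rewrite !P1 idem.
have QQ x : Q (Q x) = Q x by apply: (onb_eq hH bv) => i; rewrite !Q1 idem.
have Pe i : P (e i) = if c <= d i then e i else 0.
  apply: (onb_eq hH be) => k; rewrite P1 (onb_family be).
  case: eqVneq => [->|ne]; last by rewrite mulr0; case: ifP;
    rewrite ?ip0l ?(onb_family be) ?(negPf ne).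
  by case: ifP; rewrite ?ip0l ?mul0r// (onb_family be) eqxx mul1r.
have hiE i : (sq (Q (P (e i)) - P (e i)))%:E = cross_high l d w c i.
  rewrite -(onb_parseval hH bv); apply: eq_nsum => j; rewrite Pe cw_nc ipBl Q1.
  case: (c <= d i) => /=; last by rewrite ip0l mulr0 subrr nc0.
  rewrite leNgt; case: (c < l j) => /=; first by rewrite mul1r subrr nc0.
  by rewrite rmorph0 mul0r sub0r -mulN1r ncM -cw_nc /nc /= oppr0 sqrrN expr1n expr0n addr0 mul1r.
have loE i : (sq (Q (e i - P (e i))))%:E = cross_low l d w c i.
  rewrite -(onb_parseval hH bv); apply: eq_nsum => j; rewrite Pe cw_nc Q1 [d i < c]ltNge.
  case: (c <= d i) => /=; first by rewrite subrr ip0l mulr0 nc0.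
  by rewrite subr0; case: (c < l j) => /=; rewrite ?mul1r// mul0r nc0.
have hiT : cross_high_total l d w c = nsum (fun i => sq (Q (P (e i)) - P (e i))).
  by apply: eq_esum => i _; rewrite hiE.
have loT : cross_low_total l d w c = nsum (fun i => sq (Q (e i - P (e i)))).
  by apply: eq_esum => i _; rewrite loE.
rewrite hiT loT => lo hi; exact: (projection_pair_index hH be sP sQ PP QQ hi lo).
Qed.

End CrossTerms.

(** The inverse is the function of E equal to 1 / (t - mu) on [p] and 0 elsewhere. Invariance of V
    under all functions of E keeps this inverse inside V. *)
Lemma invertible_on_part (V : set H) (p : R -> bool) (mu : R[i]) (c : R) : 0 < c ->
  (forall (D : H -> H) (m : R -> R[i]),
     (forall x j, ip (D x) (v j) = m (l j) * ip x (v j)) -> invariant_under D V) ->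
  (forall x j, V x -> ~~ p (l j) -> ip x (v j) = 0) ->
  (forall t, p t -> c <= nc (t%:C - mu)) -> invertible_on V (Defs.shift E mu).
Proof.
move=> c0 VD Vp pc; pose m t := if p t then (t%:C - mu)^-1 else 0.
have mC j : nc (m (l j)) <= c^-1.
  rewrite /m; case: ifPn => [/pc h|_]; last by rewrite nc0 invr_ge0 ltW.
  have n0 : 0 < nc ((l j)%:C - mu) by exact: lt_le_trans h.
  rewrite -(ler_pM2l n0) -ncM divff; last by apply: contraTneq n0 => ->; rewrite nc0 ltxx.
  by rewrite /nc /= expr1n expr0n addr0 ler_pdivlMr// mul1r.
have ci : 0 <= c^-1 by rewrite invr_ge0 ltW.
have [S [S1 SK]] := diagonal_operator hH bv ci mC.
have mE x j : V x -> m (l j) * (((l j)%:C - mu) * ip x (v j)) = ip x (v j).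
  move=> Vx; rewrite /m; case: ifPn => [h|/(Vp _ _ Vx) ->]; last by rewrite mul0r.
  rewrite mulrA mulVf ?mul1r//.
  by apply: contraTneq (lt_le_trans c0 (pc _ h)) => ->; rewrite nc0 ltxx.
exists S; split.
- exact: VD S1.
- by move=> b x y _ _; apply: (onb_eq hH bv) => j; rewrite !(S1, ipDl, ipZl); ring.
- by apply: (sq_bounded_on hH) => x _; exact: SK.
- by move=> x Vx; apply: (onb_eq hH bv) => j; rewrite S1 shift_coord mE.
- by move=> x Vx; apply: (onb_eq hH bv) => j; rewrite shift_coord S1 mulrCA mE.
Qed.

Section Decoupling.
Context (I : countType) (e : I -> H) (d : I -> R) (a : R).
Hypothesis be : orthonormal_basis ip e.
Hypothesis low : forall i j, d i < a -> a < l j -> ip (e i) (v j) = 0.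
Hypothesis high : forall i j, a <= d i -> l j < a -> ip (e i) (v j) = 0.

Let lowV i j : d i < a -> a < l j -> ip (v j) (e i) = 0.
Proof. by move=> h1 h2; rewrite ipC low// rmorph0. Qed.
Let highV i j : a <= d i -> l j < a -> ip (v j) (e i) = 0.
Proof. by move=> h1 h2; rewrite ipC high// rmorph0. Qed.

Let H0P x : clspan (e @` [set i | d i < a]) x <-> forall i, a <= d i -> ip x (e i) = 0.
Proof.
rewrite (onb_clspan hH be); split=> h i hi; apply: h => /=; first by rewrite ltNge hi.
by rewrite leNgt; apply/negP.
Qed.

Let H1P x : clspan (e @` [set i | a <= d i]) x <-> forall i, d i < a -> ip x (e i) = 0.
Proof.
rewrite (onb_clspan hH be); split=> h i hi; apply: h => /=; first by rewrite leNgt hi.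
by rewrite ltNge; apply/negP.
Qed.

Let H0v x j : clspan (e @` [set i | d i < a]) x -> a < l j -> ip x (v j) = 0.
Proof.
move=> Vx lj; rewrite ipC (clspan_orth hH Vx) ?rmorph0// => _ [i /= di <-].
exact: lowV.
Qed.

Let H1v x j : clspan (e @` [set i | a <= d i]) x -> l j < a -> ip x (v j) = 0.
Proof.
move=> Vx lj; rewrite ipC (clspan_orth hH Vx) ?rmorph0// => _ [i /= di <-].
exact: highV.
Qed.

(* Only the eigenvectors for [a] can meet both parts, and there [D] is scalar. *)
Let invariant (D : H -> H) (m : R -> R[i]) :
  (forall x j, ip (D x) (v j) = m (l j) * ip x (v j)) ->
  invariant_under D (clspan (e @` [set i | d i < a])) /\
  invariant_under D (clspan (e @` [set i | a <= d i])).
Proof.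
move=> D1; split => x Vx; [apply/H0P => i di|apply/H1P => i di].
  have xi := (H0P x).1 Vx i di.
  have -> : ip (D x) (e i) = ip (D x - m a *: x) (e i) by rewrite ipBl ipZl xi mulr0 subr0.
  apply: (ip0_disjoint hH bv) => j; rewrite ipBl ipZl D1 -mulrBl.
  have [lj|lj|->] := ltgtP (l j) a; [right|left|left].
  - exact: high.
  - by rewrite (H0v Vx lj) mulr0.
  - by rewrite subrr mul0r.
have xi := (H1P x).1 Vx i di.
have -> : ip (D x) (e i) = ip (D x - m a *: x) (e i) by rewrite ipBl ipZl xi mulr0 subr0.
apply: (ip0_disjoint hH bv) => j; rewrite ipBl ipZl D1 -mulrBl.
have [lj|lj|->] := ltgtP (l j) a; [left|right|left].
- by rewrite (H1v Vx lj) mulr0.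
- exact: low.
- by rewrite subrr mul0r.
Qed.

(** A positive lower bound for the squared distance from mu to P: the squared imaginary part if mu
    is not real, else the squared distance to b, which will be the end point of a half-line P. *)
Let gap (P : set R) (b : R) (mu : R[i]) : ~ [set t%:C | t in P] mu ->
  (forall t x, P t -> ~ P x -> (x - b) ^+ 2 <= (t - x) ^+ 2 /\ x != b) ->
  exists2 c, 0 < c & forall t, P t -> c <= nc (t%:C - mu).
Proof.
case: mu => x y hmu hP; have [y0|y0] := eqVneq y 0.
  have nx : ~ P x by move=> Px; apply: hmu; exists x => //; rewrite y0.
  have [[t0 Pt0]|nP] := pselect (exists t, P t); last first.
    by exists 1 => // t Pt; exfalso; apply: nP; exists t.
  exists ((x - b) ^+ 2).
    by rewrite exprn_even_gt0//= subr_eq0; have [] := hP t0 x Pt0 nx.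
  move=> t Pt; rewrite /nc /=; have [h _] := hP t x Pt nx.
  by apply: le_trans h _; rewrite lerDl sqr_ge0.
exists (y ^+ 2); first by rewrite exprn_even_gt0.
by move=> t _; rewrite /nc /= sub0r sqrrN lerDr sqr_ge0.
Qed.

Lemma decouples_at_orthogonal : decouples_at E e d a.
Proof.
have [i0 i1] := @invariant E (fun t => t%:C) eigen_coord.
split => // mu hmu; apply: contrapT => hn; apply: hmu.
  have [|c c0 hc] := gap (b := a) hn.
    move=> t x /= ta /negP; rewrite -ltNge => xa; split; last by rewrite gt_eqF.
    have -> : (t - x) ^+ 2 = (x - t) ^+ 2 by rewrite -sqrrN opprB.
    by rewrite lerXn2r ?nnegrE; lra.
  apply: (invertible_on_part (p := fun t => t <= a) c0 _ _ hc) => [D m D1|x j Vx].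
    by have [] := invariant D1.
  by rewrite -ltNge; exact: H0v.
have [|c c0 hc] := gap (b := a) hn.
  move=> t x /= ta /negP; rewrite -ltNge => xa; split; last by rewrite lt_eqF.
  have -> : (x - a) ^+ 2 = (a - x) ^+ 2 by rewrite -sqrrN opprB.
  by rewrite lerXn2r ?nnegrE; lra.
apply: (invertible_on_part (p := fun t => a <= t) c0 _ _ hc) => [D m D1|x j Vx].
  by have [] := invariant D1.
by rewrite -ltNge; exact: H1v.
Qed.

End Decoupling.
End EigenBasis.

(** * Vanishing total excess and accumulation points of the diagonal *)

Section Accumulation.
Context {R : realType} (I J : countType) (l : J -> R) (d : I -> R) (w : I -> J -> R) (M : R).
Hypotheses (lM : forall j, `|l j| <= M) (w0 : forall i j, 0 <= w i j).
Hypothesis rows : forall i, nsum (w i) = 1%E.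
Hypothesis cols : forall j, nsum (w ^~ j) = 1%E.
Hypothesis mean : forall i, rsum (fun j => w i j * l j) = d i.

Let z0 (i : I) : 0 <= (0 : R) := lexx 0.
Let rows' i : (nsum (w i) + (0 + 0)%:E = 1)%E. Proof. by rewrite addr0 adde0. Qed.
Let mean' i : rsum (fun j => w i j * l j) + 0 = d i. Proof. by rewrite addr0. Qed.
Let cols' j : ~~ (0 <= l j <= 1) -> nsum (w ^~ j) = 1%E. Proof. by []. Qed.

Local Notation ET := (total_excess l d w (fun=> 0) (fun=> 0)).

Lemma total_excess_eq0 a : ET a = 0%E -> forall i j, w i j * split_part (d i) a (l j) = 0.
Proof.
move=> Ta i j.
have ex0 i' : 0 <= excess l (w i') 0 0 (d i') a by exact: excess_ge0.
have Ta0 : (ET a <= 0)%E by rewrite Ta.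
have ei := nsum0 ex0 Ta0 i.
apply/eqP; rewrite eq_le mulr_ge0 ?split_part_ge0// andbT -ei.
exact: (excess_weight (d i) lM (w0 i) (lexx 0) (lexx 0) (rows' i)).
Qed.

Hypothesis mid : (ET (2^-1)%R < +oo)%E.
Variable a : R.
Hypotheses (a01 : 0 < a < 1) (da : (majf d a < +oo)%E).

Let half : 0 < (2^-1 : R) < 1. Proof. by lra. Qed.

Let tent_finite eps : 0 < eps -> finite_set [set i | eps <= tent 2^-1 (d i)].
Proof.
apply: finite_ge_nsum => [i|]; first exact: tent_ge0.
by rewrite -majf_mid//; exact: majf_mid_lty da.
Qed.

(** If only finitely many d_i were near 0, only finitely many would lie below 1/2, since f_d is
    finite at -eps/2 and at 1/2. Almost every row would then have the eigenvalues below 1/4 across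
    the level 1/2 at distance 1/4 or more, and [finite_transfer] would leave finitely many of
    those. *)
Lemma accumulation_at0 : (forall b, b < 0 -> (majf l b < +oo)%E) ->
  infinite_set [set j | `|l j - 0| < 4^-1] -> accumulation_point d 0.
Proof.
move=> lfin linf eps e0 fin; apply: linf.
have e2 : - (eps / 2) < 0 by lra.
have f1 : finite_set [set i | eps / 2 <= negp (- (eps / 2)) (d i)].
  apply: finite_ge_nsum => [i||]; [exact: negp_ge0| |lra].
  rewrite -majf_le0 ?(ltW e2)//; apply: le_lt_trans (lfin _ e2).
  rewrite (majf_le0_excess lM w0 z0 z0 rows' mean' cols' (ltW e2)).
  by rewrite leeDl// total_excess_ge0.
have f2 := tent_finite (ltac:(lra) : 0 < eps / 2).
have fd : finite_set [set i | d i < 2^-1].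
  apply: sub_finite_set (_ : _ `<=` _ `|` (_ `|` _)) _; last first.
    by rewrite !finite_setU; split; [exact: fin|split; [exact: f1|exact: f2]].
  move=> i /= di; have [h|h] := ltP `|0 - d i| eps; first by left.
  right; move: h; rewrite sub0r normrN; have [d0|d0] := leP 0 (d i).
    rewrite ger0_norm// => h; right.
    by rewrite tent_inside// ?di; [lra|apply/andP; split; lra].
  rewrite ltr0_norm// => h; left; rewrite /negp le_max; apply/orP; left; lra.
apply: sub_finite_set (_ : _ `<=` [set j | l j < 4^-1]) _.
  by move=> j /=; rewrite subr0 => /(le_lt_trans (ler_norm _)).
apply: (@finite_transfer _ _ _ l d w M lM w0 rows cols 2^-1 4^-1 (fun j => l j < 4^-1)) => //.
apply: sub_finite_set fd => i /= hn; rewrite ltNge; apply/negP => di; apply: hn => j lj.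
rewrite /split_part ltNge di /= /negp le_max; apply/orP; left; lra.
Qed.

Lemma accumulation_at1 : (forall b, 1 < b -> (majf l b < +oo)%E) ->
  infinite_set [set j | `|l j - 1| < 4^-1] -> accumulation_point d 1.
Proof.
move=> lfin linf eps e0 fin; apply: linf.
have e2 : 1 < 1 + eps / 2 by lra.
have f1 : finite_set [set i | eps / 2 <= posp (1 + eps / 2) (d i)].
  apply: finite_ge_nsum => [i||]; [exact: posp_ge0| |lra].
  rewrite -majf_ge1 ?(ltW e2)//; apply: le_lt_trans (lfin _ e2).
  rewrite (majf_ge1_excess lM w0 z0 z0 rows' mean' cols' (ltW e2)).
  by rewrite leeDl// total_excess_ge0.
have f2 := tent_finite (ltac:(lra) : 0 < eps / 2).
have fd : finite_set [set i | 2^-1 <= d i].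
  apply: sub_finite_set (_ : _ `<=` _ `|` (_ `|` _)) _; last first.
    by rewrite !finite_setU; split; [exact: fin|split; [exact: f1|exact: f2]].
  move=> i /= di; have [h|h] := ltP `|1 - d i| eps; first by left.
  right; move: h; have [d0|d0] := leP (d i) 1.
    rewrite ger0_norm ?subr_ge0// => h; right.
    by rewrite tent_inside// ?ltNge ?di /=; [lra|apply/andP; split; lra].
  rewrite ltr0_norm ?subr_lt0// => h; left; rewrite /posp le_max; apply/orP; left; lra.
apply: sub_finite_set (_ : _ `<=` [set j | 3 / 4 < l j]) _.
  move=> j /=; rewrite ltr_norml => /andP[]; lra.
apply: (@finite_transfer _ _ _ l d w M lM w0 rows cols 2^-1 4^-1 (fun j => 3 / 4 < l j)) => //.
apply: sub_finite_set fd => i /= hn; rewrite leNgt; apply/negP => di; apply: hn => j lj.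
rewrite /split_part di /= /posp le_max; apply/orP; left; lra.
Qed.

End Accumulation.

Theorem theorem4p1 (R : realType) (H : completeNormedModType R[i])
    (ip : {dot H for (@Num.conj R[i])})
    (hH : hilbert_norm ip)
    (hsep : separable_space (H := H))
    (hinf : ~ finite_dimensional [set: H])
    (E : {linear H -> H})
    (hbnd : bounded_on setT E)
    (hsa : self_adjoint ip E)
    (hess01 : [set 0; 1] `<=` essential_spectrum E)
    (hess : essential_spectrum E `<=` [set t%:C | t in [set t : R | 0 <= t <= 1]])
    (J : countType) (l : J -> R)
    (hl : eigenvalue_list ip E l)
    (I : countType) (e : I -> H)
    (he : orthonormal_basis ip e)
    (d : I -> R)
    (hd : forall i, (d i)%:C = ip (E (e i)) (e i))
    (hfin : exists a : R, 0 < a < 1 /\ (majf d a < +oo)%E)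
    (hdelta : (deltaL l d + deltaU l d < +oo)%E) :
  [/\ diagonalizable_op ip E,
      accumulation_point d 0,
      accumulation_point d 1 &
      exists d0 d1 : R,
        [/\ 0 <= d0 /\ (d0%:E <= deltaL l d)%E,
            0 <= d1 /\ (d1%:E <= deltaU l d)%E,
            [/\ (forall a : R, 0 < a < 1 -> (majf l a < +oo)%E),
                (forall a : R, 0 < a < 1 ->
                   (majf l a <= majf d a + ((1 - a) * d0 + a * d1)%:E)%E),
                (exists a : R,
                   [/\ 0 < a < 1, ediff_at (majf l) a, ediff_at (majf d) a &
                       exists n : int,
                         derive1 (fine \o majf l) a - derive1 (fine \o majf d) a
                           = d1 - d0 + n%:~R]),
                ((\esum_(j in [set j | (l j < 0)%R]) (`|l j|%R)%:E < +oo)%E ->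
                   (deltaL l d - d0%:E <= deltaU l d - d1%:E)%E) &
                ((\esum_(j in [set j | (1 < l j)%R]) (l j - 1)%:E < +oo)%E ->
                   (deltaU l d - d1%:E <= deltaL l d - d0%:E)%E)] &
            (forall a : R, 0 <= a <= 1 ->
               decoupling_condition l d d0 d1 a -> decouples_at E e d a)]].
Proof.
have [K EK] := bounded_on_sq hH hbnd.
have sE : self_adjoint ip E := hsa.
have fredE (mu : R) : ~~ (0 <= mu <= 1) -> fredholm (Defs.shift E mu%:C).
  move=> mu01; apply: contrapT => /hess[t t01 /complexI tmu].
  by move: mu01; rewrite -tmu t01.
have [v [ov hv cE]] := eigenvalue_list_family hH sE hl.
have [a0 [a01 da]] := hfin.
have hd' i : d i = rip ip (E (e i)) (e i) by rewrite /rip -hd.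
have ker := eigenvectors_complete hH sE EK fredE ov hv cE he hd' a01 da hdelta.
have bv : orthonormal_basis ip v.
  split=> [i j _ _|]; first exact: ov.
  apply/seteqP; split => // x _; apply/(clspanP hH ov) => z hz.
  by rewrite (ker z) ?ip0l// => j; exact: hz.
pose w i j := cw ip (e i) (v j).
pose ET := total_excess l d w (fun=> 0) (fun=> 0).
have w0 i j : 0 <= w i j by exact: cw_ge0.
have rows i : nsum (w i) = 1%E.
  by rewrite -(onf_sq (onb_family he) i) -(onb_parseval hH bv).
have cols j : nsum (w ^~ j) = 1%E.
  rewrite -(onf_sq ov j) -(onb_parseval hH he); apply: eq_nsum => i.
  by rewrite /w cwC.
have mean i : rsum (fun j => w i j * l j) = d i.
  by rewrite hd' (eigen_expansion hH sE EK ov hv)// bv.2.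
have lM j : `|l j| <= Num.sqrt K by exact: (eigenvalue_bounded EK ov hv).
have z0 (i : I) : 0 <= (0 : R) by exact: lexx.
have rows' i : (nsum (w i) + (0 + 0)%:E = 1)%E by rewrite addr0 adde0.
have mean' i : rsum (fun j => w i j * l j) + 0 = d i by rewrite addr0.
have cols' j : ~~ (0 <= l j <= 1) -> nsum (w ^~ j) = 1%E by [].
have below := majf_eigen_below hH sE EK fredE ov hv.
have above := majf_eigen_above hH sE EK fredE ov hv.
have tL : (ET 0%R <= deltaL l d)%E by exact: total_excess_left below.
have tU : (ET 1%R <= deltaU l d)%E by exact: total_excess_right above.
have T0 b : (0 <= ET b)%E by exact: total_excess_ge0.
have dL0 : (0 <= deltaL l d)%E by exact: le_trans (T0 _) tL.
have dU0 : (0 <= deltaU l d)%E by exact: le_trans (T0 _) tU.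
have dL1 : (deltaL l d < +oo)%E by apply: le_lt_trans hdelta; rewrite leeDl.
have dU1 : (deltaU l d < +oo)%E by apply: le_lt_trans hdelta; rewrite leeDr.
have [d0 d0E] : exists r, ET 0%R = r%:E.
  by exists (fine (ET 0%R)); rewrite fineK// ge0_fin_numE// (le_lt_trans tL).
have [d1 d1E] : exists r, ET 1%R = r%:E.
  by exists (fine (ET 1%R)); rewrite fineK// ge0_fin_numE// (le_lt_trans tU).
have dfin a : 0 < a < 1 -> (majf d a < +oo)%E by move=> h; exact: majf_mid_lty da.
have EQ a : 0 < a < 1 ->
    (majf l a + ET a = majf d a + ((1 - a) * d0 + a * d1)%:E)%E.
  by move=> h; rewrite (majf_mid_excess lM w0 z0 z0 rows' mean' cols h) -/ET d0E d1E.
have lE a : 0 < a < 1 -> (majf l a <= majf d a + ((1 - a) * d0 + a * d1)%:E)%E.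
  by move=> /EQ <-; rewrite leeDl.
have lfin a : 0 < a < 1 -> (majf l a < +oo)%E.
  by move=> h; apply: le_lt_trans (lE a h) _; rewrite lte_add_pinfty ?ltry// dfin.
have mid : (ET (2^-1)%R < +oo)%E.
  have h : 0 < (2^-1 : R) < 1 by rewrite invr_gt0 ltr0n invf_lt1 ?ltr1n.
  apply: (@le_lt_trans _ _ (majf l (2^-1)%R + ET (2^-1)%R)%E).
    by rewrite leeDr// majf_ge0.
  by rewrite EQ// lte_add_pinfty ?ltry// dfin.
have inf (mu : R) : (mu = 0) \/ (mu = 1) -> infinite_set [set j | `|l j - mu| < 4^-1].
  move=> hmu; apply: (essential_infinite hH sE bv hv); last by rewrite invr_gt0.
  by apply: hess01; case: hmu => ->; [left|right].
split.
- by exists J, v; split => // j; exists (l j)%:C; exact: hv.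
- exact: (accumulation_at0 lM w0 rows cols mean mid a01 da below (inf 0 (or_introl erefl))).
- exact: (accumulation_at1 lM w0 rows cols mean mid a01 da above (inf 1 (or_intror erefl))).
exists d0, d1; split.
- by rewrite -lee_fin -d0E.
- by rewrite -lee_fin -d1E.
- split => //.
  + apply: (slope_congruence lM w0 rows cols mean a01 da d0E d1E) => c.
    exact: (cross_totals_congruent hH bv he).
  + move=> hneg; have l0 : (majf l 0 < +oo)%E.
      rewrite majf_le0//; apply: le_lt_trans hneg; rewrite [leRHS]esum_mkcond.
      apply: le_esum => j _; case: ifPn => [/set_mem /= h|/negP h].
        by rewrite lee_fin /negp sub0r (ltr0_norm h) ge_max lexx /= oppr_ge0 ltW.
      rewrite lee_fin /negp sub0r max_r// oppr_le0 leNgt; apply/negP => h'.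
      by apply/h/mem_set.
    (* The left side of (iv) becomes 0, and the right side is nonnegative because T(1) is at most
       the upper liminf. *)
    have -> : deltaL l d = d0%:E.
      by apply/eqP; rewrite eq_le -d0E tL andbT; exact: (deltaL_le lM w0 rows cols mean l0).
    by rewrite -EFinB subrr leeBrDr// add0e -d1E.
  + move=> hpos; have l0 : (majf l 1 < +oo)%E.
      rewrite majf_ge1//; apply: le_lt_trans hpos; rewrite [leRHS]esum_mkcond.
      apply: le_esum => j _; case: ifPn => [/set_mem /= h|/negP h].
        by rewrite lee_fin /posp ge_max lexx /= subr_ge0 ltW.
      rewrite lee_fin /posp max_r// subr_le0 leNgt; apply/negP => h'.
      by apply/h/mem_set.
    have -> : deltaU l d = d1%:E.
      by apply/eqP; rewrite eq_le -d1E tU andbT; exact: (deltaU_le lM w0 rows cols mean l0).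
    by rewrite -EFinB subrr leeBrDr// add0e -d0E.
move=> a a01' hdec.
(* Every decoupling condition forces T(a) = 0: at 0 and 1 through 0 <= T <= delta, or because
   delta_0 or delta_1 is itself 0; in between by cancelling the finite f_l(a). *)
have Ta : ET a = 0%E.
  apply/eqP; rewrite eq_le T0 andbT; case: hdec.
  - move=> [-> [dL|[d00 _]]]; last by rewrite d0E d00.
    by rewrite -dL.
  - move=> [h hE]; have := EQ a h; rewrite -hE => hl0.
    have lf : majf l a \is a fin_num by rewrite ge0_fin_numE ?majf_ge0// lfin.
    by rewrite -(leeD2lE _ _ lf) hl0 adde0.
  - move=> [-> [dU|[d10 _]]]; last by rewrite d1E d10.
    by rewrite -dU.
have wE := total_excess_eq0 lM w0 rows Ta.
(* T(a) = 0 kills the weight wherever [split_part] is nonzero, which includes every pair strictly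
   across [a]. *)
have off i j : split_part (d i) a (l j) != 0 -> ip (e i) (v j) = 0.
  move=> n0; apply: (@cw_eq0 _ _ ip); have /eqP := wE i j.
  by rewrite mulf_eq0 (negPf n0) orbF => /eqP.
apply: (decouples_at_orthogonal hH sE bv hv he) => i j hi hj; apply: off.
  by rewrite /split_part hi /posp gt_eqF// lt_max subr_gt0 hj.
by rewrite /split_part ltNge hi /= /negp gt_eqF// lt_max subr_gt0 hj.
Qed.
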